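(* Let $G$ be the simply connected simple complex algebraic group of type $E_7$ and let $H\subset G$ be a maximal reductive subgroup of type $D_6\times A_1$. Then for all $k\in\mathbb{N}$ $$\mathrm{res}^G_H(V_{k\omega_7})=\bigoplus_{a_1+2a_2+a_3=k}V_{a_1\lambda_1+a_2\lambda_2+a_3\lambda_6}\otimes V_{a_1\lambda_7},$$ where the $a_i$ run over non-negative integers.
   Context: The ground field is $\mathbb{C}$. Fix a maximal torus $T$ and a Borel subgroup $B\supset T$ of $G$, with simple roots $\alpha_1,\ldots,\alpha_7$ and fundamental weights $\omega_1,\ldots,\omega_7$ in Bourbaki numbering. The subgroup $H$ is (up to conjugacy) the connected subsystem subgroup containing $T$ whose $D_6$ factor has simple roots $\beta_1=\alpha_2+\alpha_3+2\alpha_4+2\alpha_5+2\alpha_6+\alpha_7$, $\beta_2=\alpha_1$, $\beta_3=\alpha_3$, $\beta_4=\alpha_4$, $\beta_5=\alpha_2$, $\beta_6=\alpha_5$ (Bourbaki numbering of $D_6$) and whose $A_1$ factor has simple root $\beta_7=\alpha_7$. $\lambda_1,\ldots,\lambda_6$ are the corresponding fundamental weights of the $D_6$ factor and $\lambda_7$ the fundamental weight of the $A_1$ factor. $V_\mu$ denotes the irreducible module of highest weight $\mu$ (of $G$, or of the relevant factor of $H$); $V_\mu\otimes V_\nu$ is the outer tensor product of a $D_6$-module and an $A_1$-module, viewed as an $H$-module. $\mathrm{res}^G_H$ denotes restriction of a $G$-module to $H$; equality means isomorphism of $H$-modules. *)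

(* Defs.v *)
(* MathComp world. *)
From mathcomp Require Import all_boot all_order all_algebra.
From mathcomp Require Import mpoly mxtens.

Set Implicit Arguments.
Unset Strict Implicit.
Unset Printing Implicit Defensive.

Import GRing.Theory.
Local Open Scope ring_scope.

(* The simply connected group of type E7 is taken in Chevalley's form (see
   Steinberg, "Lectures on Chevalley groups"): start from a representation of
   the simple Lie algebra of type E7 on F^n, given by the images e_i, f_i, h_i
   of the Chevalley generators, whose weights generate the whole weight
   lattice, and let G be the subgroup of GL_n(F) generated by the exponentials
   of root vectors.  F is meant to be the field of complex numbers.  Every
   embedding of the simply connected group in some GL_n is obtained in this
   way, together with a maximal torus, a Borel subgroup containing it and a
   choice of simple root vectors.

   Bourbaki's labels 1, .., r are the ordinals 0, .., r - 1.  An element of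
   the root lattice is the row of its coordinates on the simple roots, an
   element of the weight lattice the row of its coordinates on the fundamental
   weights. *)

Definition int_table (m n : nat) (s : seq (seq int)) : 'M[int]_(m, n) :=
  \matrix_(i, j) nth 0 (nth [::] s i) j.

Definition cartanE7 : 'M[int]_7 := int_table 7 7
  [:: [::  2 ;  0 ; -1 ;  0 ;  0 ;  0 ;  0 ];
      [::  0 ;  2 ;  0 ; -1 ;  0 ;  0 ;  0 ];
      [:: -1 ;  0 ;  2 ; -1 ;  0 ;  0 ;  0 ];
      [::  0 ; -1 ; -1 ;  2 ; -1 ;  0 ;  0 ];
      [::  0 ;  0 ;  0 ; -1 ;  2 ; -1 ;  0 ];
      [::  0 ;  0 ;  0 ;  0 ; -1 ;  2 ; -1 ];
      [::  0 ;  0 ;  0 ;  0 ;  0 ; -1 ;  2 ]].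

Definition alpha (i : 'I_7) : 'rV[int]_7 := delta_mx 0 i.

Definition beta (i : 'I_7) : 'rV[int]_7 := row i (int_table 7 7
  [:: [:: 0 ; 1 ; 1 ; 2 ; 2 ; 2 ; 1 ];
      [:: 1 ; 0 ; 0 ; 0 ; 0 ; 0 ; 0 ];
      [:: 0 ; 0 ; 1 ; 0 ; 0 ; 0 ; 0 ];
      [:: 0 ; 0 ; 0 ; 1 ; 0 ; 0 ; 0 ];
      [:: 0 ; 1 ; 0 ; 0 ; 0 ; 0 ; 0 ];
      [:: 0 ; 0 ; 0 ; 0 ; 1 ; 0 ; 0 ];
      [:: 0 ; 0 ; 0 ; 0 ; 0 ; 0 ; 1 ]]).

Definition betaD6 (i : 'I_6) : 'rV[int]_7 := beta (widen_ord (leqnSn 6) i).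

Definition betaA1 (_ : 'I_1) : 'rV[int]_7 := beta ord_max.

Section LinearLieAlgebra.

Variables (F : fieldType) (n : nat).

Definition bracket (X Y : 'M[F]_n) : 'M[F]_n := X *m Y - Y *m X.

Inductive lie_generated (S : 'M[F]_n -> Prop) : 'M[F]_n -> Prop :=
| LieIn X : S X -> lie_generated S X
| LieAdd X Y : lie_generated S X -> lie_generated S Y -> lie_generated S (X + Y)
| LieScale c X : lie_generated S X -> lie_generated S (c *: X)
| LieBracket X Y :
    lie_generated S X -> lie_generated S Y -> lie_generated S (bracket X Y).

Inductive group_generated (S : 'M[F]_n -> Prop) : 'M[F]_n -> Prop :=
| GroupIn g : S g -> group_generated S g
| GroupOne : group_generated S 1%:M
| GroupMul g k :
    group_generated S g -> group_generated S k -> group_generated S (g *m k)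
| GroupInv g : group_generated S g -> group_generated S (invmx g).

(* Only used for nilpotent X, for which X ^+ n = 0 and the sum is the full
   exponential series. *)
Definition exp_nilp (X : 'M[F]_n) : 'M[F]_n :=
  \sum_(k < n.+1) (k`!%:R)^-1 *: X ^+ k.

Definition weight_vector (h : 'I_7 -> 'M[F]_n) (m : 'rV[int]_7) (v : 'cV[F]_n) :=
  v != 0 /\ forall i, h i *m v = (m 0 i)%:~R *: v.

(* The first six fields are the Chevalley-Serre relations; the last one says
   that every element of the weight lattice is an integral combination of
   weights of F^n. *)
Record E7_realization := E7Realization {
  re : 'I_7 -> 'M[F]_n;
  rf : 'I_7 -> 'M[F]_n;
  rh : 'I_7 -> 'M[F]_n;
  re_hh : forall i j, bracket (rh i) (rh j) = 0;
  re_he : forall i j, bracket (rh i) (re j) = (cartanE7 i j)%:~R *: re j;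
  re_hf : forall i j, bracket (rh i) (rf j) = - (cartanE7 i j)%:~R *: rf j;
  re_ef : forall i j, bracket (re i) (rf j) = if i == j then rh i else 0;
  re_ee : forall i j, i != j ->
    iter `|1 - cartanE7 i j|%N (bracket (re i)) (re j) = 0;
  re_ff : forall i j, i != j ->
    iter `|1 - cartanE7 i j|%N (bracket (rf i)) (rf j) = 0;
  re_weights : forall m : 'rV[int]_7, exists s : seq (int * 'rV[int]_7),
    (forall p, p \in s -> exists v, weight_vector rh p.2 v)
    /\ m = \sum_(p <- s) p.2 *~ p.1
}.

End LinearLieAlgebra.

Section Groups.

Variables (F : fieldType) (n : nat) (X : E7_realization F n).

Definition lieE7 : 'M[F]_n -> Prop :=
  lie_generated (fun Y => exists i, Y = re X i \/ Y = rf X i).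

Definition root_space (a : 'rV[int]_7) (Y : 'M[F]_n) : Prop :=
  lieE7 Y /\
  forall i, bracket (rh X i) Y = (\sum_j cartanE7 i j * a 0 j)%:~R *: Y.

Definition root_subgroup (a : 'rV[int]_7) (g : 'M[F]_n) : Prop :=
  exists2 Y, root_space a Y & g = exp_nilp Y.

(* t is the element of the maximal torus on which the fundamental weight
   omega_j takes the value z j; it acts on the weight space of weight m as the
   scalar m(t).  As F^n is the sum of its weight spaces, t is determined by z,
   and t lies in G. *)
Definition torus_elt (z : 'I_7 -> F) (t : 'M[F]_n) : Prop :=
  forall m v, weight_vector (rh X) m v -> t *m v = (\prod_j z j ^ m 0 j) *: v.

Definition torus (t : 'M[F]_n) : Prop :=
  exists2 z, (forall j, z j != 0) & torus_elt z t.

(* E7 is simply laced: the coroot of the root with coordinates a on the simple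
   roots has the same coordinates a on the simple coroots, so that omega_j
   takes the value s ^ a_j on a^vee(s). *)
Definition coroot_elt (a : 'rV[int]_7) (s : F) (t : 'M[F]_n) : Prop :=
  torus_elt (fun j => s ^ a 0 j) t.

Definition root_group (r : nat) (b : 'I_r -> 'rV[int]_7) : 'M[F]_n -> Prop :=
  group_generated
    (fun g => exists i, root_subgroup (b i) g \/ root_subgroup (- b i) g).

Definition groupE7 := root_group alpha.

Definition factorD6 := root_group betaD6.

Definition factorA1 := root_group betaA1.

Definition groupH : 'M[F]_n -> Prop :=
  group_generated (fun g => torus g \/
    exists i, root_subgroup (beta i) g \/ root_subgroup (- beta i) g).

(* A function rho is only considered on the group K.  The groups used here are
   contained in SL_n, so their regular functions are the restrictions of the
   polynomials in the matrix entries. *)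
Definition rational_rep (K : 'M[F]_n -> Prop) (d : nat)
    (rho : 'M[F]_n -> 'M[F]_d) : Prop :=
  [/\ rho 1%:M = 1%:M,
      forall g k, K g -> K k -> rho (g *m k) = rho g *m rho k
    & forall i j, exists p : {mpoly F[n * n]},
        forall g, K g -> rho g i j = p.@[fun l => mxvec g 0 l]].

Definition irreducible_rep (K : 'M[F]_n -> Prop) (d : nat)
    (rho : 'M[F]_n -> 'M[F]_d) : Prop :=
  (0 < d)%N /\
  forall U : {vspace 'cV[F]_d},
    (forall g v, K g -> v \in U -> rho g *m v \in U) ->
    U = 0%VS \/ U = fullv.

(* v spans a line stable under the Borel subgroup with simple roots b, on which
   the maximal torus acts by the weight taking the value m i on the i-th simple
   coroot. *)
Definition highest_weight_vector (r : nat) (b : 'I_r -> 'rV[int]_7)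
    (m : 'I_r -> nat) (d : nat) (rho : 'M[F]_n -> 'M[F]_d) (v : 'cV[F]_d) :=
  [/\ v != 0,
      forall i g, root_subgroup (b i) g -> rho g *m v = v
    & forall i s t, s != 0 -> coroot_elt (b i) s t ->
        rho t *m v = s ^+ m i *: v].

Definition irreducible_of_hw (r : nat) (b : 'I_r -> 'rV[int]_7)
    (m : 'I_r -> nat) (d : nat) (rho : 'M[F]_n -> 'M[F]_d) : Prop :=
  [/\ rational_rep (root_group b) rho,
      irreducible_rep (root_group b) rho
    & exists v, highest_weight_vector b m rho v].

(* H = D6 . A1 is a quotient of D6 x A1 by a central subgroup of order 2, hence
   the existence of tau is part of what has to be proved. *)
Definition is_outer_tensor (d1 d2 : nat) (rho1 : 'M[F]_n -> 'M[F]_d1)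
    (rho2 : 'M[F]_n -> 'M[F]_d2) (tau : 'M[F]_n -> 'M[F]_(d1 * d2)) : Prop :=
  rational_rep groupH tau /\
  forall g k, factorD6 g -> factorA1 k -> tau (g *m k) = rho1 g *t rho2 k.

Definition rep_iso (K : 'M[F]_n -> Prop) (d1 d2 : nat)
    (rho1 : 'M[F]_n -> 'M[F]_d1) (rho2 : 'M[F]_n -> 'M[F]_d2) : Prop :=
  exists P : 'M[F]_(d1, d2),
    [/\ row_free P, row_full P & forall g, K g -> rho1 g *m P = P *m rho2 g].

Definition rep_dsum (I : finType) (d : I -> nat)
    (tau : forall a : I, 'M[F]_n -> 'M[F]_(d a)) (g : 'M[F]_n) :
    'M[F]_(\sum_(i < #|I|) d (enum_val i)) :=
  \mxdiag_(i < #|I|) tau (enum_val i) g.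

End Groups.

Definition weightE7 (k : nat) (i : 'I_7) : nat :=
  nth 0%N [:: 0; 0; 0; 0; 0; 0; k]%N i.

(* The triples (a_1, a_2, a_3) of natural numbers with a_1 + 2 a_2 + a_3 = k;
   each a_i is then at most k. *)
Definition branching_index (k : nat) : finType :=
  {a : 'I_k.+1 * 'I_k.+1 * 'I_k.+1 | (a.1.1 + 2 * a.1.2 + a.2 == k)%N}.

Definition weightD6 (k : nat) (a : branching_index k) (i : 'I_6) : nat :=
  nth 0%N [:: nat_of_ord (val a).1.1; nat_of_ord (val a).1.2; 0; 0; 0;
              nat_of_ord (val a).2]%N i.

Definition weightA1 (k : nat) (a : branching_index k) (_ : 'I_1) : nat :=
  (val a).1.1.

(* Main.v *)
Require Import Defs.
From mathcomp Require Import all_boot all_order all_algebra.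
From mathcomp Require Import reals complex mxtens mpoly.
From mathcomp Require Import ring zify.
From mathcomp Require boolp.
Set Implicit Arguments.
Unset Strict Implicit.
Unset Printing Implicit Defensive.
Import Order.TTheory GRing.Theory Num.Theory.
Local Open Scope ring_scope.

(** Differentiating the representations at 1 turns the problem into one about
    Chevalley generators: [V], [W a] and [U a] become highest weight modules over
    the Lie algebras of [G] and of the two factors of [H].  An irreducible highest
    weight module is determined by its weight, so [V] can be realised as the
    submodule [C0] generated by [v^(k)], the [k]-th tensor power of the highest
    weight vector [v] of the 56-dimensional representation, inside the [k]-th
    tensor power of the latter; there all the root vectors are explicit sparse
    matrices and the standard hermitian form is contravariant.

    Upper bound.  There is a vector [xi] in the orbit [G v] such that
    [b xi = Lie(G) xi] for a Borel subalgebra [b] of [Lie H].  Hence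
    [C0 = U(b) xi^(k)], and a highest weight vector of [H] in [C0] orthogonal to
    [xi^(k)] is zero.  So each weight occurs at most once, and the relations
    satisfied by the torus of [H] on [xi] leave only the weights of the theorem.

    Lower bound.  Each of these weights is the weight of an explicit highest
    weight vector of [H] in the tensor power that is not orthogonal to [xi^(k)];
    its orthogonal projection to [C0] is a nonzero highest weight vector.

    Complete reducibility comes from the hermitian form.  Finally the embedding
    [Q_a] of [W a (x) U a] in [V] transports the action of the group [H], which
    defines [tau a]. *)

(** A matrix acts on a tensor power as a derivation, so its value on the pure power of [xi] depends
    only on its value on [xi]. Whatever is checked about [xi] in dimension 56 is therefore a finite
    certificate that serves every [k], and no character or dimension formula enters.

    Geometrically, the Borel subgroup of [H] has an open orbit in the cone over the closed orbit of
    [G], and [xi] is a point of it; it comes from [v] by exponentials of two orthogonal root vectors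
    lying outside [Lie H].

    The main obstacle is that the groups are bare sets of matrices and the representations are known
    only on them. Derivatives are therefore coefficients of polynomial curves, a coroot is reached
    as a product of exponentials, and the root spaces, which the definitions of the root subgroups
    refer to, have to be computed from the Chevalley generators. Moreover [W a] and [U a] live on
    the two factors, which meet in a central subgroup, so that a formula on products [g *m k] would
    not obviously be well defined on [H]; an action transported from [V] is. *)

Ltac mxgen := repeat match goal with
  | |- context [?A *m ?B] => move: (A *m B) => ?
  end.

(** After distributing and reassociating, the noncommutative products are opaque atoms, so [ring]
    only checks a linear identity entry by entry. *)
Ltac mxring :=
  rewrite ?(mulmxDl, mulmxDr, mulmxBl, mulmxBr, mulmxN, mulNmx, mulmxA,
            =^~ scalemxAl, =^~ scalemxAr, mulmx0, mul0mx, mulmx1, mul1mx);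
  mxgen; apply/matrixP => ? ?; rewrite !mxE; ring.

(** * Commutator identities *)

Section Bracket.
Variables (F : fieldType) (n : nat).
Implicit Types X Y Z : 'M[F]_n.

Lemma bracketDl X Y Z : bracket (X + Y) Z = bracket X Z + bracket Y Z.
Proof. by rewrite /bracket; mxring. Qed.
Lemma bracketDr X Y Z : bracket X (Y + Z) = bracket X Y + bracket X Z.
Proof. by rewrite /bracket; mxring. Qed.
Lemma bracketZl c X Y : bracket (c *: X) Y = c *: bracket X Y.
Proof. by rewrite /bracket; mxring. Qed.
Lemma bracketZr c X Y : bracket X (c *: Y) = c *: bracket X Y.
Proof. by rewrite /bracket; mxring. Qed.
Lemma bracketC X Y : bracket X Y = - bracket Y X.
Proof. by rewrite /bracket; mxring. Qed.
Lemma bracket_jacobi X Y Z :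
  bracket X (bracket Y Z) = bracket (bracket X Y) Z + bracket Y (bracket X Z).
Proof. by rewrite /bracket; mxring. Qed.

End Bracket.

(** * Exponentials of nilpotent matrices *)

Section LinearPredicates.
Variables (F : fieldType) (V : lmodType F).
Implicit Types (S : V -> Prop).

(** Subspaces are predicates, so that generated submodules can be inductive predicates and stability
    can be proved by induction; [lin_repr] provides a basis when one is needed. *)
Definition lin S := S 0 /\ forall c x y, S x -> S y -> S (c *: x + y).

Lemma linD S x y : lin S -> S x -> S y -> S (x + y).
Proof. by move=> [_ HS] Sx Sy; rewrite -[x]scale1r; apply: HS. Qed.
Lemma linZ S c x : lin S -> S x -> S (c *: x).
Proof. by move=> [S0 HS] Sx; rewrite -[_ *: _]addr0; apply: HS. Qed.
Lemma linB S x y : lin S -> S x -> S y -> S (x - y).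
Proof. by move=> HS Sx Sy; rewrite -scaleN1r; apply: linD => //; apply: linZ. Qed.
Lemma lin_sum S (I : eqType) (s : seq I) (u : I -> V) :
  lin S -> (forall i, i \in s -> S (u i)) -> S (\sum_(i <- s) u i).
Proof.
move=> HS Hu; rewrite big_seq; apply: (big_ind S) => //; first by case: HS.
by move=> x y; apply: linD.
Qed.

Lemma lin_zero : lin (fun x => x = 0).
Proof. by split=> // c x y -> ->; rewrite scaler0 addr0. Qed.

Lemma eig_split S (T : V -> V) : lin S ->
  (forall c x y, T (c *: x + y) = c *: T x + T y) ->
  (forall x, S x -> S (T x)) ->
  forall s : seq (F * V), uniq (unzip1 s) ->
  (forall p, p \in s -> T p.2 = p.1 *: p.2) ->
  S (\sum_(p <- s) p.2) -> forall p, p \in s -> S p.2.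
Proof.
move=> HS Tlin HT; move=> s; have [m] := ubnP (size s); elim: m s => // m IH.
have T0 : T 0 = 0 by have := Tlin (-1) 0 0; rewrite scaler0 addr0 scaleN1r addNr.
have TD x y : T (x + y) = T x + T y by have := Tlin 1 x y; rewrite !scale1r.
have TZ c x : T (c *: x) = c *: T x by have := Tlin c x 0; rewrite T0 !addr0.
case=> // p0 s /= sz /andP[p0s us] Hs; rewrite big_cons => Hx.
have Hs' p : p \in s -> S p.2.
  move=> ps.
  have ne : p.1 - p0.1 != 0.
    by rewrite subr_eq0; apply: contraNneq p0s => <-; apply: map_f.
  have := IH [seq (q.1, (q.1 - p0.1) *: q.2) | q <- s] _ _ _ _
    (p.1, (p.1 - p0.1) *: p.2) _.
  move=> H; rewrite -[p.2](scalerK ne); apply: linZ => //; apply: H.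
  - by rewrite size_map.
  - by rewrite /unzip1 -map_comp.
  - move=> q /mapP[r rs ->] /=.
    by rewrite TZ Hs ?inE ?rs ?orbT // !scalerA mulrC.
  - rewrite big_map /=.
    have := linB HS (HT _ Hx) (linZ p0.1 HS Hx).
    suff -> : T (p0.2 + \sum_(j <- s) j.2) - p0.1 *: (p0.2 + \sum_(j <- s) j.2)
      = \sum_(j <- s) (j.1 - p0.1) *: j.2 by [].
    rewrite TD Hs ?inE ?eqxx // scalerDr opprD addrACA subrr add0r.
    rewrite (big_morph T TD T0) scaler_sumr -sumrB; apply: eq_big_seq => j js.
    by rewrite Hs ?inE ?js ?orbT // scalerBl.
  - by apply: map_f.
move=> p; rewrite inE => /predU1P[-> | /Hs' //].
rewrite -[p0.2](addrK (\sum_(j <- s) j.2)); apply: linB => //.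
exact: lin_sum.
Qed.

Lemma eig_split_fin S (T : V -> V) (I : finType) (mu : I -> F) (u : I -> V) :
  lin S -> (forall c x y, T (c *: x + y) = c *: T x + T y) ->
  (forall x, S x -> S (T x)) -> injective mu ->
  (forall i, T (u i) = mu i *: u i) -> S (\sum_i u i) -> forall i, S (u i).
Proof.
move=> HS Tlin HT imu Tu Su i.
have := @eig_split S T HS Tlin HT [seq (mu i, u i) | i <- enum I] _ _ _ (mu i, u i).
apply.
- by rewrite /unzip1 -map_comp map_inj_uniq ?enum_uniq // => a b /=; apply: imu.
- by move=> p /mapP[j _ ->] /=.
- by rewrite big_map big_enum.
- by rewrite (map_f (fun i => (mu i, u i))) // mem_enum.
Qed.

End LinearPredicates.

Lemma invmx_eq (F : fieldType) n (A B : 'M[F]_n) : A *m B = 1%:M -> invmx A = B.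
Proof.
move=> AB; have [uA _] := mulmx1_unit AB.
by rewrite -[invmx A]mulmx1 -AB mulKmx.
Qed.

Lemma invmx_mul (F : fieldType) n (A B : 'M[F]_n) :
  A \in unitmx -> B \in unitmx -> invmx (A *m B) = invmx B *m invmx A.
Proof. by move=> uA uB; apply: invmx_eq; rewrite mulmxA mulmxK // mulmxV. Qed.

Lemma triangle_sum (R : nmodType) (f : nat -> nat -> R) M :
  \sum_(k < M) \sum_(j < k.+1) f j (k - j)%N = \sum_(j < M) \sum_(l < M - j) f j l.
Proof.
elim: M => [|M IH]; first by rewrite !big_ord0.
rewrite big_ord_recr /= IH [RHS]big_ord_recr /= subSnn big_ord1.
rewrite [in LHS]big_ord_recr /= subnn addrA; congr (_ + _).
rewrite -big_split /=; apply: eq_bigr => j _.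
by rewrite subSn 1?ltnW // big_ord_recr.
Qed.

(** Two indices below [N] have a sum below [N + N], so this truncation of the Cauchy product loses
    nothing. *)
Lemma cauchy_sum (R : pzRingType) (a b : nat -> R) N :
  (forall i, (N <= i)%N -> a i = 0) -> (forall i, (N <= i)%N -> b i = 0) ->
  \sum_(k < N + N) \sum_(j < k.+1) a j * b (k - j)%N
  = (\sum_(i < N) a i) * (\sum_(j < N) b j).
Proof.
move=> Ha Hb; rewrite (triangle_sum (fun i j => a i * b j)) mulr_suml.
rewrite big_split_ord /= [X in _ + X]big1 ?addr0; last first.
  by move=> i _; rewrite big1 // => l _; rewrite Ha ?mul0r // leq_addr.
apply: eq_bigr => i _; rewrite mulr_sumr.
have -> : (N + N - i = N + (N - i))%N by have := ltn_ord i; lia.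
rewrite big_split_ord /= [X in _ + X]big1 ?addr0 //.
by move=> l _; rewrite Hb ?mulr0 // leq_addr.
Qed.

Section Exp.
Variable (F : numFieldType).

Lemma mxscaleAl n c (X Y : 'M[F]_n) : c *: (X * Y) = c *: X * Y.
Proof. exact: scalemxAl. Qed.
Lemma mxscaleAr n c (X Y : 'M[F]_n) : c *: (X * Y) = X * (c *: Y).
Proof. exact: scalemxAr. Qed.
Lemma mxexprZ n c (X : 'M[F]_n) k : (c *: X) ^+ k = c ^+ k *: X ^+ k.
Proof.
elim: k => [|k IH]; first by rewrite !expr0 scale1r.
by rewrite !exprS IH -mxscaleAl -mxscaleAr scalerA.
Qed.

(** The minimal polynomial divides a power of the variable, hence is one itself, and its degree is
    at most [n]. This makes the sum in [exp_nilp] the full exponential. *)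
Lemma nilmx_bound n (X : 'M[F]_n) N : X ^+ N = 0 -> X ^+ n = 0.
Proof.
case: n X => [|n] X; first by move=> _; apply/matrixP => -[].
move=> XN; have Xdvd : mxminpoly X %| 'X^N.
  by apply: mxminpoly_min; rewrite rmorphXn /= horner_mx_X.
have := Xdvd; rewrite -['X]subr0 -polyC0 => /dvdp_exp_XsubCP[m mN].
rewrite polyC0 subr0 => eqm.
have szm : (m <= n.+1)%N.
  have := eqp_size eqm; rewrite size_polyXn size_mxminpoly => -[] <-.
  have := dvdp_leq (monic_neq0 (char_poly_monic X)) (mxminpoly_dvd_char X).
  by rewrite size_char_poly size_mxminpoly ltnS.
have Xm : X ^+ m = 0.
  have : 'X^m %| mxminpoly X -> mxminpoly X %| 'X^m -> X ^+ m = 0.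
    move=> _ /dvdpP[q qE].
    have := congr1 (horner_mx X) qE.
    by rewrite rmorphXn rmorphM /= horner_mx_X mx_root_minpoly mulr0.
  by case/andP: eqm => h1 h2; apply.
suff H k : (m <= k)%N -> X ^+ k = 0 by apply: H.
by move=> mk; rewrite -(subnK mk) exprD Xm mulr0.
Qed.

Definition expk n (X : 'M[F]_n) k : 'M[F]_n := (k`!%:R)^-1 *: X ^+ k.

Lemma exp_nilpE n (X : 'M[F]_n) N M : X ^+ N = 0 -> (N <= M)%N ->
  exp_nilp X = \sum_(k < M) expk X k.
Proof.
move=> XN NM; rewrite /exp_nilp.
have Xn := nilmx_bound XN.
have X0 m k : X ^+ m = 0 -> (m <= k)%N -> expk X k = 0.
  by move=> Xm mk; rewrite /expk -(subnK mk) exprD Xm mulr0 scaler0.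
have ext m1 m2 : (forall k, (m1 <= k)%N -> expk X k = 0) -> (m1 <= m2)%N ->
    \sum_(k < m2) expk X k = \sum_(k < m1) expk X k.
  move=> H /subnKC<-; rewrite big_split_ord /= [X in _ + X]big1 ?addr0 //.
  by move=> i _; rewrite H ?leq_addr.
rewrite -/(\sum_(k < n.+1) expk X k).
case: (leqP M n.+1) => [Mn | /ltnW Mn].
  by apply: ext => // k Mk; apply: X0 XN _; apply: leq_trans Mk.
by rewrite -(ext n.+1 M) // => k nk; apply: X0 Xn (ltnW nk).
Qed.

Definition nilmx n (X : 'M[F]_n) := exists N, X ^+ N = 0.

Lemma nilmxZ n c (X : 'M[F]_n) : nilmx X -> nilmx (c *: X).
Proof. by case=> N XN; exists N; rewrite mxexprZ XN scaler0. Qed.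

Lemma nilmxN n (X : 'M[F]_n) : nilmx X -> nilmx (- X).
Proof. by rewrite -scaleN1r; apply: nilmxZ. Qed.

Lemma nilmx0 n : nilmx (0 : 'M[F]_n).
Proof. by exists 1%N; rewrite expr1. Qed.

Lemma exprD_expk n (X Y : 'M[F]_n) k : GRing.comm X Y ->
  expk (X + Y) k = \sum_(j < k.+1) expk X j * expk Y (k - j).
Proof.
move=> XY; rewrite addrC /expk exprDn_comm; last exact: commr_sym.
rewrite scaler_sumr; apply: eq_bigr => j _.
rewrite -mxscaleAl -mxscaleAr scalerA -scaler_nat scalerA -invfM.
rewrite [Y ^+ _ * _](commrX _ (commr_sym (commrX _ _))) //.
congr (_ *: _); have jk : (j <= k)%N by rewrite -ltnS.
have := bin_fact jk; move/(congr1 (fun m => m%:R : F)).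
rewrite !natrM => <-.
have f0 m : m`!%:R != 0 :> F by rewrite pnatr_eq0 -lt0n fact_gt0.
have b0 : 'C(k, j)%:R != 0 :> F by rewrite pnatr_eq0 -lt0n bin_gt0.
by field; rewrite ?f0 ?b0.
Qed.

Lemma expk0 n (X : 'M[F]_n) N k : X ^+ N = 0 -> (N <= k)%N -> expk X k = 0.
Proof. by move=> XN Nk; rewrite /expk -(subnK Nk) exprD XN mulr0 scaler0. Qed.

Lemma nilmxD n (X Y : 'M[F]_n) : GRing.comm X Y -> nilmx X -> nilmx Y -> nilmx (X + Y).
Proof.
move=> XY [N XN] [M YM]; exists (N + M)%N.
rewrite addrC exprDn_comm; last exact: commr_sym.
rewrite big1 // => i _; case: (leqP N i) => h.
  by rewrite -(subnKC h) exprD XN mul0r mulr0 mul0rn.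
have -> : (N + M - i = M + (N - i))%N by lia.
by rewrite exprD YM !mul0r mul0rn.
Qed.

Lemma expD n (X Y : 'M[F]_n) : GRing.comm X Y -> nilmx X -> nilmx Y ->
  exp_nilp (X + Y) = exp_nilp X * exp_nilp Y.
Proof.
move=> XY nX nY; have [K XYK] := nilmxD XY nX nY.
case: nX nY => N XN [M YM].
pose L := (N + M + K)%N.
rewrite (exp_nilpE (M := L) XN) ?(exp_nilpE (M := L) YM); try by rewrite /L; lia.
rewrite (exp_nilpE (M := L + L) XYK); last by rewrite /L; lia.
rewrite -cauchy_sum.
- by apply: eq_bigr => k _; rewrite exprD_expk.
- by move=> i Li; apply: expk0 XN _; rewrite /L in Li; lia.
- by move=> i Li; apply: expk0 YM _; rewrite /L in Li; lia.
Qed.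

Lemma exp0 n : exp_nilp (0 : 'M[F]_n) = 1.
Proof.
rewrite (@exp_nilpE _ _ 1 1) ?expr1 // big_ord1 /expk expr0 fact0.
by rewrite invr1 scale1r.
Qed.

Lemma expNl n (X : 'M[F]_n) : nilmx X -> exp_nilp (- X) * exp_nilp X = 1.
Proof.
move=> nX; rewrite -expD ?addNr ?exp0 //; last exact: nilmxN.
by apply: commr_sym; apply: commrN.
Qed.

Lemma expNr n (X : 'M[F]_n) : nilmx X -> exp_nilp X * exp_nilp (- X) = 1.
Proof. by move=> nX; rewrite -{1}[X]opprK expNl //; apply: nilmxN. Qed.

Lemma exp_unit n (X : 'M[F]_n) : nilmx X -> exp_nilp X \in unitmx.
Proof. by move=> /expNl /mulmx1_unit[]. Qed.

Lemma exp_inv n (X : 'M[F]_n) : nilmx X -> invmx (exp_nilp X) = exp_nilp (- X).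
Proof. by move=> nX; apply: invmx_eq; rewrite mulmxE expNr. Qed.

Lemma exp_add n (X : 'M[F]_n) s t : nilmx X ->
  exp_nilp ((s + t) *: X) = exp_nilp (s *: X) * exp_nilp (t *: X).
Proof.
move=> nX; rewrite scalerDl expD //; try exact: nilmxZ.
by rewrite /GRing.comm -!mxscaleAl -!mxscaleAr !scalerA mulrC.
Qed.

Lemma intertwineX n d (P : 'M[F]_(n, d)) (X : 'M[F]_n) (Y : 'M[F]_d) k :
  X *m P = P *m Y -> X ^+ k *m P = P *m Y ^+ k.
Proof.
move=> XP; elim: k => [|k IH]; first by rewrite !expr0 mul1mx mulmx1.
by rewrite exprS -mulmxE -mulmxA IH mulmxA XP -mulmxA mulmxE -exprS.
Qed.

Lemma intertwine_exp n d (P : 'M[F]_(n, d)) (X : 'M[F]_n) (Y : 'M[F]_d) :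
  nilmx X -> nilmx Y -> X *m P = P *m Y -> exp_nilp X *m P = P *m exp_nilp Y.
Proof.
move=> [N XN] [M YM] XP.
rewrite (exp_nilpE (M := N + M) XN) ?leq_addr //.
rewrite (exp_nilpE (M := N + M) YM) ?leq_addl //.
rewrite mulmx_suml mulmx_sumr; apply: eq_bigr => k _.
by rewrite /expk -scalemxAl -scalemxAr (intertwineX k XP).
Qed.

Lemma nilmx_conj n (g gi X : 'M[F]_n) : gi *m g = 1 -> nilmx X -> nilmx (g *m X *m gi).
Proof.
move=> gig [N XN]; exists N.
have /(intertwineX N) : (g *m X *m gi) *m g = g *m X by rewrite -mulmxA gig mulmx1.
rewrite XN mulmx0 => H; rewrite -[LHS]mulmx1.
have ggi : g *m gi = 1%:M by apply: mulmx1C.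
by rewrite -ggi mulmxA H mul0mx.
Qed.

Lemma exp_conj n (g gi X : 'M[F]_n) : gi *m g = 1 -> nilmx X ->
  exp_nilp (g *m X *m gi) = g *m exp_nilp X *m gi.
Proof.
move=> gig nX; have := @intertwine_exp _ _ g (g *m X *m gi) X.
move=> /(_ (nilmx_conj gig nX) nX); rewrite -mulmxA gig mulmx1 => /(_ erefl) <-.
have ggi : g *m gi = 1%:M by apply: mulmx1C.
by rewrite -[RHS]mulmxA ggi mulmx1.
Qed.

Definition adk n (X : 'M[F]_n) (Y : 'M[F]_n) k := iter k (bracket X) Y.

(** The part of degree [k] in [X] of the identity [exp(X) Y = exp(ad X)(Y) exp(X)]. *)
Lemma adk_expk n (X Y : 'M[F]_n) k :
  expk X k * Y = \sum_(j < k.+1) ((j`!%:R)^-1 *: adk X Y j) * expk X (k - j).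
Proof.
have f0 m : (m.+1)%:R != 0 :> F by rewrite pnatr_eq0.
have ff m : ((m.+1)`!%:R)^-1 = (m`!%:R)^-1 * (m.+1%:R)^-1 :> F.
  by rewrite factS natrM invfM mulrC.
have eS m : m.+1%:R *: expk X m.+1 = X * expk X m.
  rewrite /expk scalerA ff [_^-1 * _]mulrC mulrA mulfV // mul1r.
  by rewrite exprS -mxscaleAr.
have aS j : X * adk X Y j = adk X Y j.+1 + adk X Y j * X.
  by rewrite /adk iterS [bracket X _]/bracket mulmxE subrK.
elim: k => [|k IH].
  by rewrite big_ord1 /expk /adk /= expr0 fact0 invr1 !scale1r mul1r mulr1.
apply: (scalerI (f0 k)).
rewrite mxscaleAl eS -mulrA IH mulr_sumr.
pose A j := (j`!%:R)^-1 *: adk X Y j.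
have AS j : X * A j = j.+1%:R *: A j.+1 + A j * X.
  rewrite /A -mxscaleAr aS scalerDr mxscaleAl; congr (_ + _).
  by rewrite scalerA ff [_^-1 * _]mulrC mulrA mulfV // mul1r.
transitivity (\sum_(j < k.+1) (j.+1%:R *: A j.+1 * expk X (k - j))
            + \sum_(j < k.+1) ((k.+1 - j)%:R *: (A j * expk X (k.+1 - j)))).
  rewrite -big_split; apply: eq_bigr => j _ /=.
  have jk : (j <= k)%N by rewrite -ltnS.
  by rewrite mulrA AS mulrDl subSn // -!mulrA -eS mxscaleAr.
(* The factor [k + 1] is split as [j + (k + 1 - j)]: the first part matches the commutators
   [[X, A j]], the second the terms where [X] has moved past [A j]. *)
have -> : k.+1%:R *: \sum_(j < k.+2) A j * expk X (k.+1 - j)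
   = \sum_(j < k.+2) (j%:R *: (A j * expk X (k.+1 - j))
                     + (k.+1 - j)%:R *: (A j * expk X (k.+1 - j))).
  rewrite scaler_sumr; apply: eq_bigr => j _.
  have jk : (j <= k.+1)%N by rewrite -ltnS.
  by rewrite -scalerDl -natrD subnKC.
rewrite big_split /=; congr (_ + _).
  rewrite [RHS]big_ord_recl /= scale0r add0r.
  by apply: eq_bigr => j _; rewrite /bump /= add1n subSS mxscaleAl.
by rewrite [RHS]big_ord_recr /= subnn scale0r addr0.
Qed.

Lemma exp_ad n (X Y : 'M[F]_n) N : nilmx X -> (forall k, (N <= k)%N -> adk X Y k = 0) ->
  exp_nilp X *m Y = (\sum_(j < N) ((j`!%:R)^-1 *: adk X Y j)) *m exp_nilp X.
Proof.
move=> [M XM] HN; pose L := (N + M)%N.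
rewrite (exp_nilpE (M := L) XM) ?leq_addl // !mulmxE.
have -> : \sum_(j < N) (j`!%:R)^-1 *: adk X Y j = \sum_(j < L) (j`!%:R)^-1 *: adk X Y j.
  rewrite [RHS]big_split_ord /= [X in _ + X]big1 ?addr0 // => i _.
  by rewrite HN ?scaler0 // leq_addr.
rewrite -(cauchy_sum (a := fun j => (j`!%:R)^-1 *: adk X Y j)); first last.
- by move=> i Li; apply: expk0 XM _; rewrite /L in Li; lia.
- by move=> i Li; rewrite HN ?scaler0 //; rewrite /L in Li; lia.
rewrite -(exp_nilpE (M := L) XM) ?leq_addl // (exp_nilpE (M := L + L) XM); last first.
  by rewrite /L; lia.
by rewrite mulr_suml; apply: eq_bigr => k _; rewrite adk_expk.
Qed.

(** [ad(X)^k Y] is a combination of the [X^i Y X^(k-i)], and for [k >= 2N] one of the two exponents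
    is at least [N]. *)
Lemma adk_nilmx n (X Y : 'M[F]_n) : nilmx X ->
  exists N, forall k, (N <= k)%N -> adk X Y k = 0.
Proof.
move=> [N XN]; exists (N + N)%N => k Nk.
have adkE j : exists c : nat -> F,
    adk X Y j = \sum_(i < j.+1) c i *: (X ^+ i * Y * X ^+ (j - i)).
  elim: j => [|j [c IH]].
    by exists (fun=> 1); rewrite big_ord1 !expr0 mul1r mulr1 scale1r.
  exists (fun i => (if i is i'.+1 then c i' else 0) - (if (i <= j)%N then c i else 0)).
  rewrite /adk iterS -/(adk X Y j) IH /bracket mulmx_sumr mulmx_suml.
  under [RHS]eq_bigr => i _ do rewrite scalerBl.
  rewrite sumrB; congr (_ - _).
    rewrite [RHS]big_ord_recl /= scale0r add0r; apply: eq_bigr => i _.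
    by rewrite /bump /= add1n subSS exprS -scalemxAr mulmxE !mulrA.
  rewrite [RHS]big_ord_recr /= ltnn scale0r addr0; apply: eq_bigr => i _.
  have ij := ltn_ord i; rewrite ltnS in ij; rewrite ij subSn // exprSr.
  by rewrite -scalemxAl mulmxE !mulrA.
have [c ->] := adkE k; rewrite big1 // => i _.
case: (leqP N i) => h.
  by rewrite -(subnKC h) exprD XN !mul0r scaler0.
have h2 : (N <= k - i)%N by lia.
by rewrite -(subnKC h2) exprD XN mul0r mulr0 scaler0.
Qed.

End Exp.

(** * The rank one case *)

Section Sl2.
Variable (F : numFieldType) (d : nat).
Implicit Types (e f h X Y Z T : 'M[F]_d).

Lemma bracket_lin X c Y Z : bracket X (c *: Y + Z) = c *: bracket X Y + bracket X Z.
Proof. by rewrite bracketDr bracketZr. Qed.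

Lemma bracketMr X Y Z : bracket X (Y *m Z) = bracket X Y *m Z + Y *m bracket X Z.
Proof. by rewrite /bracket; mxring. Qed.

Lemma bracket_0 X : bracket X 0 = 0.
Proof. by rewrite /bracket mulmx0 mul0mx subr0. Qed.

Lemma bracket_sum X (I : finType) (Y : I -> 'M[F]_d) :
  bracket X (\sum_i Y i) = \sum_i bracket X (Y i).
Proof. exact: (big_morph _ (@bracketDr _ _ X) (bracket_0 X)). Qed.

(** Nonzero eigenvectors with distinct eigenvalues are independent, and the space has dimension
    [d * d]. All nilpotency statements come from this count. *)
Lemma eigen_sequence_vanishes (T : 'M[F]_d -> 'M[F]_d) (u : nat -> 'M[F]_d)
    (mu : nat -> F) : (forall c x y, T (c *: x + y) = c *: T x + T y) ->
  injective mu -> (forall l, T (u l) = mu l *: u l) ->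
  exists2 l, (l <= d * d)%N & u l = 0.
Proof.
move=> Tlin imu Tu.
have [/existsP[l /eqP ul] | /existsPn nz] :=
    boolP [exists l : 'I_(d * d).+1, u l == 0].
  by exists l => //; rewrite -ltnS.
pose A : 'M[F]_((d * d).+1, d * d) := \matrix_l mxvec (u l).
have : kermx A != 0.
  rewrite -mxrank_eq0 mxrank_ker subn_eq0 -ltnNge ltnS; exact: rank_leq_col.
case/rowV0Pn => x /sub_kermxP xA xn0.
have sum0 : \sum_(l < (d * d).+1) x 0 l *: u l = 0.
  apply: (can_inj mxvecK); rewrite linear0 -[RHS]xA linear_sum mulmx_sum_row.
  by apply: eq_bigr => l _; rewrite linearZ rowK.
have := @eig_split_fin F 'M[F]_d (fun x => x = 0) T _ (fun l : 'I_(d * d).+1 => mu l)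
  (fun l => x 0 l *: u l) (lin_zero _) Tlin _ _ _ sum0.
move=> H; case/eqP: xn0; apply/rowP => l; rewrite mxE.
have T0 : T 0 = 0 by have := Tlin (-1) 0 0; rewrite scaler0 addr0 scaleN1r addNr.
have /eqP : x 0 l *: u l = 0.
  apply: H => //.
  - by move=> y ->; apply: T0.
  - by move=> i j /imu /val_inj.
  - by move=> i; have := Tlin (x 0 i) (u i) 0; rewrite T0 !addr0 Tu !scalerA mulrC.
by rewrite scaler_eq0 (negPf (nz l)) orbF => /eqP.
Qed.

Lemma ad_eigen_expr h X c k : bracket h X = c *: X ->
  bracket h (X ^+ k) = (k%:R * c) *: X ^+ k.
Proof.
move=> hX; elim: k => [|k IH].
  by rewrite mul0r scale0r expr0 /bracket mulmx1 mul1mx subrr.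
rewrite exprS -mulmxE bracketMr hX IH -scalemxAl -scalemxAr -scalerDl.
by rewrite -nat1r mulrDl mul1r.
Qed.

(** The powers of [X] have the pairwise distinct eigenvalues [k * c] under [bracket h]. *)
Lemma ad_eigen_nilmx h X c : c != 0 -> bracket h X = c *: X -> nilmx X.
Proof.
move=> c0 hX.
have [||l _ ul0] := @eigen_sequence_vanishes (bracket h) (fun l => X ^+ l)
  (fun l => l%:R * c) (bracket_lin h); last by exists l.
- by move=> k l /(mulIf c0) /eqP; rewrite eqr_nat => /eqP.
- by move=> l; apply: ad_eigen_expr.
Qed.

Lemma exp_ad2 X Y : nilmx X -> bracket X (bracket X Y) = 0 ->
  exp_nilp X *m Y = (Y + bracket X Y) *m exp_nilp X.
Proof.
move=> nX H; rewrite (@exp_ad _ _ X Y 2) //; last first.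
  move=> k /subnK<-; rewrite /adk iterD /= H.
  by elim: (k - 2)%N => //= j ->; apply: bracket_0.
rewrite !big_ord_recl big_ord0 addr0 /= /bump /= /adk /= !factS fact0 ?muln1.
by rewrite invr1 !scale1r.
Qed.

Lemma exp_ad3 X Y : nilmx X -> bracket X (bracket X (bracket X Y)) = 0 ->
  exp_nilp X *m Y =
    (Y + bracket X Y + 2^-1 *: bracket X (bracket X Y)) *m exp_nilp X.
Proof.
move=> nX H; rewrite (@exp_ad _ _ X Y 3) //; last first.
  move=> k /subnK<-; rewrite /adk iterD /= H.
  by elim: (k - 3)%N => //= j ->; apply: bracket_0.
rewrite !big_ord_recl big_ord0 addr0 /= /bump /= /adk /= !factS fact0 ?muln1.
by rewrite invr1 !scale1r addrA.
Qed.

Record sl2 e f h : Prop := Sl2 {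
  sl2_ef : bracket e f = h;
  sl2_he : bracket h e = 2 *: e;
  sl2_hf : bracket h f = - 2 *: f }.

(** Steinberg's element [w(s)]: it represents the reflection, and [theta s] times the inverse of
    [theta 1] is the value at [s] of the coroot. *)
Definition theta e f (s : F) : 'M[F]_d :=
  exp_nilp (s *: e) *m exp_nilp (- s^-1 *: f) *m exp_nilp (s *: e).

Variables (e f h : 'M[F]_d).
Hypothesis S : sl2 e f h.

Lemma sl2_nilmx_e : nilmx e.
Proof. by apply: ad_eigen_nilmx (sl2_he S); rewrite pnatr_eq0. Qed.

Lemma sl2_nilmx_f : nilmx f.
Proof. by apply: ad_eigen_nilmx (sl2_hf S); rewrite oppr_eq0 pnatr_eq0. Qed.

Lemma theta_unit s : theta e f s \in unitmx.
Proof.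
have ue : exp_nilp (s *: e) \in unitmx.
  by apply: exp_unit; apply: nilmxZ; apply: sl2_nilmx_e.
have uf : exp_nilp (- s^-1 *: f) \in unitmx.
  by apply: exp_unit; apply: nilmxZ; apply: sl2_nilmx_f.
by rewrite /theta !unitmx_mul ue uf.
Qed.

Lemma bracketv X : bracket X X = 0.
Proof. by rewrite /bracket subrr. Qed.

Lemma exp_e_cartan T c s : bracket T e = c *: e ->
  exp_nilp (s *: e) *m T = (T - (s * c) *: e) *m exp_nilp (s *: e).
Proof.
move=> Te; have eT : bracket (s *: e) T = - (s * c) *: e.
  by rewrite bracketZl bracketC Te scalerN scalerA scaleNr.
rewrite exp_ad2 ?eT ?scaleNr //; first by apply: nilmxZ sl2_nilmx_e.
by rewrite -scaleNr bracketZl bracketZr bracketv !scaler0.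
Qed.

Lemma exp_f_cartan T c s : bracket T f = - c *: f ->
  exp_nilp (s *: f) *m T = (T + (s * c) *: f) *m exp_nilp (s *: f).
Proof.
move=> Te; have eT : bracket (s *: f) T = (s * c) *: f.
  by rewrite bracketZl bracketC Te scaleNr opprK scalerA.
rewrite exp_ad2 ?eT ?scaleNr //; first by apply: nilmxZ sl2_nilmx_f.
by rewrite bracketZl bracketZr bracketv !scaler0.
Qed.

Lemma exp_f_e s :
  exp_nilp (s *: f) *m e = (e - s *: h - s ^+ 2 *: f) *m exp_nilp (s *: f).
Proof.
have fe : bracket (s *: f) e = - s *: h.
  by rewrite bracketZl bracketC (sl2_ef S) scalerN scaleNr.
have ffe : bracket (s *: f) (- s *: h) = - (2 * s ^+ 2) *: f.
  rewrite bracketZl bracketZr bracketC (sl2_hf S) -scaleNr !scalerA.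
  by congr (_ *: _); ring.
rewrite exp_ad3 ?fe ?ffe; first last.
- by rewrite bracketZl bracketZr bracketv !scaler0.
- exact: nilmxZ sl2_nilmx_f.
congr (_ *m _); rewrite !scaleNr scalerN scalerA mulrA mulVf ?mul1r //.
by rewrite pnatr_eq0.
Qed.

Lemma theta_cartan T c s : s != 0 -> bracket T e = c *: e -> bracket T f = - c *: f ->
  theta e f s *m T = (T - c *: h) *m theta e f s.
Proof.
move=> s0 Te Tf; rewrite /theta -[LHS]mulmxA (exp_e_cartan s Te).
set x := exp_nilp (s *: e); set y := exp_nilp _.
have yT : y *m T = (T + (- s^-1 * c) *: f) *m y by rewrite (exp_f_cartan _ Tf).
have ye : y *m e = (e - (- s^-1) *: h - (- s^-1) ^+ 2 *: f) *m y.
  by rewrite exp_f_e.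
have xT : x *m T = (T - (s * c) *: e) *m x by rewrite (exp_e_cartan s Te).
have xh : x *m h = (h - (s * 2) *: e) *m x by rewrite (exp_e_cartan s (sl2_he S)).
have xe : x *m e = e *m x.
  have := @exp_e_cartan e 0 s; rewrite mulr0 scale0r subr0; apply.
  exact: bracketv.
have -> : x *m y *m ((T - (s * c) *: e) *m x) = x *m (y *m (T - (s * c) *: e)) *m x.
  by rewrite !mulmxA.
have -> : y *m (T - (s * c) *: e) = (T - (s * c) *: e - c *: h) *m y.
  rewrite mulmxBr -scalemxAr yT ye scalemxAl -mulmxBl; congr (_ *m _).
  by apply/matrixP => i j; rewrite !mxE; field.
rewrite !mulmxA; congr (_ *m _ *m _).
rewrite !mulmxBr -!scalemxAr xT xe xh !scalemxAl -!mulmxBl; congr (_ *m _).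
by apply/matrixP => i j; rewrite !mxE; ring.
Qed.

Lemma expkZ s X k : expk (s *: X) k = s ^+ k *: expk X k.
Proof. by rewrite /expk mxexprZ !scalerA mulrC. Qed.

Lemma scale_mulmx3 x y z X Y Z :
  (x *: X) *m (y *: Y) *m (z *: Z) = (x * y * z) *: (X *m Y *m Z).
Proof. by rewrite -!(scalemxAl, scalemxAr) !scalerA; congr (_ *: _); ring. Qed.

(* [theta s] is a Laurent polynomial in [s]; its coefficients are eigenvectors of
   [h] and, up to the invertible factor [theta 1], sum up to the identity. *)
Lemma sl2_diag : exists N (A : 'I_N -> 'M[F]_d) (mu : 'I_N -> int),
  [/\ injective mu, \sum_i A i = 1%:M,
      forall i, h *m A i = (mu i)%:~R *: A i,
      forall i, A i *m h = (mu i)%:~R *: A i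
    & forall s, s != 0 ->
        theta e f s *m invmx (theta e f 1) = \sum_i (s ^ mu i) *: A i].
Proof.
have [N eN] := sl2_nilmx_e; have [M fM] := sl2_nilmx_f.
pose K := (N + M)%N.
pose J := ('I_K * 'I_K * 'I_K)%type.
pose a := expk e; pose b := expk (- f).
pose term (t : J) := a t.1.1 *m b t.1.2 *m a t.2.
have expN : (- f) ^+ M = 0 by rewrite -scaleN1r mxexprZ fM scaler0.
have wt_lt (t : J) : (t.1.1 + t.2 + (K - t.1.2) < K + K + K.+1)%N.
  have := ltn_ord t.1.1; have := ltn_ord t.2; lia.
pose wt (t : J) : 'I_(K + K + K.+1) := Ordinal (wt_lt t).
(* The degree in [s] of the term [(i, k, l)] is [i - k + l], which may be negative; the ordinal
   [wt t] stores it shifted by [K]. *)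
pose mu (m : 'I_(K + K + K.+1)) : int := m%:Z - K%:Z.
have muE t : mu (wt t) = t.1.1%:Z + t.2%:Z - t.1.2%:Z.
  by rewrite /mu /=; have := ltn_ord t.1.2; lia.
pose Th m := \sum_(t : J | wt t == m) term t.
have imu : injective mu by move=> m1 m2; rewrite /mu => /addIr [] /val_inj.
have thetaE s : s != 0 -> theta e f s = \sum_m (s ^ mu m) *: Th m.
  move=> s0; rewrite /theta.
  rewrite (exp_nilpE (N := N) (M := K)) ?leq_addr //; last first.
    by rewrite mxexprZ eN scaler0.
  have -> : - s^-1 *: f = s^-1 *: (- f) by rewrite scaleNr scalerN.
  rewrite (exp_nilpE (N := M) (M := K)) ?leq_addl //; last first.
    by rewrite mxexprZ expN scaler0.
  transitivity (\sum_(t : J) (s ^ mu (wt t)) *: term t); last first.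
    rewrite (partition_big wt xpredT) //=; apply: eq_bigr => m _.
    by rewrite /Th scaler_sumr; apply: eq_bigr => t /eqP ->.
  rewrite !mulmx_suml -(pair_bigA _ (fun p l => (s ^ mu (wt (p, l))) *: term (p, l))) /=.
  rewrite -(pair_bigA _ (fun i k => \sum_l (s ^ mu (wt (i, k, l))) *: term (i, k, l))) /=.
  apply: eq_bigr => i _; rewrite [expk (s *: e) i *m _]mulmx_sumr mulmx_suml.
  apply: eq_bigr => k _.
  rewrite mulmx_sumr; apply: eq_bigr => l _.
  rewrite !expkZ scale_mulmx3 muE /=.
  congr (_ *: _); rewrite expfzDr // -?PoszD -exprnN -exprnP exprD exprVn.
  by ring.
have ha k : bracket h (a k) = (k%:R * 2) *: a k.
  by rewrite /a /expk bracketZr (ad_eigen_expr _ (sl2_he S)) !scalerA mulrC.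
have hb k : bracket h (b k) = (k%:R * - 2) *: b k.
  rewrite /b /expk bracketZr (@ad_eigen_expr _ _ (-2)).
    by rewrite !scalerA mulrC.
  by rewrite -scaleN1r bracketZr (sl2_hf S) !scalerA mulrC.
have hterm t : bracket h (term t) = (2 * (mu (wt t))%:~R) *: term t.
  have key p q r X Y Z : ((p *: X) *m Y + X *m (q *: Y)) *m Z + (X *m Y) *m (r *: Z)
    = (p + q + r) *: (X *m Y *m Z) by mxring.
  rewrite /term !bracketMr !ha hb key muE rmorphB rmorphD /= -!pmulrn.
  by congr (_ *: _); ring.
have hTh m : bracket h (Th m) = (2 * (mu m)%:~R) *: Th m.
  rewrite /Th -big_filter (big_morph _ (@bracketDr _ _ h) (bracket_0 h)).
  rewrite scaler_sumr; apply: eq_big_seq => t; rewrite mem_filter => /andP[/eqP<- _].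
  exact: hterm.
have th1 : theta e f 1 = \sum_m Th m.
  by rewrite thetaE ?oner_eq0 //; apply: eq_bigr => m _; rewrite exp1rz scale1r.
have th1h : theta e f 1 *m h = - h *m theta e f 1.
  rewrite (@theta_cartan h 2) ?oner_eq0 ?(sl2_he S) ?(sl2_hf S) //.
  by congr (_ *m _); rewrite scaler_nat mulr2n opprD addrA subrr sub0r.
(* As [theta 1] anticommutes with [h], its bracket with [h] is [2 h theta 1]; by [hTh] the same
   bracket is the sum of the [2 (mu m) Th m]. *)
have sumV : \sum_m (h *m Th m - (mu m)%:~R *: Th m) = 0.
  have two : (2 : F) != 0 by rewrite pnatr_eq0.
  rewrite sumrB -mulmx_sumr -th1.
  apply: (scalerI two); rewrite scaler0 scalerBr scaler_sumr.
  under [X in _ - X]eq_bigr do rewrite scalerA -hTh.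
  rewrite -bracket_sum -th1 /bracket th1h mulNmx opprK.
  by rewrite scaler_nat mulr2n subrr.
(* The summands of [sumV] are eigenvectors of [bracket h] with distinct eigenvalues, so each of them
   vanishes. *)
have hE m : h *m Th m = (mu m)%:~R *: Th m.
  apply/eqP; rewrite -subr_eq0; apply/eqP; move: m.
  apply: (@eig_split_fin _ _ (fun x => x = 0) (bracket h) _
    (fun m => 2 * (mu m)%:~R : F)) => //.
  - exact: lin_zero.
  - by move=> c x y; rewrite bracket_lin.
  - by move=> x ->; rewrite bracket_0.
  - move=> m1 m2 /mulfI; rewrite pnatr_eq0 => /(_ isT) /intr_inj.
    exact: imu.
  - move=> m; rewrite bracketDr -scaleNr bracketZr bracketMr bracketv mul0mx add0r.
    by rewrite hTh -scalemxAr scalerDr !scalerA; congr (_ + _ *: _); ring.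
have Eh m : Th m *m h = - (mu m)%:~R *: Th m.
  have := hTh m; rewrite /bracket hE => /(canRL (subKr _)) ->.
  by rewrite -scalerBl; congr (_ *: _); ring.
exists (K + K + K.+1)%N, (fun m => Th m *m invmx (theta e f 1)), mu.
have u1 := theta_unit 1.
split=> //.
- by rewrite -mulmx_suml -th1 mulmxV.
- by move=> m; rewrite mulmxA hE scalemxAl.
- move=> m; rewrite -mulmxA.
  have -> : invmx (theta e f 1) *m h = - h *m invmx (theta e f 1).
    apply: (can_inj (mulKmx u1)).
    by rewrite mulKVmx // mulmxA mulmxN th1h !mulNmx opprK mulmxK.
  by rewrite mulmxA mulmxN Eh scaleNr opprK scalemxAl.
- move=> s s0; rewrite thetaE // mulmx_suml; apply: eq_bigr => m _.
  by rewrite scalemxAl.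
Qed.

(** At the first power with [f ^+ k.+1 *m v = 0], the relation [e f^(k+1) v = (k+1)(c-k) f^k v]
    forces [c = k]. *)
Lemma sl2_hw_nat (v : 'cV[F]_d) c : v != 0 -> e *m v = 0 -> h *m v = c *: v ->
  exists m : nat, c = m%:R.
Proof.
move=> v0 ev hv.
have fE k : h *m (f ^+ k *m v) = (c - k%:R * 2) *: (f ^+ k *m v).
  have := ad_eigen_expr k (sl2_hf S); rewrite /bracket => /eqP.
  rewrite subr_eq => /eqP hf; rewrite mulmxA hf mulmxDl -mulmxA hv.
  rewrite -scalemxAl -scalemxAr -scalerDl.
  by congr (_ *: _); ring.
have efE k : e *m (f ^+ k.+1 *m v) = (k.+1%:R * (c - k%:R)) *: (f ^+ k *m v).
  elim: k => [|k IH].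
    rewrite expr1 expr0 mul1mx mulmxA -[e *m f](subrK (f *m e)).
    rewrite -/(bracket e f) (sl2_ef S) mulmxDl -mulmxA ev mulmx0 addr0 hv.
    by rewrite subr0 mul1r.
  rewrite exprS -mulmxE -mulmxA mulmxA -[e *m f](subrK (f *m e)).
  rewrite -/(bracket e f) (sl2_ef S) mulmxDl fE -mulmxA IH -scalemxAr.
  rewrite mulmxA mulmxE -exprS -scalerDl; congr (_ *: _).
  by rewrite -!nat1r; ring.
have [N fN] := sl2_nilmx_f.
have ex : exists k, f ^+ k *m v == 0 by exists N; rewrite fN mul0mx.
case: (ex_minnP ex) => -[|k]; first by rewrite expr0 mul1mx (negPf v0).
move=> /eqP fk0 mink; exists k; apply/eqP; rewrite -subr_eq0.
have := efE k; rewrite fk0 mulmx0 => /esym/eqP.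
rewrite scaler_eq0 mulf_eq0 pnatr_eq0 /= => /orP[//|fk].
by have := mink k fk; rewrite ltnn.
Qed.

End Sl2.

(** * Differentiation of rational representations *)

Section Curves.
Variable F : numFieldType.

Lemma poly0_of_values (p : {poly F}) : (forall t, p.[t] = 0) -> p = 0.
Proof.
move=> H; apply/eqP; apply: contraT => p0.
have := @max_poly_roots F p [seq k%:R | k <- iota 0 (size p)] p0.
rewrite size_map size_iota ltnn => -> //.
  by apply/allP => x _; rewrite /root H.
by rewrite map_inj_uniq ?iota_uniq // => i j /eqP; rewrite eqr_nat => /eqP.
Qed.

(** A polynomial curve with its coefficients. By [pcurve_uniq] the curve determines them, so [C 1]
    is its velocity at 0 and no topology is involved. *)
Definition pcurve m n (gam : F -> 'M[F]_(m, n)) (C : nat -> 'M[F]_(m, n)) :=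
  exists N, (forall t, gam t = \sum_(k < N) t ^+ k *: C k)
    /\ forall k, (N <= k)%N -> C k = 0.

Lemma pcurve_widen m n (C : nat -> 'M[F]_(m, n)) N M (t : F) :
  (forall k, (N <= k)%N -> C k = 0) -> (N <= M)%N ->
  \sum_(k < M) t ^+ k *: C k = \sum_(k < N) t ^+ k *: C k.
Proof.
move=> H /subnKC<-; rewrite big_split_ord /= [X in _ + X]big1 ?addr0 // => i _.
by rewrite H ?leq_addr ?scaler0.
Qed.

Lemma pcurve_uniq m n gam gam' (C C' : nat -> 'M[F]_(m, n)) :
  (forall t, gam t = gam' t) -> pcurve gam C -> pcurve gam' C' ->
  forall k, C k = C' k.
Proof.
move=> gg [N [gE C0]] [M [gE' C'0]] k.
pose L := (N + M + k.+1)%N.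
have Z t : \sum_(j < L) t ^+ j *: (C j - C' j) = 0.
  under eq_bigr do rewrite scalerBr.
  rewrite sumrB (pcurve_widen t C0) ?(pcurve_widen t C'0); try by rewrite /L; lia.
  by rewrite -gE -gE' gg subrr.
apply/eqP; rewrite -subr_eq0; apply/eqP/matrixP => a b; rewrite [RHS]mxE.
have : \poly_(j < L) (C j - C' j) a b = 0.
  apply: poly0_of_values => t; rewrite horner_poly.
  have := congr1 (fun A : 'M_(m, n) => A a b) (Z t); rewrite summxE [RHS]mxE => H; rewrite -[RHS]H.
  by apply: eq_bigr => j _; rewrite [RHS]mxE mulrC.
by move/polyP/(_ k); rewrite coef_poly coef0 /L ifT //; lia.
Qed.

Lemma pcurve_mull m n p (A : 'M[F]_(p, m)) gam (C : nat -> 'M[F]_(m, n)) :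
  pcurve gam C -> pcurve (fun t => A *m gam t) (fun k => A *m C k).
Proof.
move=> [N [gE C0]]; exists N; split=> [t|k /C0 ->]; last by rewrite mulmx0.
by rewrite gE mulmx_sumr; apply: eq_bigr => k _; rewrite scalemxAr.
Qed.

Lemma pcurve_mulr m n p (A : 'M[F]_(n, p)) gam (C : nat -> 'M[F]_(m, n)) :
  pcurve gam C -> pcurve (fun t => gam t *m A) (fun k => C k *m A).
Proof.
move=> [N [gE C0]]; exists N; split=> [t|k /C0 ->]; last by rewrite mul0mx.
by rewrite gE mulmx_suml; apply: eq_bigr => k _; rewrite scalemxAl.
Qed.

Lemma pcurve_lin m n p q (D : 'M[F]_(m, n) -> 'M[F]_(p, q)) gam C :
  (forall c x y, D (c *: x + y) = c *: D x + D y) ->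
  pcurve gam C -> pcurve (fun t => D (gam t)) (fun k => D (C k)).
Proof.
move=> Dl; have D0 : D 0 = 0.
  by have := Dl (-1) 0 0; rewrite scaler0 addr0 scaleN1r addNr.
have DD x y : D (x + y) = D x + D y by have := Dl 1 x y; rewrite !scale1r.
move=> [N [gE C0]]; exists N; split=> [t|k /C0 -> //].
rewrite gE (big_morph D DD D0); apply: eq_bigr => k _.
by have := Dl (t ^+ k) (C k) 0; rewrite D0 !addr0.
Qed.

Lemma pcurve_exp n (Y : 'M[F]_n) : nilmx Y ->
  pcurve (fun t => exp_nilp (t *: Y)) (expk Y).
Proof.
move=> [N YN]; exists N; split=> [t|k Nk]; last exact: expk0 YN Nk.
rewrite (exp_nilpE (N := N) (M := N)) ?mxexprZ ?YN ?scaler0 //.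
by apply: eq_bigr => k _; rewrite expkZ.
Qed.

Lemma pcurve_conj n (Z Y : 'M[F]_n) : nilmx Z ->
  pcurve (fun t => exp_nilp (t *: Z) *m Y *m exp_nilp (- (t *: Z)))
         (fun k => (k`!%:R)^-1 *: adk Z Y k).
Proof.
move=> nZ; have [N HN] := adk_nilmx Y nZ.
exists N; split=> [t|k /HN ->]; last by rewrite scaler0.
have nt : nilmx (t *: Z) by apply: nilmxZ.
have adkZ k : adk (t *: Z) Y k = t ^+ k *: adk Z Y k.
  elim: k => [|k IH]; first by rewrite expr0 scale1r.
  rewrite /adk iterS -/(adk _ _ _) IH bracketZl bracketZr scalerA -exprS.
  by rewrite -iterS.
rewrite (@exp_ad _ _ (t *: Z) Y N) //; last by move=> k /HN H; rewrite adkZ H scaler0.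
rewrite -mulmxA mulmxE expNr // mulr1.
by apply: eq_bigr => k _; rewrite adkZ !scalerA mulrC.
Qed.

End Curves.

Lemma expk1 (F : numFieldType) n (X : 'M[F]_n) : expk X 1 = X.
Proof. by rewrite /expk expr1 (_ : 1`! = 1%N) // invr1 scale1r. Qed.

(** The chain rule, with [L] the gradient of [p] at [x0]. It is chosen before the curve [G], which
    is what makes the differential of a representation a single linear map. *)
Lemma mpoly_derivative (F : numFieldType) N (x0 : 'I_N -> F) (p : {mpoly F[N]}) :
  exists L : 'I_N -> F, forall G : 'I_N -> {poly F}, (forall l, (G l).[0] = x0 l) ->
  exists q : {poly F}, (forall t, q.[t] = p.@[fun l => (G l).[t]])
    /\ q^`().[0] = \sum_l L l * (G l)^`().[0].
Proof.
pose P p := exists L : 'I_N -> F, forall G : 'I_N -> {poly F},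
  (forall l, (G l).[0] = x0 l) ->
  exists q : {poly F}, (forall t, q.[t] = p.@[fun l => (G l).[t]])
    /\ q^`().[0] = \sum_l L l * (G l)^`().[0].
have Pc c : P c%:MP.
  exists (fun=> 0) => G _; exists c%:P; split=> [t|]; first by rewrite hornerC mevalC.
  by rewrite derivC horner0 big1 // => l _; rewrite mul0r.
have PX i : P 'X_i.
  exists (fun l => (l == i)%:R) => G _; exists (G i); split=> [t|].
    by rewrite mevalXU.
  rewrite (bigD1 i) //= eqxx mul1r big1 ?addr0 // => l /negPf ->.
  by rewrite mul0r.
have PD p1 p2 : P p1 -> P p2 -> P (p1 + p2).
  move=> [L1 H1] [L2 H2]; exists (fun l => L1 l + L2 l) => G HG.
  have [q1 [e1 d1]] := H1 G HG; have [q2 [e2 d2]] := H2 G HG.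
  exists (q1 + q2); split=> [t|]; first by rewrite hornerD mevalD e1 e2.
  rewrite derivD hornerD d1 d2 -big_split; apply: eq_bigr => l _.
  by rewrite mulrDl.
have PM p1 p2 : P p1 -> P p2 -> P (p1 * p2).
  move=> [L1 H1] [L2 H2].
  exists (fun l => L1 l * p2.@[x0] + L2 l * p1.@[x0]) => G HG.
  have [q1 [e1 d1]] := H1 G HG; have [q2 [e2 d2]] := H2 G HG.
  exists (q1 * q2); split=> [t|]; first by rewrite hornerM mevalM e1 e2.
  have E0 (r : {mpoly F[N]}) : r.@[fun l => (G l).[0]] = r.@[x0].
    by apply: meval_eq.
  rewrite derivM hornerD !hornerM d1 d2 e1 e2 !E0 mulr_suml mulr_sumr -big_split.
  by apply: eq_bigr => l _ /=; ring.
rewrite -/(P p) (mpolyE p).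
apply: (big_ind P); first by rewrite -(mpolyC0 N F).
  by move=> *; apply: (PD _ _).
move=> m _; rewrite -mul_mpolyC; apply: (PM _ _) => //.
rewrite mpolyXE_id; apply: (big_ind P); first by rewrite -(mpolyC1 N F).
  by move=> *; apply: (PM _ _).
move=> i _; elim: (m i) => [|k IH]; first by rewrite expr0 -(mpolyC1 N F).
by rewrite exprS; apply: (PM _ _).
Qed.

Section Derivative.
Variables (F : numFieldType) (n : nat) (K : 'M[F]_n -> Prop).
Variables (d : nat) (rho : 'M[F]_n -> 'M[F]_d).
Hypotheses (K1 : K 1%:M) (KM : forall g k, K g -> K k -> K (g *m k)).
Hypotheses (KV : forall g, K g -> K (invmx g)) (KU : forall g, K g -> g \in unitmx).
Hypothesis rK : rational_rep K rho.

Definition islin (D : 'M[F]_n -> 'M[F]_d) :=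
  forall c x y, D (c *: x + y) = c *: D x + D y.

(** [D] is built from chosen polynomials for the entries of [rho]; only its values on velocities of
    curves in [K] are determined by [rho]. *)
Lemma rep_derivative : exists D, islin D /\
  forall gam G, pcurve gam G -> (forall t, K (gam t)) -> G 0%N = 1%:M ->
  exists Phi, pcurve (fun t => rho (gam t)) Phi /\ Phi 1%N = D (G 1%N).
Proof.
have [_ _ rp] := rK.
pose x0 l := mxvec (1%:M : 'M[F]_n) 0 l.
have [p Hp] : exists p : 'I_d * 'I_d -> {mpoly F[n * n]}, forall ij g, K g ->
    rho g ij.1 ij.2 = (p ij).@[fun l => mxvec g 0 l].
  by apply: (fin_all_exists (P := fun ij p => forall g, K g ->
    rho g ij.1 ij.2 = p.@[fun l => mxvec g 0 l])) => -[i j]; apply: rp.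
have [L HL] := fin_all_exists (fun ij => @mpoly_derivative F _ x0 (p ij)).
exists (fun Y => \matrix_(i, j) \sum_l L (i, j) l * mxvec Y 0 l); split.
  move=> c x y; apply/matrixP => i j; rewrite !mxE mulr_sumr -big_split.
  by apply: eq_bigr => l _; rewrite linearP !mxE /=; ring.
move=> gam G [N [gE G0]] Kg G01.
pose Gp l : {poly F} := \poly_(k < N) (mxvec (G k) 0 l).
have GpE l t : (Gp l).[t] = mxvec (gam t) 0 l.
  rewrite horner_poly gE linear_sum summxE; apply: eq_bigr => k _.
  by rewrite linearZ !mxE mulrC.
have Gpc l k : (Gp l)`_k = mxvec (G k) 0 l.
  by rewrite coef_poly; case: ltnP => // /G0 ->; rewrite linear0 mxE.
have HGp l : (Gp l).[0] = x0 l by rewrite horner_coef0 Gpc G01.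
have [q Hq] := fin_all_exists (fun ij => HL ij Gp HGp).
pose M := \max_ij size (q ij).
exists (fun k => \matrix_(i, j) (q (i, j))`_k); split.
  exists M; split=> [t|k Mk].
    apply/matrixP => i j; rewrite (Hp (i, j)) // summxE.
    have [qE _] := Hq (i, j); have := qE t.
    rewrite (meval_eq (v2 := fun l => mxvec (gam t) 0 l)) // => <-.
    rewrite (horner_coef_wide t (n := M)) ?(leq_bigmax (i, j)) //.
    by apply: eq_bigr => k _; rewrite !mxE mulrC.
  apply/matrixP => i j; rewrite !mxE nth_default //.
  by apply: leq_trans Mk; apply: (leq_bigmax (i, j)).
apply/matrixP => i j; rewrite !mxE.
have [_] := Hq (i, j); rewrite horner_coef0 coef_deriv mulr1n => ->.
by apply: eq_bigr => l _; rewrite horner_coef0 coef_deriv mulr1n Gpc.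
Qed.

Definition expo (Y : 'M[F]_n) := nilmx Y /\ forall t, K (exp_nilp (t *: Y)).

(** A substitute for membership in the Lie algebra of [K]. By [Tan_bracket] it survives brackets
    with exponentiable elements, so it also covers the semisimple [[e, f]]. *)
Definition Tan D (Y : 'M[F]_n) := forall g, K g ->
  D (g *m Y *m invmx g) = rho g *m D Y *m rho (invmx g).

Lemma pcurve_at0 m p (gam : F -> 'M[F]_(m, p)) C : pcurve gam C -> gam 0 = C 0%N.
Proof.
move=> [[|N] [-> C0]]; first by rewrite big_ord0 C0.
rewrite big_ord_recl expr0 scale1r big1 ?addr0 // => i _.
by rewrite expr0n scale0r.
Qed.

Lemma one_param_exp (phi : F -> 'M[F]_d) Phi : pcurve phi Phi ->
  phi 0 = 1%:M -> (forall s t, phi (s + t) = phi s *m phi t) ->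
  nilmx (Phi 1%N) /\ forall t, phi t = exp_nilp (t *: Phi 1%N).
Proof.
move=> cP phi0 phiM; have [M [PE PM]] := cP.
(* Comparison of the coefficients of [s^j t^l] in [phi (s + t) = phi s *m phi t]. *)
have mul1 j l : Phi j *m Phi l = 'C(j + l, j)%:R *: Phi (j + l)%N.
  pose c t j l : 'M[F]_d := t ^+ l *: ('C(j + l, j)%:R *: Phi (j + l)%N).
  have step t : Phi j *m phi t = \sum_(l < M) c t j l.
    have := pcurve_uniq (phiM^~ t) _ (pcurve_mulr (phi t) cP) j.
    move=> /(_ (fun j => \sum_(l < M) c t j l)) -> //.
    exists M; split=> [s|k Mk]; last first.
      by rewrite big1 // => r _; rewrite /c PM ?scaler0 //; lia.
    pose f j l : 'M[F]_d := s ^+ j *: c t j l.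
    transitivity (\sum_(k < M) \sum_(j < k.+1) f j (k - j)%N).
      rewrite PE; apply: eq_bigr => k _; rewrite addrC exprDn scaler_suml.
      apply: eq_bigr => i _; have ik : (i <= k)%N by rewrite -ltnS.
      rewrite /f /c subnKC // !scalerA; congr (_ *: _).
      by rewrite -mulr_natr; ring.
    rewrite triangle_sum; apply: eq_bigr => i _.
    rewrite -scaler_sumr; congr (_ *: _).
    rewrite -(pcurve_widen t (C := fun l => 'C(i + l, i)%:R *: Phi (i + l)%N)
      (M := M)) ?leq_subr //.
    by move=> k Mk; rewrite PM ?scaler0 //; lia.
  apply: (@pcurve_uniq _ _ _ _ _ (fun l => Phi j *m Phi l)
     (fun l => 'C(j + l, j)%:R *: Phi (j + l)%N) step).
    exact: pcurve_mull.
  by exists M; split=> // k Mk; rewrite PM ?scaler0 //; lia.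
have Phi0 : Phi 0%N = 1%:M by rewrite -(pcurve_at0 cP).
have PhiE k : Phi k = expk (Phi 1%N) k.
  elim: k => [|k IH]; first by rewrite /expk expr0 fact0 invr1 scale1r.
  have k0 : k.+1%:R != 0 :> F by rewrite pnatr_eq0.
  apply: (scalerI k0); have := mul1 k 1%N; rewrite addn1 binSn => <-.
  rewrite IH /expk factS natrM invfM scalerA mulrA mulfV // mul1r.
  by rewrite exprSr -scalemxAl.
have PM0 : Phi 1%N ^+ M = 0.
  have := PM M (leqnn M); rewrite PhiE => /eqP; rewrite scaler_eq0 invr_eq0 pnatr_eq0.
  by rewrite -leqn0 leqNgt fact_gt0 /= => /eqP.
split; first by exists M.
move=> t; rewrite (exp_nilpE (N := M) (M := M)) ?mxexprZ ?PM0 ?scaler0 //.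
by rewrite PE; apply: eq_bigr => k _; rewrite PhiE expkZ.
Qed.

Lemma rep_differential : exists D, [/\ islin D,
  forall Y, expo Y -> nilmx (D Y) /\ forall t, rho (exp_nilp (t *: Y)) = exp_nilp (t *: D Y)
  & forall Y, expo Y -> Tan D Y].
Proof.
have [D [Dl HD]] := rep_derivative; exists D; have [r1 rM _] := rK.
have e0 m (Y : 'M[F]_m) : expk Y 0 = 1%:M.
  by rewrite /expk expr0 fact0 invr1 scale1r.
split=> // Y [nY KY].
  have [Phi [cP P1]] := HD _ _ (pcurve_exp nY) KY (e0 _ _).
  rewrite -[Y in D Y]expk1 -P1; apply: one_param_exp => //.
    by rewrite scale0r exp0.
  by move=> s t; rewrite exp_add // rM.
have [Phi [cP P1]] := HD _ _ (pcurve_exp nY) KY (e0 _ _).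
move=> g Kg; have gu := KU Kg.
have cg := pcurve_mulr (invmx g) (pcurve_mull g (pcurve_exp nY)).
have Kt t : K (g *m exp_nilp (t *: Y) *m invmx g) by do !apply: KM => //; apply: KV.
have [|Phi2 [cP2 P2]] := HD _ _ cg Kt; first by rewrite e0 mulmx1 mulmxV.
rewrite -[Y in LHS]expk1 -[Y in RHS]expk1 -P1 -P2.
apply: (pcurve_uniq _ cP2 (pcurve_mulr _ (pcurve_mull _ cP))) => t.
have KVg := KV Kg; have KgY := KM Kg (KY t).
by rewrite !rM.
Qed.

Variable D : 'M[F]_n -> 'M[F]_d.
Hypotheses (Dlin : islin D) (Dexp : forall Y, expo Y ->
  nilmx (D Y) /\ forall t, rho (exp_nilp (t *: Y)) = exp_nilp (t *: D Y)).

(** Both claims compare the coefficients of [t] in the image under [D] of the curve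
    [exp(tZ) Y exp(-tZ)], conjugated by [g] for the second one. *)
Lemma Tan_bracket Z Y : expo Z -> Tan D Y ->
  D (bracket Z Y) = bracket (D Z) (D Y) /\ Tan D (bracket Z Y).
Proof.
move=> eZ tY; have [nZ KZ] := eZ; have [nDZ DZ] := Dexp eZ; have [r1 rM _] := rK.
have adk1 m (A B : 'M[F]_m) : (1`!%:R)^-1 *: adk A B 1 = bracket A B.
  by rewrite (_ : 1`! = 1%N) // invr1 scale1r.
have Einv t : invmx (exp_nilp (t *: Z)) = exp_nilp (- (t *: Z)).
  by apply: exp_inv; apply: nilmxZ.
have Rinv t : rho (exp_nilp (- (t *: Z))) = exp_nilp (- (t *: D Z)).
  by rewrite -!scaleNr DZ.
have E t : D (exp_nilp (t *: Z) *m Y *m exp_nilp (- (t *: Z)))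
   = exp_nilp (t *: D Z) *m D Y *m exp_nilp (- (t *: D Z)).
  by rewrite -Einv tY // Einv Rinv DZ.
split.
  rewrite -[in LHS]adk1 -[in RHS]adk1.
  exact: (pcurve_uniq E (pcurve_lin Dlin (pcurve_conj Y nZ)) (pcurve_conj (D Y) nDZ) 1%N).
move=> g Kg; have gu := KU Kg.
have DZY : D (bracket Z Y) = bracket (D Z) (D Y).
  rewrite -[in LHS]adk1 -[in RHS]adk1.
  exact: (pcurve_uniq E (pcurve_lin Dlin (pcurve_conj Y nZ)) (pcurve_conj (D Y) nDZ) 1%N).
rewrite DZY -[in LHS]adk1 -[in RHS]adk1.
have c1 := pcurve_lin Dlin (pcurve_mulr (invmx g) (pcurve_mull g (pcurve_conj Y nZ))).
have c2 := pcurve_mulr (rho (invmx g)) (pcurve_mull (rho g) (pcurve_conj (D Y) nDZ)).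
apply: (pcurve_uniq _ c1 c2) => t.
have Kgt : K (g *m exp_nilp (t *: Z)) by apply: KM.
have Ku : exp_nilp (t *: Z) \in unitmx by apply: KU.
have := tY _ Kgt; rewrite invmx_mul // Einv.
have KE : K (exp_nilp (- (t *: Z))) by rewrite -scaleNr.
rewrite !rM ?DZ ?Rinv //; last exact: KV.
by rewrite !mulmxA.
Qed.

End Derivative.

(** * Subspaces and linear maps given by predicates *)

Section Subspaces.
Variable F : fieldType.

(** A matrix with rows in [S] is enlarged until its row space is all of [S]; the rank bounds the
    number of steps. Excluded middle decides whether [S] is exhausted. *)
Lemma lin_repr d (S : 'cV[F]_d -> Prop) : lin S ->
  exists r (B : 'M[F]_(d, r)), (forall z : 'cV_r, B *m z = 0 -> z = 0)
    /\ forall x, S x <-> exists z, x = B *m z.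
Proof.
move=> HS.
pose good (A : 'M[F]_d) := forall u : 'rV_d, (u <= A)%MS -> S u^T.
have step j : exists2 A, good A & (forall x, S x -> (x^T <= A)%MS) \/ (j <= \rank A)%N.
  elim: j => [|j [A gA [fA | rA]]].
  - exists 0; last by right.
    by move=> u; rewrite submx0 => /eqP ->; rewrite trmx0; case: HS.
  - by exists A => //; left.
  case: (boolp.EM (forall x, S x -> (x^T <= A)%MS)) => [fA | nfA].
    by exists A => //; left.
  have [x [Sx nx]] : exists x, S x /\ ~~ (x^T <= A)%MS.
    apply: boolp.contrapT => H; apply: nfA => x Sx; apply: boolp.contrapT => nx.
    by apply: H; exists x; split=> //; apply/negP.
  exists (A + x^T)%MS.
    move=> u /sub_addsmxP[[u1 u2] /= ->]; rewrite linearD /=; apply: linD => //.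
      by apply: gA; apply: submxMl.
    rewrite trmx_mul trmxK [u2^T]mx11_scalar mul_mx_scalar.
    exact: linZ.
  right; apply: leq_ltn_trans rA _; apply: rank_ltmx.
  rewrite /ltmx addsmxSl /=; apply: contra nx; by rewrite addsmx_sub => /andP[].
have [A gA [fA | ]] := step d.+1; last by rewrite ltnNge rank_leq_row.
exists (\rank A), (row_base A)^T; split=> [z|x].
  move=> /(congr1 trmx); rewrite trmx_mul trmxK trmx0 => /eqP.
  by rewrite mulmx_free_eq0 ?row_base_free // => /eqP /(congr1 trmx); rewrite trmxK trmx0.
split=> [/fA | [z ->]].
  rewrite -(eq_row_base A) => /submxP[D xD]; exists D^T.
  by rewrite -trmx_mul -xD trmxK.
rewrite -[X in S X]trmxK; apply: gA.
by rewrite trmx_mul trmxK -(eq_row_base A) submxMl.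
Qed.

Lemma inj_unitmx d (G : 'M[F]_d) : (forall z : 'cV_d, G *m z = 0 -> z = 0) ->
  G \in unitmx.
Proof.
move=> H; rewrite -unitmx_tr -row_free_unit -kermx_eq0; apply/rowV0P => u.
move/sub_kermxP => uG; apply: trmx_inj; rewrite trmx0; apply: H.
by rewrite -[G]trmxK -trmx_mul uG trmx0.
Qed.

Lemma lin_fun_mx d d' (R : 'cV[F]_d -> 'cV[F]_d' -> Prop) :
  (forall x, exists y, R x y) -> (forall x y y', R x y -> R x y' -> y = y') ->
  (forall c x y x' y', R x y -> R x' y' -> R (c *: x + x') (c *: y + y')) ->
  exists P : 'M[F]_(d', d), forall x, R x (P *m x).
Proof.
move=> tot fct Rl.
have [b Hb] : exists b : 'I_d -> 'cV[F]_d', forall i, R (delta_mx i 0) (b i).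
  by apply: (fin_all_exists (P := fun i y => R (delta_mx i 0) y)) => i; apply: tot.
have R0 : R 0 0.
  have [y Ry] := tot 0; have := Rl (-1) _ _ _ _ Ry Ry.
  by rewrite !scaleN1r !addNr.
exists (\matrix_(i, j) b j i 0) => x.
have -> : x = \sum_i x i 0 *: delta_mx i 0.
  apply/colP => i; rewrite summxE (bigD1 i) //= !mxE !eqxx mulr1 big1 ?addr0 // => j ji.
  by rewrite !mxE eq_sym (negPf ji) mulr0.
have -> : (\matrix_(i, j) b j i 0) *m (\sum_i x i 0 *: delta_mx i 0)
    = \sum_i x i 0 *: b i.
  rewrite mulmx_sumr; apply: eq_bigr => i _; rewrite -scalemxAr -colE; congr (_ *: _).
  by apply/colP => j; rewrite !mxE.
apply: (big_ind2 R) => //.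
  by move=> x1 x2 y1 y2 r1 r2; have := Rl 1 _ _ _ _ r1 r2; rewrite !scale1r.
by move=> i _; have := Rl (x i 0) _ _ _ _ (Hb i) R0; rewrite !addr0.
Qed.

End Subspaces.

(** * The standard hermitian form *)

Section Hermitian.
Variable C : numClosedFieldType.

Definition adjm m n (A : 'M[C]_(m, n)) : 'M[C]_(n, m) := (map_mx Num.conj A)^T.
Definition dot d (x y : 'cV[C]_d) : C := (adjm x *m y) 0 0.

Lemma adjmK m n (A : 'M[C]_(m, n)) : adjm (adjm A) = A.
Proof. by apply/matrixP => i j; rewrite !mxE conjCK. Qed.

Lemma adjmM m n p (A : 'M[C]_(m, n)) (B : 'M_(n, p)) :
  adjm (A *m B) = adjm B *m adjm A.
Proof. by rewrite /adjm map_mxM trmx_mul. Qed.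

Lemma adjmT m n p q (A : 'M[C]_(m, n)) (B : 'M[C]_(p, q)) :
  adjm (A *t B) = adjm A *t adjm B.
Proof. by rewrite /adjm map_mxT trmx_tens. Qed.

Lemma adjmD m n (A B : 'M[C]_(m, n)) : adjm (A + B) = adjm A + adjm B.
Proof. by apply/matrixP => i j; rewrite !mxE rmorphD. Qed.

Lemma adjm1 n : adjm (1%:M : 'M[C]_n) = 1%:M.
Proof. by rewrite /adjm map_mx1 trmx1. Qed.

Lemma dotE d (x y : 'cV[C]_d) : dot x y = \sum_i (x i 0)^* * y i 0.
Proof. by rewrite /dot mxE; apply: eq_bigr => i _; rewrite !mxE. Qed.

Lemma dotC d (x y : 'cV[C]_d) : dot x y = (dot y x)^*.
Proof.
rewrite !dotE rmorph_sum; apply: eq_bigr => i _.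
by rewrite rmorphM /= conjCK mulrC.
Qed.

Lemma dotDr d c (x y z : 'cV[C]_d) : dot x (c *: y + z) = c * dot x y + dot x z.
Proof. by rewrite /dot mulmxDr -scalemxAr !mxE. Qed.

Lemma dotDl d c (x y z : 'cV[C]_d) : dot (c *: x + y) z = c^* * dot x z + dot y z.
Proof. by rewrite dotC dotDr rmorphD rmorphM /= -!dotC. Qed.

Lemma dot0r d (x : 'cV[C]_d) : dot x 0 = 0.
Proof. by rewrite /dot mulmx0 mxE. Qed.

Lemma dotZr d c (x y : 'cV[C]_d) : dot x (c *: y) = c * dot x y.
Proof. by have := dotDr c x y 0; rewrite addr0 dot0r addr0. Qed.

Lemma dotBr d (x y z : 'cV[C]_d) : dot x (y - z) = dot x y - dot x z.
Proof. by rewrite addrC -scaleN1r dotDr mulN1r addrC. Qed.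

Lemma dot0l d (x : 'cV[C]_d) : dot 0 x = 0.
Proof. by rewrite dotC dot0r conjC0. Qed.

Lemma dotMl d d' (A : 'M[C]_(d', d)) x y : dot (A *m x) y = dot x (adjm A *m y).
Proof. by rewrite /dot adjmM mulmxA. Qed.

Lemma dotMr d d' (A : 'M[C]_(d', d)) x y : dot x (A *m y) = dot (adjm A *m x) y.
Proof. by rewrite dotMl adjmK. Qed.

Lemma dot_eq0 d (x : 'cV[C]_d) : dot x x = 0 -> x = 0.
Proof.
rewrite dotE => /eqP; rewrite psumr_eq0 => [/allP H|i _]; last first.
  by rewrite mulrC mul_conjC_ge0.
apply/colP => i; rewrite mxE; have := H i (mem_index_enum _).
by rewrite mulrC mul_conjC_eq0 => /eqP.
Qed.

Lemma lin_orth d (S : 'cV[C]_d -> Prop) : lin (fun x => forall y, S y -> dot y x = 0).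
Proof.
split=> [y _|c x z Hx Hz y Sy]; first exact: dot0r.
by rewrite dotDr Hx // Hz // mulr0 addr0.
Qed.

Lemma orth_projection d (S : 'cV[C]_d -> Prop) x : lin S ->
  exists2 s, S s & forall y, S y -> dot y (x - s) = 0.
Proof.
move=> /lin_repr[r [B [Binj SE]]].
(* The Gram matrix of a basis is invertible because the form is positive definite. *)
have uG : adjm B *m B \in unitmx.
  apply: inj_unitmx => z Gz; apply: Binj; apply: dot_eq0.
  by rewrite dotMl mulmxA Gz dot0r.
exists (B *m (invmx (adjm B *m B) *m (adjm B *m x))).
  by apply/SE; eexists; reflexivity.
move=> y /SE[z ->]; rewrite dotMl mulmxBr.
by rewrite [adjm B *m (B *m _)]mulmxA mulKVmx // subrr dot0r.
Qed.

End Hermitian.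

Definition consf (T : Type) (x : T) (u : nat -> T) (l : nat) : T :=
  if l is l'.+1 then u l' else x.

(** * Highest weight modules *)

Section ChevalleyModules.
Variables (C : numClosedFieldType) (r : nat) (a : 'I_r -> 'I_r -> int).
Variable c : 'I_r -> C.
Hypotheses (a2 : forall i, a i i = 2).
Hypothesis grading : forall j, \sum_i c i * (a i j)%:~R = 1.

Record chev d (E F H : 'I_r -> 'M[C]_d) : Prop := Chev {
  chEF : forall i j, bracket (E i) (F j) = if i == j then H i else 0;
  chHE : forall i j, bracket (H i) (E j) = (a i j)%:~R *: E j;
  chHF : forall i j, bracket (H i) (F j) = - (a i j)%:~R *: F j;
  chHH : forall i j, bracket (H i) (H j) = 0 }.

Definition hwv d (E H : 'I_r -> 'M[C]_d) (m : 'I_r -> nat) (v : 'cV[C]_d) :=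
  [/\ v != 0, forall i, E i *m v = 0 & forall i, H i *m v = (m i)%:R *: v].

Definition stab d (X : 'I_r -> 'M[C]_d) (S : 'cV[C]_d -> Prop) :=
  forall i x, S x -> S (X i *m x).

Definition irrmod d (E F : 'I_r -> 'M[C]_d) (S : 'cV[C]_d -> Prop) :=
  forall S0, lin S0 -> stab E S0 -> stab F S0 -> (forall x, S0 x -> S x) ->
  (exists x, S0 x /\ x != 0) -> forall x, S x -> S0 x.

(** Only lowering operators occur; for a highest weight vector [v] this is already the generated
    submodule, by [cyc_stabE] and [cyc_stabH]. *)
Inductive cyc d (F : 'I_r -> 'M[C]_d) (v : 'cV[C]_d) : 'cV[C]_d -> Prop :=
| CycGen : cyc F v v
| Cyc0 : cyc F v 0
| CycLin k x y : cyc F v x -> cyc F v y -> cyc F v (k *: x + y)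
| CycF i x : cyc F v x -> cyc F v (F i *m x).

(** By [grading] it has eigenvalue 1 on every [E j] and -1 on every [F j]: it is the half sum of the
    positive coroots. Its eigenvalues measure the depth below the highest weight and replace the
    decomposition into weight spaces. *)
Definition hgrad d (H : 'I_r -> 'M[C]_d) := \sum_i c i *: H i.
Definition degree (m : 'I_r -> nat) : C := \sum_i c i * (m i)%:R.

Lemma cyc_lin d F v : lin (@cyc d F v).
Proof. by split; [apply: Cyc0 | apply: CycLin]. Qed.

Lemma cyc_min d F v S : lin S -> S v -> stab F S -> forall x, @cyc d F v x -> S x.
Proof.
move=> HS Sv SF x; elim=> {x} //; first by case: HS.
  by move=> k x y _ Sx _ Sy; case: HS => _; apply.
by move=> i x _ Sx; apply: SF.
Qed.

Section OneModule.
Variables (d : nat) (E F H : 'I_r -> 'M[C]_d).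
Hypothesis ch : chev E F H.

Lemma chev_sl2 i : sl2 (E i) (F i) (H i).
Proof. by split; rewrite ?(chEF ch) ?eqxx // ?(chHE ch) ?(chHF ch) a2. Qed.

Lemma hgradE j : bracket (hgrad H) (E j) = E j.
Proof.
rewrite bracketC /hgrad bracket_sum -sumrN -[RHS]scale1r -(grading j) scaler_suml.
by apply: eq_bigr => i _; rewrite bracketZr -scalerN -bracketC (chHE ch) scalerA.
Qed.

Lemma hgradF j : bracket (hgrad H) (F j) = - F j.
Proof.
rewrite bracketC /hgrad bracket_sum; congr (- _).
rewrite -[RHS]scale1r -(grading j) scaler_suml.
apply: eq_bigr => i _; rewrite bracketZr bracketC (chHF ch).
by rewrite scaleNr opprK scalerA.
Qed.

Lemma stab_hgrad S x : lin S -> stab H S -> S x -> S (hgrad H *m x).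
Proof.
move=> HS SH Sx; rewrite /hgrad mulmx_suml; apply: lin_sum => // i _.
by rewrite -scalemxAl; apply: linZ => //; apply: SH.
Qed.

Lemma stab_H S : lin S -> stab E S -> stab F S -> stab H S.
Proof.
move=> HS SE SF i x Sx; rewrite -(sl2_ef (chev_sl2 i)) /bracket mulmxBl.
by rewrite -!mulmxA; apply: linB => //; [apply/SE/SF | apply/SF/SE].
Qed.

Definition wordE (w : seq 'I_r) : 'M[C]_d := foldr (fun i X => E i *m X) 1%:M w.

Lemma hgrad_word w : bracket (hgrad H) (wordE w) = (size w)%:R *: wordE w.
Proof.
elim: w => [|i w IH] /=.
  by rewrite scale0r /bracket mulmx1 mul1mx subrr.
rewrite bracketMr hgradE IH -scalemxAr -[X in X + _]scale1r -scalerDl.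
by rewrite nat1r.
Qed.

Lemma wordE_vanish : exists l, forall w, size w = l -> wordE w = 0.
Proof.
(* [u l] is a nonzero word of length [l] whenever there is one, and has degree [l], so [u l = 0]
   means that all words of that length vanish. *)
pose u l : 'M[C]_d := if [pick w : l.-tuple 'I_r | wordE w != 0] is Some w
  then wordE w else 0.
have [|l||l _ ul] := @eigen_sequence_vanishes _ _ (bracket (hgrad H)) u (fun l => l%:R).
- exact: bracket_lin.
- by move=> k /eqP; rewrite eqr_nat => /eqP.
- move=> l; rewrite /u; case: pickP => [w _|_]; last by rewrite bracket_0 scaler0.
  by rewrite hgrad_word size_tuple.
exists l => w sw; apply/eqP; apply: contraT => w0.
have swl : size w == l by apply/eqP.
move: ul; rewrite /u; case: pickP => [w' /eqP //|].
by move=> /(_ (Tuple swl)); rewrite /= w0.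
Qed.

(** A longest word in the [E i] that does not kill [x] yields the vector. *)
Lemma killed_vector S x : stab E S -> S x -> x != 0 ->
  exists y, [/\ S y, y != 0 & forall i, E i *m y = 0].
Proof.
move=> SE Sx x0.
have Sw w : S (wordE w *m x).
  by elim: w => [|i w IH] /=; rewrite ?mul1mx // -mulmxA; apply: SE.
have ex : exists l, [forall w : l.-tuple 'I_r, wordE w *m x == 0].
  have [l Hl] := wordE_vanish; exists l; apply/forallP => w.
  by rewrite Hl ?size_tuple // mul0mx.
case: (ex_minnP ex) => -[|l] Hl minl.
  by have /forallP/(_ [tuple]) := Hl; rewrite /= mul1mx (negPf x0).
have /forallPn[w w0] : ~~ [forall w : l.-tuple 'I_r, wordE w *m x == 0].
  by apply/negP => /minl; rewrite ltnn.
exists (wordE w *m x); split=> // i.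
have /forallP/(_ [tuple of i :: w]) /eqP := Hl.
by rewrite /= -mulmxA.
Qed.

Lemma sl2_components i (S : 'cV[C]_d -> Prop) v : lin S ->
  (forall x, S x -> S (H i *m x)) -> S v -> v != 0 ->
  exists y mu, [/\ S y, y != 0 & H i *m y = (mu : C) *: y].
Proof.
move=> HS SH Sv v0.
have [N [A [mu [imu sumA hA _ _]]]] := sl2_diag (chev_sl2 i).
have SA j : S (A j *m v).
  apply: (@eig_split_fin _ _ S (fun x => H i *m x) _ (fun j => (mu j)%:~R : C)
    (fun j => A j *m v)) => //.
  - by move=> k x y; rewrite mulmxDr -scalemxAr.
  - by move=> j1 j2 /intr_inj /imu.
  - by move=> k; rewrite mulmxA hA -scalemxAl.
  - by rewrite -mulmx_suml sumA mul1mx.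
have [/existsP[j Aj]|/existsPn none] := boolP [exists j, A j *m v != 0].
  exists (A j *m v), (mu j)%:~R; split=> //.
  by rewrite mulmxA hA -scalemxAl.
case/eqP: v0; rewrite -[v]mul1mx -sumA mulmx_suml big1 // => j _.
by apply/eqP; rewrite -[_ == _]negbK; apply: none.
Qed.

Lemma hwv_exists S x : lin S -> stab E S -> stab H S -> S x -> x != 0 ->
  exists m v, S v /\ hwv E H m v.
Proof.
move=> HS SE SH Sx x0; have [y0 [Sy0 y00 Ey0]] := killed_vector SE Sx x0.
(* The [H i] are diagonalized one after the other, inside the space of killed vectors that are
   already eigenvectors for the indices in [s]. *)
have ind (s : seq 'I_r) : exists mu : 'I_r -> C, exists y, [/\ S y, y != 0,
    forall i, E i *m y = 0 & forall i, i \in s -> H i *m y = mu i *: y].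
  elim: s => [|i s [mu [y [Sy yn0 Ey Hy]]]]; first by exists (fun=> 0), y0.
  pose S' x := [/\ S x, forall i, E i *m x = 0 & forall i, i \in s -> H i *m x = mu i *: x].
  have [||||z [nu [[Sz Ez Hz] z0 Hnu]]] := @sl2_components i S' y.
  - split; first by split; [case: HS | move=> j; rewrite mulmx0 | move=> j _;
      rewrite mulmx0 scaler0].
    move=> k p q [Sp Ep Hp] [Sq Eq Hq]; split; first by case: HS => _; apply.
      by move=> j; rewrite mulmxDr -scalemxAr Ep Eq scaler0 addr0.
    move=> j js; rewrite mulmxDr -scalemxAr Hp // Hq // scalerDr !scalerA.
    by rewrite mulrC.
  - move=> p [Sp Ep Hp]; split; first exact: SH.
      move=> j; have := chHE ch i j; rewrite /bracket => /eqP; rewrite subr_eq.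
      move=> /eqP /(congr1 (fun X => X *m p)); rewrite mulmxDl -scalemxAl -!mulmxA.
      by rewrite !Ep scaler0 add0r mulmx0.
    move=> j js; have := chHH ch j i; rewrite /bracket => /eqP; rewrite subr_eq0.
    move=> /eqP /(congr1 (fun X => X *m p)); rewrite -!mulmxA => ->.
    by rewrite Hp // -scalemxAr.
  - by split.
  - exact: yn0.
  exists (fun j => if j == i then nu else mu j), z; split=> // j.
  rewrite inE; case: eqP => [-> _ //|_ /= js]; exact: Hz.
have [mu [y [Sy yn0 Ey Hy]]] := ind (enum 'I_r).
have Hy' i : H i *m y = mu i *: y by apply: Hy; rewrite mem_enum.
have [m Hm] := fin_all_exists (fun i => sl2_hw_nat (chev_sl2 i) yn0 (Ey i) (Hy' i)).
by exists m, y; split=> //; split=> // i; rewrite Hy' Hm.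
Qed.

Section HighestWeight.
Variables (m : 'I_r -> nat) (v : 'cV[C]_d).
Hypothesis hv : hwv E H m v.

Lemma hwv_grad : hgrad H *m v = degree m *: v.
Proof.
have [_ _ Hv] := hv; rewrite mulmx_suml /degree scaler_suml.
by apply: eq_bigr => i _; rewrite -scalemxAl Hv scalerA.
Qed.

Lemma cyc_stabH : stab H (cyc F v).
Proof.
have [_ _ Hv] := hv; have L := cyc_lin F v.
move=> i x cx; elim: cx i => {x} [||k x y _ IHx _ IHy|j x cx IH] i.
- by rewrite Hv; apply: linZ => //; apply: CycGen.
- by rewrite mulmx0; apply: Cyc0.
- by rewrite mulmxDr -scalemxAr; apply: CycLin.
- have := chHF ch i j; rewrite /bracket => /eqP; rewrite subr_eq => /eqP HF.
  rewrite mulmxA HF mulmxDl -scalemxAl -mulmxA; apply: CycLin; apply: CycF => //.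
Qed.

Lemma cyc_stabE : stab E (cyc F v).
Proof.
have [_ Ev _] := hv; have L := cyc_lin F v.
move=> i x cx; elim: cx i => {x} [||k x y _ IHx _ IHy|j x cx IH] i.
- by rewrite Ev; apply: Cyc0.
- by rewrite mulmx0; apply: Cyc0.
- by rewrite mulmxDr -scalemxAr; apply: CycLin.
- have := chEF ch i j; rewrite /bracket => /eqP; rewrite subr_eq => /eqP EF.
  rewrite mulmxA EF mulmxDl -mulmxA; apply: linD => //; last exact: CycF.
  by case: eqP => _; [apply: cyc_stabH | rewrite mul0mx; apply: Cyc0].
Qed.

(** The decomposition by depth; the part of depth 0 lies on the line of [v]. *)
Lemma cyc_decomp x : cyc F v x -> exists N (u : nat -> 'cV[C]_d),
  [/\ x = \sum_(l < N) u l, forall l, hgrad H *m u l = (degree m - l%:R) *: u l,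
      forall l, (N <= l)%N -> u l = 0 & exists k, u 0%N = k *: v].
Proof.
elim=> {x} [||k x y _ [N [u [-> Hu u0 [k1 uk]]]] _ [M [w [-> Hw w0 [k2 wk]]]]
           |i x _ [N [u [-> Hu u0 [k uk]]]]].
- exists 1%N, (consf v (fun=> 0)); split.
  + by rewrite big_ord1.
  + by case=> [|l]; rewrite ?subr0 ?hwv_grad // mulmx0 scaler0.
  + by case.
  + by exists 1; rewrite scale1r.
- exists 0%N, (fun=> 0); split=> //; first by rewrite big_ord0.
    by move=> l; rewrite mulmx0 scaler0.
  by exists 0; rewrite scale0r.
- exists (N + M)%N, (fun l => k *: u l + w l); split.
  + rewrite big_split /= -scaler_sumr; congr (_ *: _ + _).
      rewrite big_split_ord /= [X in _ + X]big1 ?addr0 // => j _.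
      by rewrite u0 ?leq_addr.
    rewrite addnC big_split_ord /= [X in _ + X]big1 ?addr0 // => j _.
    by rewrite w0 ?leq_addr.
  + by move=> l; rewrite mulmxDr -scalemxAr Hu Hw scalerDr !scalerA mulrC.
  + by move=> l Nl; rewrite u0 ?w0 ?scaler0 ?addr0 //; lia.
  + by exists (k * k1 + k2); rewrite uk wk scalerDl scalerA.
- exists N.+1, (consf 0 (fun l => F i *m u l)); split.
  + by rewrite big_ord_recl add0r mulmx_sumr.
  + case=> [|l]; first by rewrite mulmx0 scaler0.
    have := hgradF i; rewrite /bracket => /eqP; rewrite subr_eq => /eqP HF.
    rewrite mulmxA HF mulmxDl -mulmxA Hu -scalemxAr mulNmx -scaleN1r -scalerDl.
    by congr (_ *: _); rewrite -nat1r; ring.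
  + by case=> // l Nl; rewrite /= u0 ?mulmx0.
  + by exists 0; rewrite scale0r.
Qed.

Lemma grad_split (S : 'cV[C]_d -> Prop) N (u : nat -> 'cV[C]_d) : lin S ->
  (forall x, S x -> S (hgrad H *m x)) ->
  (forall l, hgrad H *m u l = (degree m - l%:R) *: u l) ->
  S (\sum_(l < N) u l) -> forall l, (l < N)%N -> S (u l).
Proof.
move=> HS SH Hu Su l lN.
apply: (@eig_split_fin _ _ S (fun x => hgrad H *m x) _
  (fun l : 'I_N => degree m - l%:R) (fun l : 'I_N => u l) _ _ _ _ _ _ (Ordinal lN)) => //.
- by move=> k x y; rewrite mulmxDr -scalemxAr.
- by move=> i j /addrI /oppr_inj /eqP; rewrite eqr_nat => /eqP /val_inj.
Qed.

Lemma cyc_top x : cyc F v x -> hgrad H *m x = degree m *: x -> exists k, x = k *: v.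
Proof.
move=> /cyc_decomp[N [u [xE Hu u0 [k uk]]]] Hx; exists k; rewrite -uk.
apply/eqP; rewrite -subr_eq0; apply/eqP.
(* [x] has depth 0 like [u 0], so it is absorbed there; the resulting components sum to zero and
   must all vanish. *)
pose w := consf (u 0%N - x) (fun l => u l.+1).
have ww : u 0%N - x = w 0%N by [].
rewrite -opprB ww; suff -> : w 0%N = 0 by rewrite oppr0.
apply: (@grad_split (fun x => x = 0) N.+1 w (lin_zero _)) => //.
- by move=> y ->; rewrite mulmx0.
- case=> [|l]; last exact: Hu.
  by rewrite /w /= mulmxBr Hx Hu subr0 scalerBr.
- rewrite big_ord_recl /= addrAC; apply/eqP; rewrite subr_eq0; apply/eqP.
  rewrite xE; have := big_ord_recl N (fun l : 'I_N.+1 => u l) => /= <-.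
  by rewrite big_ord_recr /= u0 // addr0.
Qed.

(* The orthogonal complement of a submodule is a submodule. *)
Lemma star_irreducible : (forall i, adjm (E i) = F i) -> irrmod E F (cyc F v).
Proof.
move=> EF S0 HS0 S0E S0F S0c [x [S0x x0]].
have FE i : adjm (F i) = E i by rewrite -EF adjmK.
have S0H := stab_H HS0 S0E S0F.
have [s S0s orth] := orth_projection v HS0.
pose S1 y := forall z, S0 z -> dot z y = 0.
have S1l : lin S1 by apply: lin_orth.
have S1E : stab E S1 by move=> i y Hy z S0z; rewrite dotMr EF Hy //; apply: S0F.
have S1F : stab F S1 by move=> i y Hy z S0z; rewrite dotMr FE Hy //; apply: S0E.
have S1H := stab_H S1l S1E S1F.
(* The defect [y] of [s] as an eigenvector of [hgrad H] lies in [S0] and, being also the defect of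
   [v - s] up to sign, in its orthogonal [S1]. Hence [s] has top degree. If [k = 0] then [v] and all
   of [cyc F v] are orthogonal to [S0]; otherwise [v] is in [S0]. *)
have [k sk] : exists k, s = k *: v.
  apply: cyc_top; first exact: S0c.
  apply/eqP; rewrite -subr_eq0; apply/eqP; apply: dot_eq0.
  set y := _ - _; have S0y : S0 y.
    by apply: linB => //; [exact: (stab_hgrad HS0 S0H) | exact: linZ].
  have yE : y = degree m *: (v - s) - hgrad H *m (v - s).
    rewrite /y mulmxBr hwv_grad scalerBr.
    by apply/matrixP => i j; rewrite !mxE; ring.
  rewrite {2}yE; apply: (linB S1l (linZ _ S1l orth) (stab_hgrad S1l S1H orth)).
  exact: S0y.
have [k0 | k0] := eqVneq k 0.
  have S1v : S1 v by move: orth; rewrite sk k0 scale0r subr0.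
  have /(_ x (S0c _ S0x)) S1x := cyc_min S1l S1v S1F.
  by case/eqP: x0; apply: dot_eq0; apply: S1x.
have S0v : S0 v by rewrite -[v](scalerK k0) -sk; apply: linZ.
exact: cyc_min.
Qed.

End HighestWeight.

(* In an irreducible module the highest weight line is unique, because each of
   two highest weight vectors is obtained from the other by lowering. *)
Lemma hwv_unique m v m' y : (forall x, cyc F v x) -> (forall x, cyc F y x) ->
  hwv E H m v -> hwv E H m' y -> exists k, y = k *: v.
Proof.
move=> cv cy hv hy; apply: (cyc_top hv) => //.
have deg m1 v1 m2 v2 : hwv E H m1 v1 -> hwv E H m2 v2 -> cyc F v1 v2 ->
    exists l : nat, degree m2 = degree m1 - l%:R.
  move=> h1 h2 /(cyc_decomp h1)[N [u [uE Hu u0 _]]].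
  apply: boolp.contrapT => nex.
  have [/eqP v20 _ _] := h2; apply: v20.
  (* If the degree of [v2] is not one of the degrees below [m1], then [v2] and its components are
     eigenvectors with distinct eigenvalues and sum zero. *)
  pose mu := consf (degree m2) (fun l => degree m1 - l%:R).
  pose w := consf (- v2) u.
  have imu : injective (fun l : 'I_N.+1 => mu l).
    move=> [[|i] Hi] [[|j] Hj] //= ij; apply: val_inj => //=.
    - by case: nex; exists j.
    - by case: nex; exists i.
    - by move/addrI/oppr_inj/eqP: ij; rewrite eqr_nat => /eqP ->.
  apply: oppr_inj; rewrite oppr0.
  apply: (@eig_split_fin _ _ (fun x => x = 0) (fun x => hgrad H *m x) _
    (fun l : 'I_N.+1 => mu l) (fun l : 'I_N.+1 => w l) (lin_zero _) _ _ imu _ _ ord0).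
  - by move=> k p q; rewrite mulmxDr -scalemxAr.
  - by move=> p ->; rewrite mulmx0.
  - by case=> [[|l] Hl] //=; rewrite mulmxN (hwv_grad h2) scalerN.
  - by rewrite big_ord_recl /= {1}uE addNr.
have [l Hl] := deg _ _ _ _ hv hy (cv y); have [l' Hl'] := deg _ _ _ _ hy hv (cy v).
rewrite (hwv_grad hy); congr (_ *: _).
move: Hl'; rewrite Hl -addrA -opprD -natrD => /eqP.
rewrite -[X in X == _]addr0 => /eqP /addrI /esym/eqP.
rewrite oppr_eq0 pnatr_eq0 addn_eq0 => /andP[/eqP -> _].
by rewrite subr0.
Qed.

End OneModule.

Lemma chev_block d d' (E F H : 'I_r -> 'M[C]_d) (E' F' H' : 'I_r -> 'M[C]_d') :
  chev E F H -> chev E' F' H' ->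
  chev (fun i => block_mx (E i) 0 0 (E' i)) (fun i => block_mx (F i) 0 0 (F' i))
       (fun i => block_mx (H i) 0 0 (H' i)).
Proof.
have bb (X Y : 'M[C]_d) (X' Y' : 'M[C]_d') : bracket (block_mx X 0 0 X') (block_mx Y 0 0 Y')
    = block_mx (bracket X Y) 0 0 (bracket X' Y').
  rewrite /bracket !mulmx_block !mul0mx !mulmx0 !addr0 !add0r.
  by rewrite opp_block_mx add_block_mx !subr0.
move=> ch ch'; split=> i j; rewrite bb.
- rewrite (chEF ch) (chEF ch'); case: eqP => // _.
  by rewrite -[RHS](@block_mx0 C d d' d d').
- by rewrite (chHE ch) (chHE ch') scale_block_mx !scaler0.
- by rewrite (chHF ch) (chHF ch') scale_block_mx !scaler0.
- by rewrite (chHH ch) (chHH ch') (@block_mx0 C d d' d d').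
Qed.

(* The submodule of the direct sum generated by the pair of highest weight
   vectors is the graph of the embedding. *)
Lemma hw_embedding d d' (E F H : 'I_r -> 'M[C]_d) (E' F' H' : 'I_r -> 'M[C]_d')
    m (v : 'cV[C]_d) (v' : 'cV[C]_d') :
  chev E F H -> chev E' F' H' -> hwv E H m v -> hwv E' H' m v' ->
  irrmod E F (fun=> True) -> irrmod E' F' (cyc F' v') ->
  exists P : 'M[C]_(d', d), [/\ forall i, P *m E i = E' i *m P,
    forall i, P *m F i = F' i *m P, P *m v = v',
    forall x : 'cV_d, P *m x = 0 -> x = 0
    & forall y, cyc F' v' y <-> exists x, y = P *m x].
Proof.
move=> ch ch' hv hv' irr irr'.
have chb := chev_block ch ch'.
set Eb := fun i => _ in chb; set Fb := fun i => _ in chb; set Hb := fun i => _ in chb.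
pose vb := col_mx v v'.
have mulb (X : 'M[C]_d) (X' : 'M[C]_d') x y :
    block_mx X 0 0 X' *m col_mx x y = col_mx (X *m x) (X' *m y).
  by rewrite mul_block_col !mul0mx addr0 add0r.
have [v0 Ev Hv] := hv; have [v'0 Ev' Hv'] := hv'.
have hvb : hwv Eb Hb m vb.
  split; first by rewrite col_mx_eq0 negb_and v0.
    by move=> i; rewrite mulb Ev Ev' col_mx0.
  by move=> i; rewrite mulb Hv Hv' scale_col_mx.
pose D x y := cyc Fb vb (col_mx x y).
have DE i x y : D x y -> D (E i *m x) (E' i *m y).
  by move=> /(cyc_stabE chb hvb i); rewrite mulb.
have DF i x y : D x y -> D (F i *m x) (F' i *m y).
  by move=> /(CycF i); rewrite mulb.
have Dl k x y x' y' : D x y -> D x' y' -> D (k *: x + x') (k *: y + y').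
  by move=> d1 d2; have := CycLin k d1 d2; rewrite scale_col_mx add_col_mx.
have D0 : D 0 0 by rewrite /D col_mx0; apply: Cyc0.
have hgb x y : hgrad Hb *m col_mx x y = col_mx (hgrad H *m x) (hgrad H' *m y).
  apply: (big_ind3 (fun X A B => X *m col_mx x y = col_mx (A *m x) (B *m y))).
  - by rewrite !mul0mx col_mx0.
  - by move=> X1 A1 B1 X2 A2 B2 h1 h2; rewrite !mulmxDl h1 h2 add_col_mx.
  - by move=> i _; rewrite -!scalemxAl mulb scale_col_mx.
have cycD x : cyc Fb vb x -> cyc F v (usubmx x) /\ cyc F' v' (dsubmx x).
  elim=> {x} [||k x y _ [x1 x2] _ [y1 y2]|i x _ [x1 x2]].
  - by rewrite col_mxKu col_mxKd; split; apply: CycGen.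
  - by rewrite !linear0; split; apply: Cyc0.
  - by rewrite !linearP; split; apply: CycLin.
  - by rewrite -[x]vsubmxK mulb col_mxKu col_mxKd; split; apply: CycF.
(* The top degree part of the relation [D] is the line of [vb], which contains neither [(0, v')] nor
   [(v, 0)]. Irreducibility then makes [D] functional and injective. *)
have D0v' : ~ D 0 v'.
  move=> Dv'; have [|k] := cyc_top chb hvb Dv'.
    by rewrite hgb (hwv_grad hv') mulmx0 scale_col_mx scaler0.
  rewrite /vb scale_col_mx => /eq_col_mx[/esym/eqP].
  rewrite scaler_eq0 (negPf v0) orbF => /eqP ->; rewrite scale0r => v'E.
  by rewrite v'E eqxx in v'0.
have Dv0 : ~ D v 0.
  move=> Dv; have [|k] := cyc_top chb hvb Dv.
    by rewrite hgb (hwv_grad hv) mulmx0 scale_col_mx scaler0.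
  rewrite /vb scale_col_mx => /eq_col_mx[vE /esym/eqP].
  rewrite scaler_eq0 (negPf v'0) orbF => /eqP k0.
  by rewrite vE k0 scale0r eqxx in v0.
have fct y : D 0 y -> y = 0.
  move=> Dy; apply: boolp.contrapT => yn0; apply: D0v'.
  apply: (irr' (D 0)).
  - by split=> // k p q dp dq; have := Dl k _ _ _ _ dp dq; rewrite scaler0 addr0.
  - by move=> i p /(DE i); rewrite mulmx0.
  - by move=> i p /(DF i); rewrite mulmx0.
  - by move=> p /cycD[]; rewrite col_mxKd.
  - by exists y; split=> //; apply/eqP.
  - exact: CycGen.
have inj x : D x 0 -> x = 0.
  move=> Dx; apply: boolp.contrapT => xn0; apply: Dv0.
  apply: (irr (D^~ 0)) => //.
  - by split=> // k p q dp dq; have := Dl k _ _ _ _ dp dq; rewrite scaler0 addr0.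
  - by move=> i p /(DE i); rewrite mulmx0.
  - by move=> i p /(DF i); rewrite mulmx0.
  - by exists x; split=> //; apply/eqP.
have fct2 x y y' : D x y -> D x y' -> y = y'.
  move=> d1 d2; apply/eqP; rewrite -subr_eq0; apply/eqP; apply: fct.
  have := Dl (-1) _ _ _ _ d2 d1; rewrite !scaleN1r addNr.
  by rewrite addrC.
have [P HP] : exists P : 'M[C]_(d', d), forall x, D x (P *m x).
  apply: lin_fun_mx => // x.
  apply: (irr (fun x => exists y, D x y)) => //.
  - split; first by exists 0.
    by move=> k p q [p' dp] [q' dq]; exists (k *: p' + q'); apply: Dl.
  - by move=> i p [p' dp]; exists (E' i *m p'); apply: DE.
  - by move=> i p [p' dp]; exists (F' i *m p'); apply: DF.
  - by exists v; split=> //; exists v'; apply: CycGen.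
have mxeq (A B : 'M[C]_(d', d)) : (forall x : 'cV_d, A *m x = B *m x) -> A = B.
  by move=> AB; apply/matrixP => i j; have := AB (delta_mx j 0); rewrite -!colE
    => /matrixP/(_ i 0); rewrite !mxE.
exists P; split.
- by move=> i; apply: mxeq => x; rewrite -!mulmxA; apply: fct2 (HP _) _; apply: DE.
- by move=> i; apply: mxeq => x; rewrite -!mulmxA; apply: fct2 (HP _) _; apply: DF.
- by apply: fct2 (HP _) _; apply: CycGen.
- by move=> x Px0; apply: inj; have := HP x; rewrite Px0.
move=> y; split=> [cy|[x ->]]; last by have [_] := cycD _ (HP x); rewrite col_mxKd.
have PF i : P *m F i = F' i *m P.
  by apply: mxeq => x; rewrite -!mulmxA; apply: fct2 (HP _) _; apply: DF.
elim: cy => {y} [||k x y _ [x' ->] _ [y' ->]|i x _ [x' ->]].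
- by exists v; apply/esym; apply: fct2 (HP _) _; apply: CycGen.
- by exists 0; rewrite mulmx0.
- by exists (k *: x' + y'); rewrite mulmxDr -scalemxAr.
- by exists (F i *m x'); rewrite !mulmxA PF.
Qed.

End ChevalleyModules.

(** * Tensor products of matrices and of modules *)

Section TensorLinear.
Variable R : comPzRingType.

Lemma tensDl m n p q (A A' : 'M[R]_(m, n)) (B : 'M[R]_(p, q)) :
  (A + A') *t B = A *t B + A' *t B.
Proof. by apply/matrixP => i j; rewrite !mxE mulrDl. Qed.
Lemma tensDr m n p q (A : 'M[R]_(m, n)) (B B' : 'M[R]_(p, q)) :
  A *t (B + B') = A *t B + A *t B'.
Proof. by apply/matrixP => i j; rewrite !mxE mulrDr. Qed.
Lemma tensZl m n p q k (A : 'M[R]_(m, n)) (B : 'M[R]_(p, q)) :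
  (k *: A) *t B = k *: (A *t B).
Proof. by apply/matrixP => i j; rewrite !mxE mulrA. Qed.
Lemma tensZr m n p q k (A : 'M[R]_(m, n)) (B : 'M[R]_(p, q)) :
  A *t (k *: B) = k *: (A *t B).
Proof. by apply/matrixP => i j; rewrite !mxE mulrCA. Qed.
Lemma tens11 m n : (1%:M : 'M[R]_m) *t (1%:M : 'M[R]_n) = 1%:M.
Proof.
apply/matrixP => i j; case: (mxtens_indexP i) => i0 i1; case: (mxtens_indexP j) => j0 j1.
rewrite tensmxE !mxE (inj_eq (can_inj (@mxtens_indexK _ _))) xpair_eqE.
by do 2!case: eqP => _; rewrite /= ?mulr1n ?mulr0n ?mulr1 ?mulr0.
Qed.

Definition tensv m n (x : 'cV[R]_m) (y : 'cV[R]_n) : 'cV[R]_(m * n) := x *t y.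

Lemma tensvE m n (x : 'cV[R]_m) (y : 'cV[R]_n) i j :
  tensv x y (mxtens_index (i, j)) 0 = x i 0 * y j 0.
Proof. by rewrite mxE mxtens_indexK; congr (x _ _ * y _ _); apply: ord1. Qed.

Lemma tensv_mul m m' n n' (A : 'M[R]_(m', m)) (B : 'M[R]_(n', n)) x y :
  (A *t B) *m tensv x y = tensv (A *m x) (B *m y).
Proof. exact: (@tensmx_mul R m' m n' n 1 1 A B x y). Qed.

Lemma tensv_span m n (S : 'cV[R]_(m * n) -> Prop) :
  (forall x y, S x -> S y -> S (x + y)) -> S 0 ->
  (forall x y, S (tensv x y)) -> forall z, S z.
Proof.
move=> SD S0 St z.
have -> : z = \sum_(i < m) \sum_(j < n)
    tensv (delta_mx i 0) (z (mxtens_index (i, j)) 0 *: delta_mx j 0).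
  apply/colP => k; case: (mxtens_indexP k) => i j.
  have E i' j' w : tensv (delta_mx i' 0) (w *: delta_mx j' 0) (mxtens_index (i, j)) 0
      = (i == i')%:R * (w * (j == j')%:R).
    by rewrite tensvE !mxE !eqxx !andbT.
  rewrite summxE (bigD1 i) //= [X in _ + X]big1 => [|i' ii']; last first.
    by rewrite summxE big1 // => j' _; rewrite E eq_sym (negPf ii') mul0r.
  rewrite addr0 summxE (bigD1 j) //= [X in _ + X]big1 => [|j' jj']; last first.
    by rewrite E [j == _]eq_sym (negPf jj') !mulr0.
  by rewrite E !eqxx mul1r mulr1 addr0.
do 2!apply: (big_ind S) => // ? _; exact: St.
Qed.

End TensorLinear.

(* Columns and rows of [x] seen as an [m] by [n] matrix. *)
Definition tcol (R : comPzRingType) m n (x : 'cV[R]_(m * n)) (j : 'I_n) : 'cV[R]_m :=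
  \col_i x (mxtens_index (i, j)) 0.
Definition trow (R : comPzRingType) m n (x : 'cV[R]_(m * n)) (i : 'I_m) : 'cV[R]_n :=
  \col_j x (mxtens_index (i, j)) 0.

Lemma tmulE (R : comPzRingType) m n (A : 'M[R]_m) (B : 'M[R]_n) (x : 'cV[R]_(m * n)) i j :
  ((A *t B) *m x) (mxtens_index (i, j)) 0
  = \sum_k \sum_l A i k * B j l * x (mxtens_index (k, l)) 0.
Proof.
rewrite mxE pair_bigA /= (reindex (@mxtens_index m n)) /=; last first.
  by exists (@mxtens_unindex m n) => k _; rewrite ?mxtens_indexK ?mxtens_unindexK.
by apply: eq_bigr => -[k l] _; rewrite tensmxE.
Qed.

Lemma tcol_mull (R : comPzRingType) m n (A : 'M[R]_m) (x : 'cV[R]_(m * n)) j :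
  tcol ((A *t 1%:M) *m x) j = A *m tcol x j.
Proof.
apply/colP => i; rewrite mxE tmulE mxE; apply: eq_bigr => k _.
rewrite (bigD1 j) //= big1 ?addr0 => [|l lj].
  by rewrite !mxE eqxx mulr1.
by rewrite mxE eq_sym (negPf lj) mulr0 mul0r.
Qed.

Lemma trow_mulr (R : comPzRingType) m n (B : 'M[R]_n) (x : 'cV[R]_(m * n)) i :
  trow ((1%:M *t B) *m x) i = B *m trow x i.
Proof.
apply/colP => j; rewrite mxE tmulE mxE (bigD1 i) //= [X in _ + X]big1 ?addr0 => [|l lj].
  by apply: eq_bigr => k _; rewrite !mxE eqxx mul1r.
by rewrite big1 // => k _; rewrite mxE eq_sym (negPf lj) !mul0r.
Qed.

Section OuterTensor.
Variables (C : numClosedFieldType) (r1 r2 : nat).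
Variables (a : 'I_(r1 + r2) -> 'I_(r1 + r2) -> int) (c : 'I_(r1 + r2) -> C).
Variables (c1 : 'I_r1 -> C) (c2 : 'I_r2 -> C).
Let a1 i j := a (lshift r2 i) (lshift r2 j).
Let a2 i j := a (rshift r1 i) (rshift r1 j).
Hypotheses (aii : forall i, a i i = 2).
Hypotheses (a12 : forall i j, a (lshift r2 i) (rshift r1 j) = 0)
           (a21 : forall i j, a (rshift r1 i) (lshift r2 j) = 0).
Hypothesis grading : forall j, \sum_i c i * (a i j)%:~R = 1.
Hypothesis grading1 : forall j, \sum_i c1 i * (a1 i j)%:~R = 1.
Hypothesis grading2 : forall j, \sum_i c2 i * (a2 i j)%:~R = 1.
Variables (d1 d2 : nat) (E1 F1 H1 : 'I_r1 -> 'M[C]_d1) (E2 F2 H2 : 'I_r2 -> 'M[C]_d2).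
Hypotheses (ch1 : chev a1 E1 F1 H1) (ch2 : chev a2 E2 F2 H2).

Definition outer (X1 : 'I_r1 -> 'M[C]_d1) (X2 : 'I_r2 -> 'M[C]_d2) (i : 'I_(r1 + r2)) :=
  match split i with inl j => X1 j *t 1%:M | inr j => 1%:M *t X2 j end.

Lemma outer_l X1 X2 j : outer X1 X2 (lshift r2 j) = X1 j *t 1%:M.
Proof. by rewrite /outer (unsplitK (inl j)). Qed.
Lemma outer_r X1 X2 j : outer X1 X2 (rshift r1 j) = 1%:M *t X2 j.
Proof. by rewrite /outer (unsplitK (inr j)). Qed.


Lemma bracket_tl (X Y : 'M[C]_d1) :
  bracket (X *t (1%:M : 'M_d2)) (Y *t 1%:M) = bracket X Y *t 1%:M.
Proof.
rewrite /bracket !tensmx_mul !mul1mx; apply/matrixP => i j.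
by rewrite !mxE mulrBl.
Qed.
Lemma bracket_tr (X Y : 'M[C]_d2) :
  bracket ((1%:M : 'M_d1) *t X) (1%:M *t Y) = 1%:M *t bracket X Y.
Proof.
rewrite /bracket !tensmx_mul !mul1mx; apply/matrixP => i j.
by rewrite !mxE mulrBr.
Qed.
Lemma bracket_tlr (X : 'M[C]_d1) (Y : 'M[C]_d2) : bracket (X *t 1%:M) (1%:M *t Y) = 0.
Proof. by rewrite /bracket !tensmx_mul !mul1mx !mulmx1 subrr. Qed.
Lemma bracket_trl (X : 'M[C]_d2) (Y : 'M[C]_d1) : bracket (1%:M *t X) (Y *t 1%:M) = 0.
Proof. by rewrite /bracket !tensmx_mul !mul1mx !mulmx1 subrr. Qed.

Lemma outer_chev : chev a (outer E1 E2) (outer F1 F2) (outer H1 H2).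
Proof.
split=> i j; case: (split_ordP i) => i' ->; case: (split_ordP j) => j' ->;
  rewrite ?outer_l ?outer_r ?bracket_tl ?bracket_tr ?bracket_tlr ?bracket_trl
    ?a12 ?a21 ?oppr0 ?scale0r //.
- by rewrite (chEF ch1) (inj_eq (@lshift_inj _ _)); case: eqP; rewrite ?tens0mx ?outer_l.
- by rewrite eq_lrshift.
- by rewrite eq_rlshift.
- by rewrite (chEF ch2) (inj_eq (@rshift_inj _ _)); case: eqP; rewrite ?tensmx0 ?outer_r.
- by rewrite (chHE ch1) tensZl.
- by rewrite (chHE ch2) tensZr.
- by rewrite (chHF ch1) tensZl.
- by rewrite (chHF ch2) tensZr.
- by rewrite (chHH ch1) tens0mx.
- by rewrite (chHH ch2) tensmx0.
Qed.

Variables (m : 'I_(r1 + r2) -> nat) (w : 'cV[C]_d1) (u : 'cV[C]_d2).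
Let m1 i := m (lshift r2 i).
Let m2 i := m (rshift r1 i).
Hypotheses (hw : hwv E1 H1 m1 w) (hu : hwv E2 H2 m2 u).
Hypotheses (irr1 : irrmod E1 F1 (fun=> True)) (irr2 : irrmod E2 F2 (fun=> True)).


Lemma outer_hwv : hwv (outer E1 E2) (outer H1 H2) m (tensv w u).
Proof.
have [w0 Ew Hw] := hw; have [u0 Eu Hu] := hu.
split.
- have [i wi] : exists i, w i 0 != 0.
    by apply/existsP; apply: contraNT w0 => /existsPn H; apply/eqP/colP => i;
      rewrite mxE; apply/eqP; have := H i; rewrite negbK.
  have [j uj] : exists j, u j 0 != 0.
    by apply/existsP; apply: contraNT u0 => /existsPn H; apply/eqP/colP => j;
      rewrite mxE; apply/eqP; have := H j; rewrite negbK.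
  apply/eqP => /colP/(_ (mxtens_index (i, j))); rewrite [RHS]mxE.
  by rewrite tensvE => /eqP; rewrite mulf_eq0 (negPf wi) (negPf uj).
- move=> i; case: (split_ordP i) => i' ->; rewrite ?outer_l ?outer_r tensv_mul.
    by rewrite Ew /tensv tens0mx.
  by rewrite Eu /tensv tensmx0.
- move=> i; case: (split_ordP i) => i' ->; rewrite ?outer_l ?outer_r tensv_mul mul1mx.
    by rewrite Hw /tensv tensZl.
  by rewrite Hu /tensv tensZr.
Qed.

Lemma irr_cyc (r d : nat) (aa : 'I_r -> 'I_r -> int) (E F H : 'I_r -> 'M[C]_d) mm v :
  chev aa E F H -> hwv E H mm v -> irrmod E F (fun=> True) -> forall x, cyc F v x.
Proof.
move=> ch hv irr x; apply: (irr (cyc F v)) => //; first exact: cyc_lin.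
- exact: (cyc_stabE ch hv).
- by move=> i y; apply: CycF.
- by exists v; split; [apply: CycGen | case: hv].
Qed.

(** A highest weight vector of a submodule, seen as a matrix, has columns proportional to [w] and
    rows proportional to [u] by [hwv_unique]. It is thus a multiple of [w (x) u], from which the two
    irreducible actions generate everything. *)
Lemma outer_irr : irrmod (outer E1 E2) (outer F1 F2) (fun=> True).
Proof.
move=> S Sl SE SF _ [x0 [Sx0 x00]] z _.
have cho := outer_chev.
have SH := stab_H aii cho Sl SE SF.
have [mx [x [Sx [x_n0 Ex Hx]]]] := hwv_exists aii grading cho Sl SE SH Sx0 x00.
have aii1 i : a1 i i = 2 by apply: aii.
have aii2 i : a2 i i = 2 by apply: aii.
have key1 y : (forall i, E1 i *m y = 0) ->
    (forall i, H1 i *m y = (mx (lshift r2 i))%:R *: y) -> exists k, y = k *: w.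
  move=> Ey Hy; have [-> | y0] := eqVneq y 0; first by exists 0; rewrite scale0r.
  have hy : hwv E1 H1 (fun i => mx (lshift r2 i)) y by split.
  by apply: (hwv_unique grading1 ch1 _ _ hw hy); apply: irr_cyc; eauto.
have key2 y : (forall i, E2 i *m y = 0) ->
    (forall i, H2 i *m y = (mx (rshift r1 i))%:R *: y) -> exists k, y = k *: u.
  move=> Ey Hy; have [-> | y0] := eqVneq y 0; first by exists 0; rewrite scale0r.
  have hy : hwv E2 H2 (fun i => mx (rshift r1 i)) y by split.
  by apply: (hwv_unique grading2 ch2 _ _ hu hy); apply: irr_cyc; eauto.
have tcolZ k y j : tcol (k *: y) j = k *: tcol (y : 'cV[C]_(d1 * d2)) j.
  by apply/colP => i; rewrite !mxE.
have trowZ k y j : trow (k *: y) j = k *: trow (y : 'cV[C]_(d1 * d2)) j.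
  by apply/colP => i; rewrite !mxE.
have [k Hk] : exists k : 'I_d2 -> C, forall j, tcol x j = k j *: w.
  apply: (fin_all_exists (P := fun j k => tcol x j = k *: w)) => j; apply: key1 => i.
    have := Ex (lshift r2 i); rewrite outer_l => e.
    rewrite -tcol_mull e; by apply/colP => p; rewrite !mxE.
  by have := Hx (lshift r2 i); rewrite outer_l => e; rewrite -tcol_mull e tcolZ.
have [l Hl] : exists l : 'I_d1 -> C, forall i, trow x i = l i *: u.
  apply: (fin_all_exists (P := fun i l => trow x i = l *: u)) => j; apply: key2 => i.
    have := Ex (rshift r1 i); rewrite outer_r => e.
    rewrite -trow_mulr e; by apply/colP => p; rewrite !mxE.
  by have := Hx (rshift r1 i); rewrite outer_r => e; rewrite -trow_mulr e trowZ.
have xE i j : x (mxtens_index (i, j)) 0 = k j * w i 0.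
  by have /colP/(_ i) := Hk j; rewrite !mxE.
have xE' i j : x (mxtens_index (i, j)) 0 = l i * u j 0.
  by have /colP/(_ j) := Hl i; rewrite !mxE.
have [w0 _ _] := hw.
have [i0 wi0] : exists i, w i 0 != 0.
  by apply/existsP; apply: contraNT w0 => /existsPn H; apply/eqP/colP => i;
    rewrite mxE; apply/eqP; have := H i; rewrite negbK.
have [q xq] : exists q, x = q *: tensv w u.
  exists (l i0 / w i0 0); apply/colP => p; case: (mxtens_indexP p) => i j.
  rewrite [RHS]mxE.
  rewrite tensvE.
  have := xE i0 j; rewrite xE' => kE.
  by rewrite xE -[k j](mulfK wi0) -kE; ring.
have q0 : q != 0 by apply: contraNneq x_n0 => q0; rewrite xq q0 scale0r.
have Swu : S (tensv w u) by rewrite -[tensv w u](scalerK q0) -xq; apply: linZ.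
have Sw y : S (tensv w y).
  apply: (irr2 (S0 := fun y => S (tensv w y))) => //.
  - split; first by rewrite /tensv tensmx0; case: Sl.
    by move=> p y1 y2 s1 s2; rewrite /tensv tensDr tensZr; case: Sl => _; apply.
  - by move=> i p /(SE (rshift r1 i)); rewrite outer_r tensv_mul mul1mx.
  - by move=> i p /(SF (rshift r1 i)); rewrite outer_r tensv_mul mul1mx.
  - by exists u; split=> //; case: hu.
apply: tensv_span; [by move=> *; apply: linD | by case: Sl |].
move=> y t; apply: (irr1 (S0 := fun y => S (tensv y t))) => //.
- split; first by rewrite /tensv tens0mx; case: Sl.
  by move=> p y1 y2 s1 s2; rewrite /tensv tensDl tensZl; case: Sl => _; apply.
- by move=> i p /(SE (lshift r2 i)); rewrite outer_l tensv_mul mul1mx.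
- by move=> i p /(SF (lshift r2 i)); rewrite outer_l tensv_mul mul1mx.
- by exists w.
Qed.

End OuterTensor.

(** * Root spaces of E7 *)

Inductive lspan (F : fieldType) (V : lmodType F) (B : V -> Prop) : V -> Prop :=
| Span0 : lspan B 0
| SpanS k x y : B x -> lspan B y -> lspan B (k *: x + y).

Section Span.
Variables (F : fieldType) (V : lmodType F).
Implicit Types B S : V -> Prop.

Lemma lspan_lin B : lin (lspan B).
Proof.
split; first exact: Span0.
move=> k x y sx; elim: sx y => {x} [|l x z Bx _ IH] y sy.
  by rewrite scaler0 add0r.
rewrite scalerDr scalerA -addrA; apply: SpanS => //; exact: IH.
Qed.

Lemma lspan_gen B x : B x -> lspan B x.
Proof.
by move=> Bx; rewrite -[x]addr0 -[x in x + 0]scale1r; apply: SpanS => //; apply: Span0.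
Qed.

Lemma lspan_sub B S : lin S -> (forall x, B x -> S x) -> forall x, lspan B x -> S x.
Proof.
move=> [S0 SD] BS x; elim=> {x} // k x y Bx _ Sy; apply: SD => //; exact: BS.
Qed.

End Span.

Lemma lspan_map (F : fieldType) (V W : lmodType F) (T : V -> W) (B : V -> Prop)
  (S : W -> Prop) : (forall c x y, T (c *: x + y) = c *: T x + T y) -> lin S ->
  (forall x, B x -> S (T x)) -> forall x, lspan B x -> S (T x).
Proof.
move=> Tl [S0 SD] BS; apply: lspan_sub => //.
have T0 : T 0 = 0 by have := Tl (-1) 0 0; rewrite scaler0 addr0 scaleN1r addNr.
by split=> [|c x y]; rewrite ?T0 // Tl; apply: SD.
Qed.

(** The tables are repeated as lists of lists, on which [vm_compute] can run. *)
Definition cartan_table : seq (seq int) :=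
  [:: [::  2 ;  0 ; -1 ;  0 ;  0 ;  0 ;  0 ];
      [::  0 ;  2 ;  0 ; -1 ;  0 ;  0 ;  0 ];
      [:: -1 ;  0 ;  2 ; -1 ;  0 ;  0 ;  0 ];
      [::  0 ; -1 ; -1 ;  2 ; -1 ;  0 ;  0 ];
      [::  0 ;  0 ;  0 ; -1 ;  2 ; -1 ;  0 ];
      [::  0 ;  0 ;  0 ;  0 ; -1 ;  2 ; -1 ];
      [::  0 ;  0 ;  0 ;  0 ;  0 ; -1 ;  2 ]].
Definition beta_table : seq (seq int) :=
  [:: [:: 0 ; 1 ; 1 ; 2 ; 2 ; 2 ; 1 ];
      [:: 1 ; 0 ; 0 ; 0 ; 0 ; 0 ; 0 ];
      [:: 0 ; 0 ; 1 ; 0 ; 0 ; 0 ; 0 ];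
      [:: 0 ; 0 ; 0 ; 1 ; 0 ; 0 ; 0 ];
      [:: 0 ; 1 ; 0 ; 0 ; 0 ; 0 ; 0 ];
      [:: 0 ; 0 ; 0 ; 0 ; 1 ; 0 ; 0 ];
      [:: 0 ; 0 ; 0 ; 0 ; 0 ; 0 ; 1 ]].
Definition ctn (i j : nat) : int := nth 0 (nth [::] cartan_table i) j.

Lemma cartanE i j : cartanE7 i j = ctn i j.
Proof. by rewrite mxE. Qed.

Lemma forall_ord n (P : nat -> bool) : all P (iota 0 n) -> forall i : 'I_n, P i.
Proof. by move=> /allP H i; apply: H; rewrite mem_iota /=. Qed.

Lemma forall_ord2 n (P : nat -> nat -> bool) :
  all (fun i => all (P i) (iota 0 n)) (iota 0 n) -> forall i j : 'I_n, P i j.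
Proof. by move=> H i j; apply: forall_ord; apply: (forall_ord H). Qed.

Lemma cartan_sym i j : cartanE7 i j = cartanE7 j i.
Proof.
rewrite !cartanE; apply/eqP; move: i j.
by apply: (@forall_ord2 7 (fun i j => ctn i j == ctn j i)); vm_compute.
Qed.

Lemma cartan_diag i : cartanE7 i i = 2.
Proof.
rewrite cartanE; apply/eqP; move: i.
by apply: (@forall_ord 7 (fun i => ctn i i == 2)); vm_compute.
Qed.

(** The pairing of [a] with the simple coroots, that is, its coordinates on the fundamental
    weights. *)
Definition cw (a : 'rV[int]_7) (i : 'I_7) : int := \sum_j cartanE7 i j * a 0 j.

Lemma cwD a b i : cw (a + b) i = cw a i + cw b i.
Proof. by rewrite /cw -big_split; apply: eq_bigr => j _; rewrite [(a + b) 0 j]mxE mulrDr. Qed.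
Lemma cwN a i : cw (- a) i = - cw a i.
Proof. by rewrite /cw -sumrN; apply: eq_bigr => j _; rewrite [(- a) 0 j]mxE mulrN. Qed.
Lemma cw_alpha j i : cw (alpha j) i = cartanE7 i j.
Proof.
rewrite /cw (bigD1 j) //= big1 ?addr0 => [|k kj].
  by rewrite [alpha _ _ _]mxE !eqxx mulr1.
by rewrite [alpha _ _ _]mxE (negPf kj) mulr0.
Qed.

(* Twice the inverse of the Cartan matrix. *)
Definition cartan_adj : seq (seq int) :=
  [:: [:: 4; 4; 6; 8; 6; 4; 2]; [:: 4; 7; 8; 12; 9; 6; 3];
      [:: 6; 8; 12; 16; 12; 8; 4]; [:: 8; 12; 16; 24; 18; 12; 6];
      [:: 6; 9; 12; 18; 15; 10; 5]; [:: 4; 6; 8; 12; 10; 8; 4];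
      [:: 2; 3; 4; 6; 5; 4; 3]].
Definition can (i j : nat) : int := nth 0 (nth [::] cartan_adj i) j.
Definition sum7 (f : nat -> int) : int := foldr (fun j s => f j + s) 0 (iota 0 7).

Lemma sum7E (f : nat -> int) : \sum_(j < 7) f j = sum7 f.
Proof. by rewrite -(big_mkord xpredT) unlock. Qed.

Lemma cartan_adjP (i j : 'I_7) :
  \sum_(k < 7) can i k * cartanE7 k j = if i == j then 2 else 0.
Proof.
under eq_bigr do rewrite cartanE.
rewrite (sum7E (fun k => can i k * ctn k j)).
apply/eqP; move: i j.
by apply: (@forall_ord2 7 (fun i j => sum7 (fun k => can i k * ctn k j)
  == if i == j then 2 else 0)); vm_compute.
Qed.

Lemma cw_inj a b : (forall i, cw a i = cw b i) -> a = b.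
Proof.
move=> ab; have two (x : 'rV[int]_7) j : 2 * x 0 j = \sum_(i < 7) can j i * cw x i.
  transitivity (\sum_(i < 7) \sum_k can j i * cartanE7 i k * x 0 k); last first.
    by apply: eq_bigr => i _; rewrite mulr_sumr; apply: eq_bigr => k _; rewrite mulrA.
  rewrite exchange_big /= (bigD1 j) //= -mulr_suml cartan_adjP eqxx.
  rewrite big1 ?addr0 // => k kj; rewrite -mulr_suml cartan_adjP eq_sym (negPf kj).
  exact: mul0r.
apply/rowP => j; apply: (@mulfI int 2) => //.
by rewrite !two; apply: eq_bigr => i _; rewrite ab.
Qed.

Section RootSpaces.
Variables (F : numClosedFieldType) (n : nat).
Implicit Types (Y Z : 'M[F]_n).

Definition wt (H : 'I_7 -> 'M[F]_n) (a : 'rV[int]_7) Y :=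
  forall i, bracket (H i) Y = (cw a i)%:~R *: Y.

Lemma wt_bracket H a b Y Z : wt H a Y -> wt H b Z -> wt H (a + b) (bracket Y Z).
Proof.
move=> wY wZ i; rewrite bracket_jacobi wY wZ bracketZl bracketZr -scalerDl.
by rewrite cwD rmorphD.
Qed.

(** The induction of [eig_split] for simultaneous eigenvectors: at each step some coroot [i]
    separates the first weight from [a]. *)
Lemma wt_sum0 H (s : seq ('rV[int]_7 * 'M[F]_n)) a :
  (forall p, p \in s -> wt H p.1 p.2 /\ p.1 != a) ->
  wt H a (\sum_(p <- s) p.2) -> \sum_(p <- s) p.2 = 0.
Proof.
have [k] := ubnP (size s); elim: k s => // k IH [|p0 s] /= sz Hs.
  by rewrite big_nil.
set Z := \sum_(p <- _) _ => wZ.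
have [w0 n0] := Hs _ (mem_head _ _).
have [i ni] : exists i, cw p0.1 i != cw a i.
  apply/existsP; apply: contraNT n0 => /existsPn H0; apply/eqP/cw_inj => i.
  by apply/eqP; have := H0 i; rewrite negbK.
pose f (p : 'rV[int]_7 * 'M[F]_n) := (cw p.1 i - cw p0.1 i)%:~R *: p.2.
have ZE : (cw a i - cw p0.1 i)%:~R *: Z = \sum_(p <- s) f p.
  rewrite rmorphB scalerBl -wZ /Z big_cons.
  rewrite bracketDr w0 scalerDr opprD addrACA subrr add0r.
  rewrite (big_morph _ (@bracketDr _ _ (H i)) (bracket_0 (H i))) scaler_sumr -sumrB.
  apply: eq_big_seq => p ps; have [wp _] := Hs p (mem_behead (s := p0 :: s) ps).
  by rewrite wp /f rmorphB scalerBl.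
have nz : (cw a i - cw p0.1 i)%:~R != 0 :> F.
  by rewrite intr_eq0 subr_eq0 eq_sym.
apply: (scalerI nz); rewrite scaler0 ZE.
have := IH [seq (p.1, f p) | p <- s] _ _ _; rewrite big_map; apply.
- by rewrite size_map.
- move=> q /mapP[p ps ->] /=; have [wp np] := Hs p (mem_behead (s := p0 :: s) ps).
  by split=> // j; rewrite /f bracketZr wp !scalerA mulrC.
- by move=> j; rewrite -ZE bracketZr wZ !scalerA mulrC.
Qed.

Lemma wt_component H (B : 'rV[int]_7 -> 'M[F]_n -> Prop) a Y :
  (forall b Z, B b Z -> wt H b Z) -> lspan (fun Z => exists b, B b Z) Y ->
  wt H a Y -> lspan (B a) Y.
Proof.
move=> BH sY wY.
have [Y0 [s [sY0 Hs YE]]] : exists Y0 s, [/\ lspan (B a) Y0,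
    forall p, p \in s -> wt H p.1 p.2 /\ p.1 != a & Y = Y0 + \sum_(p <- s) p.2].
  elim: sY {wY} => {Y} [|k x y [b Bx] _ [Y0 [s [sY0 Hs ->]]]].
    by exists 0, [::]; split; rewrite ?big_nil ?addr0 //; apply: Span0.
  have [ba | nba] := eqVneq b a.
    exists (k *: x + Y0), s; split=> //; last by rewrite addrA.
    by apply: SpanS => //; rewrite -ba.
  exists Y0, ((b, k *: x) :: s); split=> //.
    move=> p; rewrite inE => /predU1P[-> /=|/Hs //]; split=> // i.
    by rewrite bracketZr (BH _ _ Bx) !scalerA mulrC.
  by rewrite big_cons addrCA.
suff Z0 : \sum_(p <- s) p.2 = 0 by rewrite YE Z0 addr0.
apply: (wt_sum0 (a := a) Hs) => i.
have -> : \sum_(p <- s) p.2 = Y - Y0 by rewrite YE addrC addKr.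
have w0 : bracket (H i) Y0 = (cw a i)%:~R *: Y0.
  apply: (lspan_sub (S := fun Z => bracket (H i) Z = (cw a i)%:~R *: Z)) sY0.
    split; first by rewrite bracket_0 scaler0.
    move=> k x y hx hy; rewrite bracketDr bracketZr hx hy scalerDr !scalerA.
    by rewrite mulrC.
  by move=> x Bx; apply: BH.
by rewrite bracketDr -scaleN1r bracketZr w0 wY scalerDr !scalerA mulrC.
Qed.

Inductive pos (E : 'I_7 -> 'M[F]_n) : 'rV[int]_7 -> 'M[F]_n -> Prop :=
| PosGen i : pos E (alpha i) (E i)
| PosBr i a Y : pos E a Y -> pos E (alpha i + a) (bracket (E i) Y).

Definition height (a : 'rV[int]_7) : int := \sum_j a 0 j.

Lemma heightD a b : height (a + b) = height a + height b.
Proof. by rewrite /height -big_split; apply: eq_bigr => j _; rewrite mxE. Qed.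

Lemma height_alpha i : height (alpha i) = 1.
Proof.
rewrite /height (bigD1 i) //= big1 ?addr0 => [|k ki].
  by rewrite mxE !eqxx.
by rewrite mxE (negPf ki).
Qed.

Lemma pos_ge0 E a Y : pos E a Y -> (forall j, 0 <= a 0 j) /\ 1 <= height a.
Proof.
have al i j : 0 <= alpha i 0 j by rewrite mxE; case: (_ && _).
elim=> {a Y} [i|i a Y _ [a0 ha]]; first by rewrite height_alpha.
split; last by rewrite heightD height_alpha; lia.
by move=> j; rewrite mxE addr_ge0.
Qed.

Lemma pos_simple E i Y : pos E (alpha i) Y -> Y = E i.
Proof.
move=> p; have : height (alpha i) = 1 by apply: height_alpha.
move: p; move a_eq: (alpha i) => a p.
case: p a_eq => {a Y} [j|j a Y pa] ij ha.
  congr (E _); apply/eqP; apply: contraT => ji.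
  move/rowP/(_ j): ij; rewrite !mxE !eqxx /= eq_sym.
  by rewrite eq_sym in ji; rewrite (negPf ji).
by have [_] := pos_ge0 pa; move: ha; rewrite heightD height_alpha; lia.
Qed.

Section Triangular.
Variables (E G H : 'I_7 -> 'M[F]_n).
Hypothesis ch : chev (fun i j => cartanE7 i j) E G H.

Lemma pos_wt a Y : pos E a Y -> wt H a Y.
Proof.
elim=> {a Y} [j|j a Y _ IH] => [i|].
  by rewrite (chHE ch) cw_alpha.
by apply: wt_bracket => // i; rewrite (chHE ch) cw_alpha.
Qed.

Definition isH Y := exists i, Y = H i.
Definition posH Y := (exists a, pos E a Y) \/ isH Y.

Lemma posH_adE i Y : lspan posH Y -> lspan posH (bracket (E i) Y).
Proof.
apply: (lspan_map (T := bracket (E i))); [exact: bracket_lin | exact: lspan_lin |].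
move=> {}Y [[a p]|[j ->]].
  by apply: lspan_gen; left; eexists; apply: PosBr p.
rewrite bracketC (chHE ch) -scaleNr; apply: linZ; first exact: lspan_lin.
by apply: lspan_gen; left; eexists; apply: PosGen.
Qed.

Lemma pos_adG i a Y : pos E a Y -> lspan posH (bracket (G i) Y).
Proof.
elim=> {a Y} [j|j a Y p IH].
  rewrite bracketC (chEF ch) -scaleN1r; apply: linZ; first exact: lspan_lin.
  case: eqP => _; last exact: Span0.
  by apply: lspan_gen; right; eexists.
rewrite bracket_jacobi; apply: linD; [exact: lspan_lin | | exact: posH_adE].
rewrite bracketC -scaleN1r; apply: linZ; first exact: lspan_lin.
rewrite [bracket (G i) _]bracketC (chEF ch) -scaleN1r bracketZr.
apply: linZ; first exact: lspan_lin.
case: eqP => _; last by rewrite bracket_0; apply: Span0.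
rewrite bracketC (pos_wt p) -scaleN1r; do 2!(apply: linZ; first exact: lspan_lin).
by apply: lspan_gen; left; exists a.
Qed.

End Triangular.

(** The Chevalley involution, which transfers results on positive roots to negative ones. *)
Lemma chev_op (E G H : 'I_7 -> 'M[F]_n) : chev (fun i j => cartanE7 i j) E G H ->
  chev (fun i j => cartanE7 i j) G E (fun i => - H i).
Proof.
have bN Y Z : bracket (- Y) Z = - bracket Y Z by rewrite -scaleN1r bracketZl scaleN1r.
move=> ch; split=> i j; rewrite ?bN.
- by rewrite bracketC (chEF ch) eq_sym; case: eqP => [-> //|_]; rewrite oppr0.
- by rewrite (chHF ch) scaleNr opprK.
- by rewrite (chHE ch) scaleNr.
- by rewrite bracketC bN (chHH ch) !oppr0.
Qed.

Definition basic (E G H : 'I_7 -> 'M[F]_n) (a : 'rV[int]_7) (Y : 'M[F]_n) :=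
  [\/ pos E a Y, pos G (- a) Y | a = 0 /\ isH H Y].

Section Generated.
Variables (E G H : 'I_7 -> 'M[F]_n).
Hypothesis ch : chev (fun i j => cartanE7 i j) E G H.

Lemma basic_wt a Y : basic E G H a Y -> wt H a Y.
Proof.
move=> [p|p|[-> [j ->]]]; first exact: (pos_wt ch p).
  move=> i; have := pos_wt (chev_op ch) p i; rewrite cwN -[- H i]scaleN1r bracketZl.
  by rewrite scaleN1r rmorphN scaleNr => /oppr_inj.
move=> i; rewrite (chHH ch) /cw big1 ?scale0r // => k _.
by rewrite [X in _ * X]mxE mulr0.
Qed.

Definition tri Y := lspan (fun Z => exists a, basic E G H a Z) Y.

Lemma tri_lin : lin tri. Proof. exact: lspan_lin. Qed.

Lemma tri_adE i Y : tri Y -> tri (bracket (E i) Y).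
Proof.
apply: (lspan_map (T := bracket (E i))); [exact: bracket_lin | exact: lspan_lin |].
move=> {}Y [a [p|p|[_ [j ->]]]].
- by apply: lspan_gen; eexists; apply: Or31; apply: PosBr p.
- have := pos_adG (chev_op ch) i p; apply: lspan_sub; first exact: lspan_lin.
  move=> Z [[b q]|[j ->]].
    by apply: lspan_gen; exists (- b); apply: Or32; rewrite opprK.
  rewrite -scaleN1r; apply: linZ; first exact: lspan_lin.
  by apply: lspan_gen; exists 0; apply: Or33; split=> //; exists j.
rewrite bracketC (chHE ch) -scaleNr; apply: linZ; first exact: lspan_lin.
by apply: lspan_gen; eexists; apply: Or31; apply: PosGen.
Qed.

Lemma tri_adG i Y : tri Y -> tri (bracket (G i) Y).
Proof.
apply: (lspan_map (T := bracket (G i))); [exact: bracket_lin | exact: lspan_lin |].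
move=> {}Y [a [p|p|[_ [j ->]]]].
- have := pos_adG ch i p; apply: lspan_sub; first exact: lspan_lin.
  move=> Z [[b q]|[j ->]].
    by apply: lspan_gen; exists b; apply: Or31.
  by apply: lspan_gen; exists 0; apply: Or33; split=> //; exists j.
- apply: lspan_gen; exists (- (alpha i - a)); apply: Or32.
  by rewrite opprK; apply: PosBr p.
rewrite bracketC (chHF ch) -scaleNr; apply: linZ; first exact: lspan_lin.
by apply: lspan_gen; exists (- alpha i); apply: Or32; rewrite opprK; apply: PosGen.
Qed.

(** The triangular decomposition: the span of both kinds of iterated brackets and of the [H i] is
    stable under the generators, hence by the Jacobi identity under the Lie algebra they
    generate. *)
Lemma generated_tri Y :
  lie_generated (fun Z => exists i, Z = E i \/ Z = G i) Y -> tri Y.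
Proof.
move=> LY; have tl := tri_lin.
have norm Z : lie_generated (fun Z => exists i, Z = E i \/ Z = G i) Z ->
    forall T, tri T -> tri (bracket Z T).
  elim=> {Z} [Z [i [-> | ->]]|Z1 Z2 _ h1 _ h2|c Z _ h|Z1 Z2 _ h1 _ h2] T tT.
  - exact: tri_adE.
  - exact: tri_adG.
  - by rewrite bracketDl; apply: linD => //; [apply: h1 | apply: h2].
  - by rewrite bracketZl; apply: linZ => //; apply: h.
  - have := bracket_jacobi Z1 Z2 T => /eqP; rewrite -subr_eq => /eqP <-.
    by apply: linB => //; [apply/h1/h2 | apply/h2/h1].
elim: LY => {Y} [Y [i [-> | ->]]|Y1 Y2 _ h1 _ h2|c Y _ h|Y1 Y2 l1 h1 _ h2].
- by apply: lspan_gen; exists (alpha i); apply: Or31; apply: PosGen.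
- by apply: lspan_gen; exists (- alpha i); apply: Or32; rewrite opprK; apply: PosGen.
- exact: linD.
- exact: linZ.
- exact: norm.
Qed.

(** A root subgroup is defined through the whole root space, which therefore has to be shown to be a
    line. Among the spanning brackets only [E i] has the weight [alpha i], for reasons of height. *)
Lemma simple_root_space i Y :
  lie_generated (fun Z => exists i, Z = E i \/ Z = G i) Y -> wt H (alpha i) Y ->
  exists k, Y = k *: E i.
Proof.
move=> LY wY; have := wt_component basic_wt (generated_tri LY) wY.
apply: (lspan_sub (S := fun Y => exists k, Y = k *: E i)).
  split; first by exists 0; rewrite scale0r.
  move=> k x y [k1 ->] [k2 ->]; exists (k * k1 + k2).
  by rewrite scalerDl scalerA.
move=> Z [/pos_simple ->|p|[a0 _]]; first by exists 1; rewrite scale1r.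
  have [_] := pos_ge0 p; have := height_alpha i.
  have := heightD (alpha i) (- alpha i); rewrite subrr /height big1; first by lia.
  by move=> j _; rewrite mxE.
have := height_alpha i; rewrite a0 /height big1 // => j _.
by rewrite mxE.
Qed.

Lemma mixed_root_space (a : 'rV[int]_7) Y j k : 0 < a 0 j -> a 0 k < 0 ->
  lie_generated (fun Z => exists i, Z = E i \/ Z = G i) Y -> wt H a Y -> Y = 0.
Proof.
move=> aj ak LY wY; have := wt_component basic_wt (generated_tri LY) wY.
apply: (lspan_sub (S := fun Y => Y = 0)); first exact: lin_zero.
move=> Z [p|p|[a0 _]].
- by have [/(_ k)] := pos_ge0 p; rewrite leNgt ak.
- by have [/(_ j)] := pos_ge0 p; rewrite mxE oppr_ge0 leNgt aj.
- by move: aj; rewrite a0 mxE.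
Qed.

End Generated.

End RootSpaces.

(** * Simple reflections on the root lattice *)

Definition refl (i : 'I_7) (a : 'rV[int]_7) : 'rV[int]_7 :=
  \row_j (a 0 j - (j == i)%:R * cw a i).

Lemma cw_refl i a j : cw (refl i a) j = cw a j - cartanE7 j i * cw a i.
Proof.
rewrite /cw; under eq_bigr do rewrite [refl i a _ _]mxE mulrBr.
rewrite sumrB; congr (_ - _); rewrite (bigD1 i) //= eqxx mul1r big1 ?addr0 //.
by move=> k /negPf ->; rewrite mul0r mulr0.
Qed.

Lemma reflK i a : refl i (refl i a) = a.
Proof.
apply/rowP => j; rewrite [LHS]mxE cw_refl cartan_diag mxE.
by case: eqP => _; rewrite /=; ring.
Qed.

Definition rowS (s : seq int) : 'rV[int]_7 := \row_j nth 0 s j.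
Definition cwS (s : seq int) (i : nat) : int := sum7 (fun j => ctn i j * nth 0 s j).
Definition reflS (i : nat) (s : seq int) : seq int :=
  mkseq (fun j => nth 0 s j - (j == i)%:R * cwS s i) 7.
Definition chainS (s : seq int) (w : seq nat) := foldr reflS s w.

Lemma cw_rowS s i : cw (rowS s) i = cwS s i.
Proof.
rewrite /cwS -sum7E; apply: eq_bigr => j _.
by rewrite cartanE [rowS s _ _]mxE.
Qed.

Lemma refl_rowS i s : refl i (rowS s) = rowS (reflS i s).
Proof.
by apply/rowP => j; rewrite !mxE nth_mkseq // cw_rowS.
Qed.

Lemma rowSP (s t : seq int) :
  all (fun j => nth 0 s j == nth 0 t j) (iota 0 7) -> rowS s = rowS t.
Proof.
by move=> /forall_ord H; apply/rowP => j; rewrite !mxE; apply/eqP; apply: H.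
Qed.

Lemma rowSN s : - rowS s = rowS (map -%R s).
Proof.
apply/rowP => j; rewrite !mxE; case: (ltnP j (size s)) => js.
  by rewrite (nth_map 0).
by rewrite !nth_default ?size_map // oppr0.
Qed.

Definition betaS (i : nat) : seq int := nth [::] beta_table i.
Definition alphaS (i : nat) : seq int := mkseq (fun j => (j == i)%:R) 7.

Lemma betaE i : beta i = rowS (betaS i).
Proof. by apply/rowP => j; rewrite !mxE. Qed.

Lemma alphaE i : alpha i = rowS (alphaS i).
Proof. by apply/rowP => j; rewrite !mxE nth_mkseq. Qed.

(** For [i != 0], the index of the simple root equal to [beta i]; the entry at 0 is a filler, as
    [beta_1] is not simple. *)
Definition bidx (i : nat) : nat := nth 0%N [:: 0; 0; 2; 3; 1; 4; 6]%N i.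

Lemma bidx_lt (i : 'I_7) : (bidx i < 7)%N.
Proof. by move: i; apply: (@forall_ord 7 (fun i => (bidx i < 7)%N)). Qed.

Definition bord (i : 'I_7) : 'I_7 := Ordinal (bidx_lt i).

Lemma beta_alpha i : i != 0 -> beta i = alpha (bord i).
Proof.
move=> i0; rewrite betaE alphaE; apply: rowSP => /=.
have := @forall_ord 7 (fun i => (i != 0%N) ==> all (fun j =>
  nth 0 (betaS i) j == nth 0 (alphaS (bidx i)) j) (iota 0 7)).
by move=> /(_ isT i) /implyP/(_ i0).
Qed.

(** With Bourbaki labels, [s6 s5 s4 s2 s3 s4 s5 s6] sends [alpha_7] to [beta_1], one simple root
    being added at each step. *)
Definition beta_word : seq nat := [:: 5; 4; 3; 1; 2; 3; 4; 5]%N.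

Lemma beta0_chain : beta 0 = rowS (chainS (alphaS 6) beta_word).
Proof. by rewrite betaE; apply: rowSP; vm_compute. Qed.

Lemma nbeta0_chain : - beta 0 = rowS (chainS (map -%R (alphaS 6)) beta_word).
Proof. by rewrite betaE rowSN; apply: rowSP; vm_compute. Qed.

Definition mixedS (s : seq int) : bool :=
  has (fun j => 0 < nth 0 s j) (iota 0 7) && has (fun j => nth 0 s j < 0) (iota 0 7).

(* A chain of simple reflections that moves [beta_1 - beta_(j+1)] to a vector
   with coordinates of both signs, which shows that it is not a root. *)
Definition diff_word (j : nat) : seq nat := nth [::]
  [:: [::]; [::]; [:: 6; 5; 4; 3]; [:: 6; 5; 4]; [:: 6; 5; 4; 3]; [:: 6; 5];
      [:: 1; 3; 4; 5]]%N j.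
Definition diffS (i j : nat) : seq int :=
  mkseq (fun k => nth 0 (betaS i) k - nth 0 (betaS j) k) 7.

Lemma diff_mixed (j : 'I_7) : j != 0 ->
  mixedS (chainS (diffS 0 j) (diff_word j)) && mixedS (chainS (diffS j 0) (diff_word j))
  && all (fun i => (i < 7)%N) (diff_word j).
Proof.
move=> j0; have := @forall_ord 7 (fun j => (j != 0%N) ==>
  mixedS (chainS (diffS 0 j) (diff_word j)) && mixedS (chainS (diffS j 0) (diff_word j))
  && all (fun i => (i < 7)%N) (diff_word j)).
move=> H; apply: (implyP (H _ j) j0).
by vm_compute.
Qed.

Lemma diffSE (i j : 'I_7) : beta i - beta j = rowS (diffS i j).
Proof. by rewrite !betaE; apply/rowP => k; rewrite !mxE nth_mkseq. Qed.

(** The Cartan matrix of [H]: roots and coroots have the same coordinates, E7 being simply laced. *)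
Definition cartanB (i j : 'I_7) : int := \sum_k beta i 0 k * cw (beta j) k.
Definition cbn (i j : nat) : int := sum7 (fun k => nth 0 (betaS i) k * cwS (betaS j) k).

Lemma cartanBE i j : cartanB i j = cbn i j.
Proof.
rewrite /cbn -sum7E /cartanB; apply: eq_bigr => k _.
by rewrite !betaE cw_rowS [rowS _ _ _]mxE.
Qed.

(** * Chevalley generators of the subsystem of H *)

Section BetaSystem.
Variables (F : numClosedFieldType) (n : nat) (X : E7_realization F n).
Let E := re X.
Let G := rf X.
Let H := rh X.
Implicit Types (Y Z : 'M[F]_n).

Lemma chev_E7 : chev (fun i j => cartanE7 i j) E G H.
Proof.
by split=> i j; [exact: re_ef | exact: re_he | exact: re_hf | exact: re_hh].
Qed.
Let ch := chev_E7.

Lemma E7_sl2 i : sl2 (E i) (G i) (H i).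
Proof. by apply: (chev_sl2 _ ch) => j; apply: cartan_diag. Qed.

Definition nW (i : 'I_7) : 'M[F]_n := locked (theta (E i) (G i) 1).

Lemma nWE i : nW i = theta (E i) (G i) 1.
Proof. by rewrite /nW -lock. Qed.

Lemma nW_unit i : nW i \in unitmx.
Proof. rewrite nWE; exact: (theta_unit (E7_sl2 i) 1). Qed.

Lemma nW_H i j : nW i *m H j = (H j - (cartanE7 j i)%:~R *: H i) *m nW i.
Proof.
rewrite nWE; apply: (theta_cartan (E7_sl2 i)); first exact: oner_neq0.
  exact: (chHE ch).
exact: (chHF ch).
Qed.

Lemma H_nW i j : H j *m nW i = nW i *m (H j - (cartanE7 j i)%:~R *: H i).
Proof.
rewrite mulmxBr -scalemxAr !nW_H cartan_diag scalemxAl -mulmxBl; congr (_ *m _).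
by apply/matrixP => p q; rewrite !mxE; ring.
Qed.

Lemma nWV_H i j :
  invmx (nW i) *m H j = (H j - (cartanE7 j i)%:~R *: H i) *m invmx (nW i).
Proof.
have u := nW_unit i.
by rewrite -[LHS](mulmxK u) -[_ *m H j *m _]mulmxA H_nW mulKmx.
Qed.

Lemma H_nWV i j :
  H j *m invmx (nW i) = invmx (nW i) *m (H j - (cartanE7 j i)%:~R *: H i).
Proof.
have u := nW_unit i.
by rewrite -[LHS](mulKmx u) [nW i *m _]mulmxA nW_H mulmxK.
Qed.

Lemma wt_H_comb a Y i j : wt H a Y ->
  bracket (H j - (cartanE7 j i)%:~R *: H i) Y = (cw (refl i a) j)%:~R *: Y.
Proof.
move=> wY; rewrite bracketDl -scaleNr bracketZl !wY scalerA -scalerDl cw_refl.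
by rewrite rmorphB rmorphM /= mulNr.
Qed.

Lemma wt_refl i a Y : wt H a Y -> wt H (refl i a) (nW i *m Y *m invmx (nW i)).
Proof.
move=> wY j; have u := nW_unit i.
have -> : bracket (H j) (nW i *m Y *m invmx (nW i))
  = nW i *m bracket (H j - (cartanE7 j i)%:~R *: H i) Y *m invmx (nW i).
  rewrite /bracket [in RHS]mulmxBr mulmxBl; congr (_ - _).
    by rewrite !mulmxA H_nW.
  by rewrite -!mulmxA nWV_H.
by rewrite (wt_H_comb _ _ wY) -scalemxAr -scalemxAl.
Qed.

Lemma wt_reflV i a Y : wt H a Y -> wt H (refl i a) (invmx (nW i) *m Y *m nW i).
Proof.
move=> wY j; have u := nW_unit i.
have -> : bracket (H j) (invmx (nW i) *m Y *m nW i)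
  = invmx (nW i) *m bracket (H j - (cartanE7 j i)%:~R *: H i) Y *m nW i.
  rewrite /bracket [in RHS]mulmxBr mulmxBl; congr (_ - _).
    by rewrite !mulmxA H_nWV.
  by rewrite -!mulmxA nW_H.
by rewrite (wt_H_comb _ _ wY) -scalemxAr -scalemxAl.
Qed.

Lemma lie_lin : lin (lieE7 X).
Proof.
have gen : lieE7 X (E 0) by apply: LieIn; exists 0; left.
split; first by rewrite -(scale0r (E 0)); apply: LieScale.
by move=> k Y Z lY lZ; apply: LieAdd => //; apply: LieScale.
Qed.

Lemma lie_exp Y Z : lieE7 X Z -> nilmx Z -> lieE7 X Y ->
  lieE7 X (exp_nilp Z *m Y *m exp_nilp (- Z)).
Proof.
move=> lZ nZ lY; have [N HN] := adk_nilmx Y nZ.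
rewrite (exp_ad nZ HN) -mulmxA mulmxE expNr // mulr1.
apply: lin_sum => [|j _]; first exact: lie_lin.
apply: LieScale; rewrite /adk; elim: (nat_of_ord j) => //= k IH.
exact: LieBracket.
Qed.

Lemma lieE i : lieE7 X (E i). Proof. by apply: LieIn; exists i; left. Qed.
Lemma lieG i : lieE7 X (G i). Proof. by apply: LieIn; exists i; right. Qed.

Lemma lie_nW i Y : lieE7 X Y -> lieE7 X (nW i *m Y *m invmx (nW i)).
Proof.
move=> lY; have ne := sl2_nilmx_e (E7_sl2 i); have ng := sl2_nilmx_f (E7_sl2 i).
have n1 := nilmxZ 1 ne; have n2 := nilmxZ (- 1^-1) ng.
have u1 := exp_unit n1; have u2 := exp_unit n2.
rewrite nWE /theta !invmx_mul ?unitmx_mul ?u1 // !exp_inv //.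
have l1 : lieE7 X (1 *: E i) by apply: LieScale; apply: lieE.
have l2 : lieE7 X (- 1^-1 *: G i) by apply: LieScale; apply: lieG.
have := lie_exp l1 n1 (lie_exp l2 n2 (lie_exp l1 n1 lY)).
by rewrite !mulmxA.
Qed.

Lemma lie_nWV i Y : lieE7 X Y -> lieE7 X (invmx (nW i) *m Y *m nW i).
Proof.
move=> lY; have ne := sl2_nilmx_e (E7_sl2 i); have ng := sl2_nilmx_f (E7_sl2 i).
have n1 := nilmxZ 1 ne; have n2 := nilmxZ (- 1^-1) ng.
have u1 := exp_unit n1; have u2 := exp_unit n2.
rewrite nWE /theta !invmx_mul ?unitmx_mul ?u1 // !exp_inv //.
have l1 : lieE7 X (- (1 *: E i)).
  by rewrite -scaleN1r; do 2!apply: LieScale; apply: lieE.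
have l2 : lieE7 X (- (- 1^-1 *: G i)).
  by rewrite -scaleN1r; do 2!apply: LieScale; apply: lieG.
have := lie_exp l1 (nilmxN n1) (lie_exp l2 (nilmxN n2) (lie_exp l1 (nilmxN n1) lY)).
by rewrite !opprK !mulmxA.
Qed.

Definition rsp a Y := lieE7 X Y /\ wt H a Y.

Definition word_mx (w : seq nat) : 'M[F]_n :=
  locked (foldr (fun i A => nW (inord i) *m A) 1%:M w).

Lemma word_nil : word_mx [::] = 1%:M.
Proof. by rewrite /word_mx -lock. Qed.

Lemma word_cons i w : word_mx (i :: w) = nW (inord i) *m word_mx w.
Proof. by rewrite /word_mx -!lock. Qed.

Lemma word_unit w : word_mx w \in unitmx.
Proof.
by elim: w => [|i w IH]; rewrite ?word_nil ?unitmx1 // word_cons unitmx_mul nW_unit.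
Qed.

Lemma rsp_chain w s Y : all (fun i => (i < 7)%N) w -> rsp (rowS s) Y ->
  rsp (rowS (chainS s w)) (word_mx w *m Y *m invmx (word_mx w)).
Proof.
elim: w => [|i w IH] /=; first by rewrite word_nil invmx1 mul1mx mulmx1.
rewrite word_cons => /andP[i7 w7] /(IH w7)[lY wY].
rewrite invmx_mul ?nW_unit ?word_unit //.
have -> : nW (inord i) *m word_mx w *m Y *m (invmx (word_mx w) *m invmx (nW (inord i)))
  = nW (inord i) *m (word_mx w *m Y *m invmx (word_mx w)) *m invmx (nW (inord i)).
  by rewrite !mulmxA.
split; first exact: lie_nW.
have -> : rowS (reflS i (chainS s w)) = refl (inord i) (rowS (chainS s w)).
  by rewrite refl_rowS inordK.
exact: wt_refl.
Qed.

Lemma rsp_chainV w s Y : all (fun i => (i < 7)%N) w -> rsp (rowS (chainS s w)) Y ->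
  rsp (rowS s) (invmx (word_mx w) *m Y *m word_mx w).
Proof.
elim: w Y => [|i w IH] Y /=; first by rewrite word_nil invmx1 mul1mx mulmx1.
rewrite word_cons => /andP[i7 w7] [lY wY].
rewrite invmx_mul ?nW_unit ?word_unit //.
have -> : invmx (word_mx w) *m invmx (nW (inord i)) *m Y *m (nW (inord i) *m word_mx w)
  = invmx (word_mx w) *m (invmx (nW (inord i)) *m Y *m nW (inord i)) *m word_mx w.
  by rewrite !mulmxA.
apply: IH => //; split; first exact: lie_nWV.
rewrite -(reflK (inord i) (rowS (chainS s w))).
have -> : refl (inord i) (rowS (chainS s w)) = rowS (reflS i (chainS s w)).
  by rewrite refl_rowS inordK.
exact: wt_reflV.
Qed.

(** Conjugation by the representative of [w] carries [Y] to a weight with coordinates of both signs,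
    which is not a root. *)
Lemma rsp_mixed s w Y : all (fun i => (i < 7)%N) w -> mixedS (chainS s w) ->
  rsp (rowS s) Y -> Y = 0.
Proof.
move=> w7 /andP[/hasP[j j7 sj] /hasP[k k7 sk]] /(rsp_chain w7)[lY wY].
have u := word_unit w; rewrite mem_iota in j7; rewrite mem_iota in k7.
apply: (can_inj (mulKmx u)); apply: (can_inj (mulmxK (m := n) (etrans (unitmx_inv _) u))).
rewrite mulmx0 mul0mx.
apply: (mixed_root_space ch (j := Ordinal j7) (k := Ordinal k7)) lY wY;
  by rewrite mxE.
Qed.

Lemma rsp_alpha i Y : rsp (alpha i) Y -> exists k, Y = k *: E i.
Proof. by case=> lY wY; apply: (simple_root_space ch) lY wY. Qed.

Lemma rsp_nalpha i Y : rsp (- alpha i) Y -> exists k, Y = k *: G i.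
Proof.
case=> lY wY; apply: (simple_root_space (chev_op ch) (i := i)).
  elim: lY => {Y wY} [Y [j [-> | ->]]||c Y _ h|Y1 Y2 _ h1 _ h2].
  - by apply: LieIn; exists j; right.
  - by apply: LieIn; exists j; left.
  - by move=> Y1 Y2 _ h1 _ h2; apply: LieAdd.
  - exact: LieScale.
  - exact: LieBracket.
move=> j; rewrite -scaleN1r bracketZl wY cwN rmorphN scalerA.
by rewrite mulN1r opprK.
Qed.

Lemma rsp_E i : rsp (alpha i) (E i).
Proof. by split; [exact: lieE | move=> j; rewrite (chHE ch) cw_alpha]. Qed.

Lemma rsp_G i : rsp (- alpha i) (G i).
Proof.
by split; [exact: lieG | move=> j; rewrite (chHF ch) cwN cw_alpha rmorphN].
Qed.

(** The vector for [beta_1] is transported from [alpha_7]. [Gb] uses the same conjugation, so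
    [[Eb, Gb]] is the coroot without any choice of scalars. *)
Definition Eb (i : 'I_7) : 'M[F]_n :=
  if i == 0 then word_mx beta_word *m E (inord 6) *m invmx (word_mx beta_word) else E (bord i).
Definition Gb (i : 'I_7) : 'M[F]_n :=
  if i == 0 then word_mx beta_word *m G (inord 6) *m invmx (word_mx beta_word) else G (bord i).
Definition hS (a : 'rV[int]_7) : 'M[F]_n := \sum_k (a 0 k)%:~R *: H k.
Definition Hb (i : 'I_7) : 'M[F]_n := hS (beta i).

Lemma alpha6 : alpha (inord 6) = rowS (alphaS 6).
Proof. by rewrite alphaE inordK. Qed.

Lemma rsp_Eb i : rsp (beta i) (Eb i).
Proof.
rewrite /Eb; case: eqP => [-> | /eqP i0]; last by rewrite beta_alpha //; apply: rsp_E.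
by rewrite beta0_chain; apply: rsp_chain => //; rewrite -alpha6; apply: rsp_E.
Qed.

Lemma rsp_Gb i : rsp (- beta i) (Gb i).
Proof.
rewrite /Gb; case: eqP => [-> | /eqP i0]; last by rewrite beta_alpha //; apply: rsp_G.
rewrite nbeta0_chain; apply: rsp_chain => //; rewrite -rowSN -alpha6; exact: rsp_G.
Qed.

Lemma rsp_beta i Y : rsp (beta i) Y -> exists k, Y = k *: Eb i.
Proof.
rewrite /Eb; case: eqP => [-> | /eqP i0]; last by rewrite beta_alpha //; apply: rsp_alpha.
rewrite beta0_chain => /rsp_chainV; rewrite -alpha6 => /(_ isT)/rsp_alpha[k kE].
exists k; rewrite scalemxAl scalemxAr -kE.
by rewrite !mulmxA mulmxV ?word_unit // mul1mx mulmxK ?word_unit.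
Qed.

Lemma rsp_nbeta i Y : rsp (- beta i) Y -> exists k, Y = k *: Gb i.
Proof.
rewrite /Gb; case: eqP => [-> | /eqP i0]; last by rewrite beta_alpha //; apply: rsp_nalpha.
rewrite nbeta0_chain => /rsp_chainV; rewrite -rowSN -alpha6 => /(_ isT)/rsp_nalpha[k kE].
exists k; rewrite scalemxAl scalemxAr -kE.
by rewrite !mulmxA mulmxV ?word_unit // mul1mx mulmxK ?word_unit.
Qed.

Lemma hS_wt a b Y : wt H b Y -> bracket (hS a) Y = (\sum_k a 0 k * cw b k)%:~R *: Y.
Proof.
move=> wY; rewrite bracketC bracket_sum -sumrN rmorph_sum scaler_suml.
apply: eq_bigr => k _.
by rewrite bracketZr -scalerN -bracketC wY scalerA rmorphM.
Qed.

Lemma hS_chain w s : all (fun i => (i < 7)%N) w ->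
  word_mx w *m hS (rowS s) *m invmx (word_mx w) = hS (rowS (chainS s w)).
Proof.
have step i a : nW i *m hS a *m invmx (nW i) = hS (refl i a).
  apply: (can_inj (mulmxK (nW_unit i))); rewrite mulmxKV ?nW_unit //.
  rewrite mulmx_sumr mulmx_suml.
  transitivity (\sum_k ((a 0 k)%:~R *: H k - (a 0 k * cartanE7 k i)%:~R *: H i) *m nW i).
    apply: eq_bigr => k _; rewrite -scalemxAr nW_H scalemxAl scalerBr scalerA.
    by rewrite rmorphM.
  rewrite -mulmx_suml sumrB -scaler_suml -rmorph_sum -[in RHS]mulmx_suml.
  congr (_ *m _).
  have -> : \sum_k a 0 k * cartanE7 k i = cw a i.
    by apply: eq_bigr => k _; rewrite mulrC cartan_sym.
  rewrite /hS; under [RHS]eq_bigr do rewrite [refl i a _ _]mxE rmorphB scalerBl.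
  rewrite sumrB; congr (_ - _); rewrite (bigD1 i) //= eqxx mul1r big1 ?addr0 //.
  by move=> k /negPf ->; rewrite mul0r scale0r.
elim: w => [|i w IH] /=; first by rewrite word_nil invmx1 mul1mx mulmx1.
rewrite word_cons => /andP[i7 /IH wE]; rewrite invmx_mul ?nW_unit ?word_unit //.
have -> : rowS (reflS i (chainS s w)) = refl (inord i) (rowS (chainS s w)).
  by rewrite refl_rowS inordK.
by rewrite -step -wE !mulmxA.
Qed.

Lemma hS_alpha i : hS (alpha i) = H i.
Proof.
rewrite /hS (bigD1 i) //= big1 ?addr0 => [|k ki].
  by rewrite [alpha _ _ _]mxE !eqxx scale1r.
by rewrite [alpha _ _ _]mxE (negPf ki) scale0r.
Qed.

Lemma chev_beta : chev cartanB Eb Gb Hb.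
Proof.
have brE i j : rsp (beta i - beta j) (bracket (Eb i) (Gb j)).
  have [l1 w1] := rsp_Eb i; have [l2 w2] := rsp_Gb j.
  by split; [apply: LieBracket | apply: wt_bracket].
split=> i j.
- have [<- | ij] := eqVneq i j.
    rewrite /Hb /Eb /Gb; case: eqP => [-> | /eqP i0]; last first.
      by rewrite beta_alpha // hS_alpha (chEF ch) eqxx.
    rewrite beta0_chain -hS_chain // -alpha6 hS_alpha -(sl2_ef (E7_sl2 _)).
    rewrite /bracket mulmxBr mulmxBl !mulmxA; congr (_ - _).
      by rewrite mulmxKV ?word_unit.
    by rewrite mulmxKV ?word_unit.
  (* [beta_1] minus a simple root of [H] is not a root, nor is its negative; the other pairs are
     distinct simple roots of G. *)
  have [i0 | i0] := eqVneq i 0.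
    have j0 : j != 0 by rewrite -i0 eq_sym.
    have /andP[/andP[m1 _] w7] := diff_mixed j0.
    by move: (brE i j); rewrite i0 diffSE => b0; apply: (rsp_mixed w7 m1 b0).
  have [j0 | j0] := eqVneq j 0.
    have /andP[/andP[_ m1] w7] := diff_mixed i0.
    by move: (brE i j); rewrite j0 diffSE => b0; apply: (rsp_mixed w7 m1 b0).
  rewrite /Eb /Gb (negPf i0) (negPf j0) (chEF ch); case: eqP => // bij.
  have := @forall_ord2 7 (fun i j => [&& i != 0%N, j != 0%N & bidx i == bidx j]
    ==> (i == j)) isT i j.
  rewrite i0 j0 /=; have -> : bidx i == bidx j by rewrite -[bidx i]/(val (bord i)) bij.
  by move=> /implyP/(_ isT) /eqP/val_inj ijE; rewrite ijE eqxx in ij.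
- by have [_ w] := rsp_Eb j; rewrite (hS_wt _ w).
- have [_ w] := rsp_Gb j; rewrite (hS_wt _ w); congr (_ *: _).
  rewrite -rmorphN /cartanB -sumrN; congr (_%:~R); apply: eq_bigr => k _.
  by rewrite cwN mulrN.
- rewrite /Hb /hS bracket_sum big1 // => k _; rewrite bracketZr bracketC bracket_sum.
  rewrite big1 ?oppr0 ?scaler0 // => l _.
  by rewrite bracketZr (chHH ch) scaler0.
Qed.

Lemma cartanB_diag i : cartanB i i = 2.
Proof.
rewrite cartanBE; apply/eqP; move: i.
by apply: (@forall_ord 7 (fun i => cbn i i == 2)); vm_compute.
Qed.

End BetaSystem.

Lemma group_generated_unit (F : fieldType) n (S : 'M[F]_n -> Prop) g :
  (forall g, S g -> g \in unitmx) -> group_generated S g -> g \in unitmx.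
Proof.
move=> SU; elim=> {g} [g /SU //||g k _ ug _ uk|g _ ug]; first exact: unitmx1.
  by rewrite unitmx_mul ug.
by rewrite unitmx_inv.
Qed.

Lemma group_generated_sub (F : fieldType) n (S : 'M[F]_n -> Prop) (K : 'M[F]_n -> Prop) g :
  (forall g, S g -> group_generated K g) -> group_generated S g -> group_generated K g.
Proof.
move=> SK; elim=> {g} [g /SK //||g k _ ug _ uk|g _ ug].
- exact: GroupOne.
- exact: GroupMul.
- exact: GroupInv.
Qed.

Section Wmx.
Variables (F : numFieldType) (d : nat).
Implicit Types E G : 'I_7 -> 'M[F]_d.

Definition wmx E G (w : seq nat) : 'M[F]_d :=
  locked (foldr (fun i A => theta (E (inord i)) (G (inord i)) 1 *m A) 1%:M w).

Lemma wmx_nil E G : wmx E G [::] = 1%:M.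
Proof. by rewrite /wmx -lock. Qed.

Lemma wmx_cons E G i w :
  wmx E G (i :: w) = theta (E (inord i)) (G (inord i)) 1 *m wmx E G w.
Proof. by rewrite /wmx -!lock. Qed.

(** The recipe of [Eb] and [Gb] in an arbitrary module, so that it can be followed through
    differentials and intertwining maps. *)
Definition Ebm E G (X : 'I_7 -> 'M[F]_d) (i : 'I_7) : 'M[F]_d :=
  if i == 0 then wmx E G beta_word *m X (inord 6) *m invmx (wmx E G beta_word)
  else X (bord i).

End Wmx.

(** * Root subgroups and the differentials of their representations *)

Section RootGroups.
Variables (F : numClosedFieldType) (n : nat) (X : E7_realization F n).
Let H := rh X.

Lemma word_mxE w : word_mx X w = wmx (re X) (rf X) w.
Proof.
by elim: w => [|i w IH]; rewrite ?word_nil ?wmx_nil // word_cons wmx_cons nWE IH.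
Qed.

Lemma EbE i : Eb X i = Ebm (re X) (rf X) (re X) i.
Proof. by rewrite /Eb /Ebm word_mxE. Qed.
Lemma GbE i : Gb X i = Ebm (re X) (rf X) (rf X) i.
Proof. by rewrite /Gb /Ebm word_mxE. Qed.

Lemma weight_hS a m v : weight_vector H m v ->
  hS X a *m v = (\sum_k a 0 k * m 0 k)%:~R *: v.
Proof.
move=> [_ Hv]; rewrite /hS mulmx_suml rmorph_sum scaler_suml; apply: eq_bigr => k _.
by rewrite -scalemxAl Hv scalerA rmorphM.
Qed.

(* Each [h_i] is diagonalizable with integral eigenvalues, by [sl2_diag]. *)
Lemma weight_vectors_span (S : 'cV[F]_n -> Prop) : lin S ->
  (forall m v, weight_vector H m v -> S v) -> forall x, S x.
Proof.
move=> Sl SW; have ch := chev_E7 X.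
(* [l] lists the indices for which [x] is not yet known to be an eigenvector. *)
suff ind (l : seq 'I_7) (mu : 'I_7 -> int) x :
    (forall i, i \notin l -> H i *m x = (mu i)%:~R *: x) -> S x.
  by move=> x; apply: (ind (enum 'I_7) (fun=> 0)) => i; rewrite mem_enum.
elim: l mu x => [|i l IH] mu x Hx.
  have [-> | x0] := eqVneq x 0; first by case: Sl.
  apply: (SW (\row_i mu i)); split=> // i; rewrite mxE; exact: Hx.
have [N [A [nu [inu sumA hA _ _]]]] := sl2_diag (E7_sl2 X i).
rewrite -[x]mul1mx -sumA mulmx_suml; apply: lin_sum => // k _.
apply: (IH (fun j => if j == i then nu k else mu j)) => j jl.
case: eqP => [-> | /eqP ji]; first by rewrite mulmxA hA -scalemxAl.
have jil : j \notin i :: l by rewrite inE negb_or ji.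
apply: (@eig_split_fin F 'cV[F]_n (fun y => H j *m y = (mu j)%:~R *: y)
  (fun y => H i *m y) _ (fun k => (nu k)%:~R : F) (fun k => A k *m x)).
- split; first by rewrite mulmx0 scaler0.
  move=> c y z hy hz; rewrite mulmxDr -scalemxAr hy hz scalerDr !scalerA.
  by rewrite mulrC.
- by move=> c y z; rewrite mulmxDr -scalemxAr.
- move=> y hy; have := chHH ch j i; rewrite /bracket => /eqP; rewrite subr_eq0 => /eqP e.
  by rewrite mulmxA e -mulmxA hy -scalemxAr.
- by move=> k1 k2 /intr_inj /inu.
- by move=> k'; rewrite mulmxA hA -scalemxAl.
- by rewrite -mulmx_suml sumA mul1mx Hx.
Qed.

(** Since [A k] carries the eigenvalue [mu k] on the right too, only the component with [mu k = c]
    survives on [v]. *)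
Lemma theta_weight (e f : 'M[F]_n) a s m v : sl2 e f (hS X a) -> s != 0 ->
  weight_vector H m v ->
  theta e f s *m invmx (theta e f 1) *m v = s ^ (\sum_k a 0 k * m 0 k) *: v.
Proof.
move=> S s0 wv; have [N [A [mu [imu sumA hA Ah th]]]] := sl2_diag S.
have hv := weight_hS a wv; set c := \sum_k _ in hv *.
have Av k : mu k != c -> A k *m v = 0.
  move=> kc; have : A k *m (hS X a *m v) = A k *m hS X a *m v by rewrite mulmxA.
  rewrite hv Ah -scalemxAr -scalemxAl => /eqP; rewrite -subr_eq0 -scalerBl scaler_eq0.
  by rewrite subr_eq0 eqr_int eq_sym (negPf kc) /= => /eqP.
rewrite th // mulmx_suml -[in RHS](mul1mx v) -sumA mulmx_suml scaler_sumr.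
apply: eq_bigr => k _; rewrite -scalemxAl; have [-> // | kc] := eqVneq (mu k) c.
by rewrite Av // !scaler0.
Qed.

Lemma prodr_expz (z : F) (f : 'I_7 -> int) : z != 0 ->
  \prod_j z ^ f j = z ^ (\sum_j f j).
Proof.
move=> z0; elim/big_rec2: _ => [|i x y _ ->]; first by rewrite expr0z.
by rewrite expfzDr.
Qed.

Lemma theta_coroot (e f : 'M[F]_n) a s : sl2 e f (hS X a) -> s != 0 ->
  coroot_elt X a s (theta e f s *m invmx (theta e f 1)).
Proof.
move=> S s0 m v wv; rewrite (theta_weight S s0 wv); congr (_ *: _).
rewrite -prodr_expz //; apply: eq_bigr => j _.
by rewrite exprz_exp.
Qed.

Lemma rootsub_exp a Y (t : F) : rsp X a Y -> root_subgroup X a (exp_nilp (t *: Y)).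
Proof.
move=> [lY wY]; exists (t *: Y) => //; split; first exact: LieScale.
by move=> i; rewrite bracketZr wY !scalerA mulrC.
Qed.

(** * One group generated by root subgroups: used for G and for both factors of H *)

Section OneGroup.
Variables (r : nat) (b : 'I_r -> 'rV[int]_7) (aa : 'I_r -> 'I_r -> int).
Variables (E G HH : 'I_r -> 'M[F]_n).
Hypotheses (ch : chev aa E G HH) (aa2 : forall i, aa i i = 2).
Hypothesis HHE : forall i, HH i = hS X (b i).
Hypotheses (bE : forall i, rsp X (b i) (E i)) (bG : forall i, rsp X (- b i) (G i)).
Hypothesis bE1 : forall i Y, rsp X (b i) Y -> exists k, Y = k *: E i.
Hypothesis bG1 : forall i Y, rsp X (- b i) Y -> exists k, Y = k *: G i.
Let K := root_group X b.
Let s2 i := chev_sl2 aa2 ch i.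

Lemma gen_cases i g : root_subgroup X (b i) g \/ root_subgroup X (- b i) g ->
  (exists t, g = exp_nilp (t *: E i)) \/ (exists t, g = exp_nilp (t *: G i)).
Proof.
by move=> [[Y rY ->] | [Y rY ->]]; [left; have [k ->] := bE1 rY |
  right; have [k ->] := bG1 rY]; exists k.
Qed.

Lemma K_unit g : K g -> g \in unitmx.
Proof.
apply: group_generated_unit => {}g [i /gen_cases[[t ->]|[t ->]]]; apply: exp_unit;
  apply: nilmxZ; [exact: sl2_nilmx_e (s2 i) | exact: sl2_nilmx_f (s2 i)].
Qed.

Lemma K_expoE i : expo K (E i).
Proof.
split; first exact: sl2_nilmx_e (s2 i).
by move=> t; apply: GroupIn; exists i; left; apply: rootsub_exp.
Qed.

Lemma K_expoG i : expo K (G i).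
Proof.
split; first exact: sl2_nilmx_f (s2 i).
by move=> t; apply: GroupIn; exists i; right; apply: rootsub_exp.
Qed.

Lemma K_theta i s : K (theta (E i) (G i) s).
Proof.
have [_ kE] := K_expoE i; have [_ kG] := K_expoG i.
by apply: GroupMul (kE s); apply: GroupMul (kE s) (kG _).
Qed.

Variables (d : nat) (rho : 'M[F]_n -> 'M[F]_d).
Hypothesis rK : rational_rep K rho.

Record differential (D : 'M[F]_n -> 'M[F]_d) : Prop := Differential {
  dif_lin : islin D;
  dif_exp : forall Y, expo K Y ->
    nilmx (D Y) /\ forall t, rho (exp_nilp (t *: Y)) = exp_nilp (t *: D Y);
  dif_conj : forall Y, expo K Y -> Tan K rho D Y }.

Lemma differential_exists : exists D, differential D.
Proof.
have [D [h1 h2 h3]] := rep_differential (fun g k (Kg : K g) (Kk : K k) => GroupMul Kg Kk)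
  (fun g (Kg : K g) => GroupInv Kg)
  K_unit rK.
by exists D; split.
Qed.

Variable D : 'M[F]_n -> 'M[F]_d.
Hypothesis dD : differential D.

Lemma rho_V g : K g -> rho (invmx g) = invmx (rho g).
Proof.
move=> Kg; have [r1 rM _] := rK; apply/esym/invmx_eq.
rewrite -rM //; last exact: GroupInv.
by rewrite mulmxV ?K_unit.
Qed.

Lemma rho_unit g : K g -> rho g \in unitmx.
Proof.
move=> Kg; have [r1 rM _] := rK.
have : rho g *m rho (invmx g) = 1%:M.
  by rewrite -rM ?mulmxV ?K_unit //; apply: GroupInv.
by move/mulmx1_unit => [].
Qed.

Lemma dif_bracket Z Y : expo K Z -> Tan K rho D Y ->
  D (bracket Z Y) = bracket (D Z) (D Y) /\ Tan K rho D (bracket Z Y).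
Proof.
apply: (Tan_bracket _ _ K_unit rK (dif_lin dD) (dif_exp dD)).
  by move=> *; apply: GroupMul.
by move=> *; apply: GroupInv.
Qed.

Lemma D_N Y : D (- Y) = - D Y.
Proof.
have Dl := dif_lin dD.
have D0 : D 0 = 0 by have := Dl (-1) 0 0; rewrite scaler0 addr0 scaleN1r addNr.
by have := Dl (-1) Y 0; rewrite D0 !addr0 !scaleN1r.
Qed.

Lemma D_Z c Y : D (c *: Y) = c *: D Y.
Proof.
have Dl := dif_lin dD.
have D0 : D 0 = 0 by have := Dl (-1) 0 0; rewrite scaler0 addr0 scaleN1r addNr.
by have := Dl c Y 0; rewrite D0 !addr0.
Qed.

Lemma D_0 : D 0 = 0.
Proof. by rewrite -(scale0r (0 : 'M_n)) D_Z scale0r. Qed.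

Lemma D_sum (I : finType) (Y : I -> 'M[F]_n) : D (\sum_i Y i) = \sum_i D (Y i).
Proof.
apply: big_morph; last exact: D_0.
by move=> x y; have := dif_lin dD 1 x y; rewrite !scale1r.
Qed.

Lemma dif_chev : chev aa (fun i => D (E i)) (fun i => D (G i)) (fun i => D (HH i)).
Proof.
have eE := K_expoE; have eG := K_expoG.
have TE i := dif_conj dD (eE i); have TG i := dif_conj dD (eG i).
have HEG i : HH i = bracket (E i) (G i) by rewrite (chEF ch) eqxx.
have TH i : Tan K rho D (HH i) by rewrite HEG; have [] := dif_bracket (eE i) (TG i).
have bC Y Z : D (bracket Y Z) = - D (bracket Z Y).
  by rewrite bracketC D_N.
(* [dif_bracket] wants an exponentiable element on the left, which the semisimple [HH i] is not;
   hence the exchange of the two arguments. *)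
have HEl i j : bracket (D (HH i)) (D (E j)) = (aa i j)%:~R *: D (E j).
  rewrite bracketC -(dif_bracket (eE j) (TH i)).1 bracketC D_N opprK (chHE ch).
  exact: D_Z.
have HGl i j : bracket (D (HH i)) (D (G j)) = - (aa i j)%:~R *: D (G j).
  rewrite bracketC -(dif_bracket (eG j) (TH i)).1 bracketC D_N opprK (chHF ch).
  exact: D_Z.
have EGl i j : bracket (D (E i)) (D (G j)) = if i == j then D (HH i) else 0.
  rewrite -(dif_bracket (eE i) (TG j)).1 (chEF ch).
  by case: eqP => // _; apply: D_0.
split=> // i j.
have -> : D (HH j) = bracket (D (E j)) (D (G j)) by rewrite EGl eqxx.
rewrite bracket_jacobi HEl HGl bracketZl bracketZr scaleNr.
by rewrite subrr.
Qed.

Lemma rho_theta i s : rho (theta (E i) (G i) s) = theta (D (E i)) (D (G i)) s.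
Proof.
have [r1 rM _] := rK.
have [_ kE] := K_expoE i; have [_ kG] := K_expoG i.
have [_ dE] := dif_exp dD (K_expoE i); have [_ dG] := dif_exp dD (K_expoG i).
have k1 := kE s; have k2 := kG (- s^-1); have k12 : K _ := GroupMul k1 k2.
by rewrite /theta !rM // dE dG.
Qed.

Lemma rho_coroot i s : s != 0 ->
  exists t, [/\ K t, coroot_elt X (b i) s t &
    rho t = theta (D (E i)) (D (G i)) s *m invmx (theta (D (E i)) (D (G i)) 1)].
Proof.
move=> s0; have [r1 rM _] := rK.
exists (theta (E i) (G i) s *m invmx (theta (E i) (G i) 1)).
have k1 := K_theta i 1; have ks := K_theta i s.
split; first by apply: GroupMul => //; apply: GroupInv.
  by apply: theta_coroot => //; rewrite -HHE; apply: s2.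
rewrite rM //; last exact: GroupInv.
by rewrite rho_V // !rho_theta.
Qed.

Lemma dif_hwv m v : highest_weight_vector X b m rho v ->
  hwv (fun i => D (E i)) (fun i => D (HH i)) m v.
Proof.
move=> [v0 hE hT]; split=> // i.
  have [nE dE] := dif_exp dD (K_expoE i).
  have c1 := pcurve_mulr v (pcurve_exp nE).
  have c2 : pcurve (fun t => exp_nilp (t *: D (E i)) *m v) (fun k => if k is 0%N then v else 0).
    exists 1%N; split=> [t|[]//]; rewrite big_ord1 expr0 scale1r -dE.
    by apply: hE; apply: rootsub_exp.
  by have := pcurve_uniq (fun=> erefl) c1 c2 1%N; rewrite expk1.
have S2 := chev_sl2 aa2 dif_chev i.
have [N [A [mu [imu sumA hA Ah th]]]] := sl2_diag S2.
(* The single parameter [s = 2] is enough: [2 ^ mu] determines the integer [mu]. *)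
have two0 : (2 : F) != 0 by rewrite pnatr_eq0.
have [t [Kt ct rt]] := rho_coroot i two0.
have := hT i 2 t two0 ct; rewrite rt th // mulmx_suml.
under eq_bigr do rewrite -scalemxAl.
move/eqP; rewrite -subr_eq0 => /eqP sum0.
have vE : v = \sum_k A k *m v by rewrite -mulmx_suml sumA mul1mx.
have z k : (2 ^ mu k - 2 ^+ m i) *: (A k *m v) = 0.
  apply: (@eig_split_fin F 'cV[F]_d (fun y => y = 0) (fun y => D (HH i) *m y) _
    (fun k => (mu k)%:~R : F) (fun k => (2 ^ mu k - 2 ^+ m i) *: (A k *m v))).
  - exact: lin_zero.
  - by move=> c y z; rewrite mulmxDr -scalemxAr.
  - by move=> y ->; rewrite mulmx0.
  - by move=> k1 k2 /intr_inj /imu.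
  - by move=> k'; rewrite -scalemxAr mulmxA hA -scalemxAl !scalerA mulrC.
  - rewrite -[RHS]sum0 [X in _ - _ *: X]vE scaler_sumr -sumrB; apply: eq_bigr => k' _.
    by rewrite scalerBl.
rewrite vE mulmx_sumr scaler_sumr; apply: eq_bigr => k _.
rewrite mulmxA hA -scalemxAl; have /eqP := z k.
rewrite scaler_eq0 => /orP[|/eqP ->]; last by rewrite !scaler0.
rewrite subr_eq0 => /eqP e.
have -> : mu k = (m i)%:Z.
  case: (mu k) e => q.
    by rewrite -exprnP -!natrX => /eqP; rewrite eqr_nat eqn_exp2l // => /eqP ->.
  rewrite NegzE -exprnN => /(congr1 (fun x => x * 2 ^+ q.+1)).
  rewrite mulVf ?expf_neq0 // -exprD -natrX -[1]/(1%:R) => /eqP.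
  by rewrite eqr_nat addnS expnS => /eqP; lia.
by rewrite -pmulrn.
Qed.

Lemma stable_rho (S : 'cV[F]_d -> Prop) g : lin S ->
  stab (fun i => D (E i)) S -> stab (fun i => D (G i)) S -> K g ->
  forall x, S x -> S (rho g *m x).
Proof.
move=> Sl SE SG Kg; have [r1 rM _] := rK.
have Sexp Y t x : nilmx Y -> (forall x, S x -> S (Y *m x)) -> S x ->
    S (exp_nilp (t *: Y) *m x).
  move=> [N YN] SY Sx; rewrite (exp_nilpE (N := N) (M := N)) ?mxexprZ ?YN ?scaler0 //.
  rewrite mulmx_suml; apply: lin_sum => // k _; rewrite expkZ /expk.
  rewrite -!scalemxAl; do 2!apply: linZ => //.
  elim: (nat_of_ord k) => [|j IH]; first by rewrite mul1mx.
  by rewrite exprS -mulmxE -mulmxA; apply: SY.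
suff [] : (forall x, S x -> S (rho g *m x)) /\ (forall x, S x -> S (rho (invmx g) *m x)).
  by [].
elim: Kg => {g} [g [i gi]||g k Kg [hg hgv] Kk [hk hkv]|g Kg [hg hgv]].
- have [nE dE] := dif_exp dD (K_expoE i); have [nG dG] := dif_exp dD (K_expoG i).
  have [n1 _] := K_expoE i; have [n2 _] := K_expoG i.
  case: (gen_cases gi) => -[t ->]; rewrite exp_inv -?scaleNr ?dE ?dG; try exact: nilmxZ.
    by split=> x Sx; apply: Sexp => // y; apply: SE.
  by split=> x Sx; apply: Sexp => // y; apply: SG.
- by rewrite invmx1 r1; split=> x; rewrite mul1mx.
- have Kgv := GroupInv Kg; have Kkv := GroupInv Kk.
  rewrite invmx_mul ?K_unit // !rM //.
  by split=> x Sx; rewrite -mulmxA; [apply/hg/hk | apply/hkv/hgv].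
- by rewrite invmxK; split.
Qed.

Lemma dif_irr : irreducible_rep K rho ->
  irrmod (fun i => D (E i)) (fun i => D (G i)) (fun=> True).
Proof.
move=> [d0 irr] S Sl SE SG _ [x [Sx x0]] y _.
have [p [B [Binj SB]]] := lin_repr Sl.
pose U : {vspace 'cV[F]_d} := limg (linfun (mulmx B : 'cV[F]_p -> 'cV[F]_d)).
have UE z : z \in U <-> S z.
  split=> [/memv_imgP[t _ ->]|/SB[t ->]]; first by rewrite lfunE; apply/SB; exists t.
  by apply/memv_imgP; exists t; rewrite ?memvf ?lfunE.
have [|U0|Uf] := irr U.
- by move=> g v Kg /UE Sv; apply/UE; apply: stable_rho.
- by move/UE: Sx; rewrite U0 memv0 (negPf x0).
- by apply/UE; rewrite Uf memvf.
Qed.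

End OneGroup.

End RootGroups.

Lemma mx_ext (F : fieldType) m n (A B : 'M[F]_(m, n)) :
  (forall x : 'cV_n, A *m x = B *m x) -> A = B.
Proof.
move=> AB; apply/matrixP => i j; have := AB (delta_mx j 0); rewrite -!colE.
by move=> /matrixP/(_ i 0); rewrite !mxE.
Qed.

(** The matrix of [g] in a basis of [S] is injective, hence invertible, by finite dimension. *)
Lemma lin_stable_inv (F : fieldType) d (S : 'cV[F]_d -> Prop) (g : 'M[F]_d) :
  lin S -> g \in unitmx -> (forall x, S x -> S (g *m x)) ->
  forall x, S x -> S (invmx g *m x).
Proof.
move=> Sl ug Sg; have [p [B [Binj SB]]] := lin_repr Sl.
have [M MP] : exists M : 'M[F]_p, g *m B = B *m M.
  have [M HM] : exists M : 'I_p -> 'cV[F]_p, forall j, g *m col j B = B *m M j.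
    apply: (fin_all_exists (P := fun j c => g *m col j B = B *m c)) => j.
    by apply/SB/Sg/SB; exists (delta_mx j 0); rewrite colE.
  exists (\matrix_(i, j) M j i 0); apply/matrixP => i j.
  have /matrixP/(_ i 0) := HM j; rewrite !mxE => e.
  transitivity (\sum_j0 g i j0 * col j B j0 0); last
    by rewrite e; apply: eq_bigr => k _; rewrite mxE.
  by apply: eq_bigr => k _; rewrite mxE.
have uM : M \in unitmx.
  apply: inj_unitmx => z Mz; apply: Binj; apply: (can_inj (mulKmx ug)).
  by rewrite mulmxA MP -mulmxA Mz !mulmx0.
move=> x /SB[z ->]; apply/SB; exists (invmx M *m z).
apply: (can_inj (mulKmx ug)); rewrite mulKVmx // mulmxA MP -mulmxA.
by rewrite mulKVmx.
Qed.

(** * The group H inside G *)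

Section GroupH.
Variables (F : numClosedFieldType) (n : nat) (X : E7_realization F n).
Let E := re X.
Let G := rf X.
Let H := rh X.
Let ch := chev_E7 X.

Lemma H_alphaE i : H i = hS X (alpha i).
Proof. by rewrite hS_alpha. Qed.

Let e1 := rsp_E X.
Let g1 := rsp_G X.
Let KE := K_expoE ch cartan_diag e1.
Let KG := K_expoG ch cartan_diag g1.
Let KU := K_unit ch cartan_diag (@rsp_alpha _ _ X) (@rsp_nalpha _ _ X).
Let Kth := K_theta ch cartan_diag e1 g1.

Definition Ti (i : 'I_7) (s : F) : 'M[F]_n :=
  theta (E i) (G i) s *m invmx (theta (E i) (G i) 1).

Lemma Ti_group i s : groupE7 X (Ti i s).
Proof. by apply: GroupMul; [|apply: GroupInv]; apply: Kth. Qed.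

Lemma Ti_weight i s m v : s != 0 -> weight_vector H m v -> Ti i s *m v = s ^ m 0 i *: v.
Proof.
move=> s0 wv; have S2 : sl2 (E i) (G i) (hS X (alpha i)).
  by rewrite -H_alphaE; apply: E7_sl2.
rewrite /Ti (theta_weight S2 s0 wv); congr (_ ^ _ *: _).
rewrite (bigD1 i) //= big1 ?addr0 => [|k ki].
  by rewrite mxE !eqxx mul1r.
by rewrite mxE (negPf ki) mul0r.
Qed.

(** Both sides agree on weight vectors, and these span. *)
Lemma torusE t : torus X t -> exists2 z : 'I_7 -> F, (forall j, z j != 0) &
  t = foldr (fun i A => Ti i (z i) *m A) 1%:M (enum 'I_7).
Proof.
move=> [z z0 tz]; exists z => //; apply: mx_ext.
set T := foldr _ _ _.
apply: (weight_vectors_span (X := X) (S := fun x => t *m x = T *m x)).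
  split; first by rewrite !mulmx0.
  by move=> c x y hx hy; rewrite !mulmxDr -!scalemxAr hx hy.
move=> m v wv; rewrite (tz m v wv) /T -big_enum /=.
elim: (enum _) => [|i l IH] /=; first by rewrite big_nil scale1r mul1mx.
by rewrite big_cons -mulmxA -IH -scalemxAr (Ti_weight _ _ wv) // scalerA mulrC.
Qed.

Lemma torus_groupE7 t : torus X t -> groupE7 X t.
Proof.
move=> /torusE[z _ ->]; elim: (enum _) => [|i l IH] /=; first exact: GroupOne.
by apply: GroupMul => //; apply: Ti_group.
Qed.

Lemma wmx_group w : groupE7 X (wmx E G w).
Proof.
elim: w => [|i w IH]; first by rewrite wmx_nil; apply: GroupOne.
by rewrite wmx_cons; apply: GroupMul => //; apply: Kth.
Qed.

Lemma expo_conj g Y : groupE7 X g -> expo (groupE7 X) Y ->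
  expo (groupE7 X) (g *m Y *m invmx g).
Proof.
move=> Kg [nY KY]; have ug := KU Kg.
have vg : invmx g *m g = 1 by rewrite mulVmx.
split; first exact: nilmx_conj.
move=> t; have -> : t *: (g *m Y *m invmx g) = g *m (t *: Y) *m invmx g.
  by rewrite -scalemxAr -scalemxAl.
rewrite exp_conj //; last exact: nilmxZ.
exact: (GroupMul (GroupMul Kg (KY t)) (GroupInv Kg)).
Qed.

Lemma expo_Eb i : expo (groupE7 X) (Eb X i).
Proof.
rewrite EbE /Ebm; case: eqP => _; last exact: KE.
by apply: expo_conj; [apply: wmx_group | apply: KE].
Qed.

Lemma expo_Gb i : expo (groupE7 X) (Gb X i).
Proof.
rewrite GbE /Ebm; case: eqP => _; last exact: KG.
by apply: expo_conj; [apply: wmx_group | apply: KG].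
Qed.

Lemma beta_gen_cases i g : root_subgroup X (beta i) g \/ root_subgroup X (- beta i) g ->
  (exists t, g = exp_nilp (t *: Eb X i)) \/ (exists t, g = exp_nilp (t *: Gb X i)).
Proof.
by move=> [[Y rY ->] | [Y rY ->]]; [left; have [k ->] := rsp_beta rY |
  right; have [k ->] := rsp_nbeta rY]; exists k.
Qed.

Lemma groupH_E7 g : groupH X g -> groupE7 X g.
Proof.
apply: group_generated_sub => {}g [/torus_groupE7 //|[i /beta_gen_cases[[t ->]|[t ->]]]].
  by have [_] := expo_Eb i; apply.
by have [_] := expo_Gb i; apply.
Qed.

Variables (d : nat) (rho : 'M[F]_n -> 'M[F]_d).
Hypothesis rK : rational_rep (groupE7 X) rho.
Variable D : 'M[F]_n -> 'M[F]_d.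
Hypothesis dD : differential X alpha rho D.

Lemma rho_wmx w : rho (wmx E G w) = wmx (fun i => D (E i)) (fun i => D (G i)) w.
Proof.
have [r1 rM _] := rK; elim: w => [|i w IH]; first by rewrite !wmx_nil.
rewrite !wmx_cons rM; [|exact: Kth|exact: wmx_group].
by rewrite IH (rho_theta ch cartan_diag e1 g1 rK dD).
Qed.

Lemma dif_Ebm Z i : (forall i, expo (groupE7 X) (Z i)) ->
  D (Ebm E G Z i) = Ebm (fun i => D (E i)) (fun i => D (G i)) (fun i => D (Z i)) i.
Proof.
move=> eZ; rewrite /Ebm; case: eqP => // _.
rewrite (dif_conj dD) //; last exact: wmx_group.
have := rho_V ch cartan_diag (@rsp_alpha _ _ X) (@rsp_nalpha _ _ X) rK (wmx_group beta_word).
by move=> ->; rewrite rho_wmx.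
Qed.

Lemma dif_Eb i :
  D (Eb X i) = Ebm (fun i => D (E i)) (fun i => D (G i)) (fun i => D (E i)) i.
Proof. by rewrite EbE; apply: dif_Ebm. Qed.

Lemma dif_Gb i :
  D (Gb X i) = Ebm (fun i => D (E i)) (fun i => D (G i)) (fun i => D (G i)) i.
Proof. by rewrite GbE; apply: dif_Ebm. Qed.

Lemma dif_Hb i : D (Hb X i) = \sum_k (beta i 0 k)%:~R *: D (H k).
Proof.
by rewrite /Hb /hS (D_sum dD); apply: eq_bigr => k _; rewrite (D_Z dD).
Qed.

(** The coroots of [H] contain all simple coroots of G but that of [alpha_6] (index 5). It is
    recovered from [beta_1], where it has coefficient 2, by subtraction and division by 2. *)
Lemma stab_Hb_H (S : 'cV[F]_d -> Prop) : lin S -> stab (fun i => D (Hb X i)) S ->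
  stab (fun i => D (H i)) S.
Proof.
move=> Sl SH.
have two0 : (2 : F) != 0 by rewrite pnatr_eq0.
have simple (i : 'I_7) : i != 0 -> forall x, S x -> S (D (H (bord i)) *m x).
  by move=> i0 x Sx; have := SH i x Sx; rewrite /Hb beta_alpha // hS_alpha.
have all_but (i : 'I_7) : (i : nat) != 5%N -> forall x, S x -> S (D (H i) *m x).
  move=> i5; have [j j0 ->] : exists2 j, j != 0 & i = bord j.
    have := @forall_ord 7 (fun i => (i != 5%N) ==>
      has (fun j => (j != 0%N) && (bidx j == i)) (iota 0 7)) isT i.
    move=> /implyP/(_ i5)/hasP[j]; rewrite mem_iota => j7 /andP[j0 /eqP ji].
    by exists (Ordinal j7) => //; apply: val_inj.
  exact: simple.
move=> i x Sx; have [i5 | /all_but] := eqVneq (i : nat) 5%N; last exact.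
have := SH 0 x Sx; rewrite dif_Hb (bigD1 i) //= mulmxDl => Sy.
have S2 : S ((\sum_(k < 7 | k != i) (beta 0 0 k)%:~R *: D (H k)) *m x).
  rewrite mulmx_suml -big_filter; apply: lin_sum => // k; rewrite mem_filter => /andP[ki _].
  rewrite -scalemxAl; apply: linZ => //; apply: all_but => //.
  by apply: contraNneq ki => e; apply/eqP/val_inj; rewrite /= e i5.
have := linB Sl Sy S2; rewrite addrK -scalemxAl => S3.
have b2 : beta 0 0 i = 2 by rewrite betaE mxE i5.
rewrite -[_ *m x](scalerK two0); apply: linZ => //.
by rewrite b2 in S3.
Qed.

Lemma Ti_stable (S : 'cV[F]_d -> Prop) i s : lin S -> stab (fun i => D (H i)) S ->
  s != 0 -> forall x, S x -> S (rho (Ti i s) *m x).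
Proof.
move=> Sl SH s0 x Sx; have [r1 rM _] := rK.
have k1 := Kth i 1; have ks := Kth i s.
rewrite /Ti rM //; last exact: GroupInv.
rewrite (rho_V ch cartan_diag (@rsp_alpha _ _ X) (@rsp_nalpha _ _ X) rK) //.
rewrite !(rho_theta ch cartan_diag e1 g1 rK dD).
have S2 := chev_sl2 cartan_diag (dif_chev ch cartan_diag e1 g1
  (@rsp_alpha _ _ X) (@rsp_nalpha _ _ X) rK dD) i.
have [N [A [mu [imu sumA hA Ah th]]]] := sl2_diag S2.
rewrite th // mulmx_suml; apply: lin_sum => // k _; rewrite -scalemxAl; apply: linZ => //.
apply: (@eig_split_fin F 'cV[F]_d S (fun y => D (H i) *m y) _
    (fun k => (mu k)%:~R : F) (fun k => A k *m x)) => //.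
- by move=> c y z; rewrite mulmxDr -scalemxAr.
- by move=> y; apply: SH.
- by move=> k1' k2 /intr_inj /imu.
- by move=> k'; rewrite mulmxA hA -scalemxAl.
- by rewrite -mulmx_suml sumA mul1mx.
Qed.

Lemma groupH_stable (S : 'cV[F]_d -> Prop) g : lin S ->
  stab (fun i => D (Eb X i)) S -> stab (fun i => D (Gb X i)) S ->
  stab (fun i => D (Hb X i)) S -> groupH X g ->
  forall x, S x -> S (rho g *m x).
Proof.
move=> Sl SE SG SHb; have [r1 rM _] := rK; have SH := stab_Hb_H Sl SHb.
have Sexp Y t x : nilmx Y -> (forall x, S x -> S (Y *m x)) -> S x ->
    S (exp_nilp (t *: Y) *m x).
  move=> [N YN] SY Sx; rewrite (exp_nilpE (N := N) (M := N)) ?mxexprZ ?YN ?scaler0 //.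
  rewrite mulmx_suml; apply: lin_sum => // k _; rewrite expkZ /expk.
  rewrite -!scalemxAl; do 2!apply: linZ => //.
  elim: (nat_of_ord k) => [|j IH]; first by rewrite mul1mx.
  by rewrite exprS -mulmxE -mulmxA; apply: SY.
elim=> {g} [g [/torusE[z z0 ->]|[i gi]]||g k Kg hg Kk hk|g Kg hg] x Sx.
- elim: (enum _) => [|i l IH] /=; first by rewrite r1 mul1mx.
  rewrite rM; [|exact: Ti_group|].
    by rewrite -mulmxA; apply: Ti_stable.
  elim: (l) => [|j l' IH'] /=; first exact: GroupOne.
  by apply: GroupMul => //; apply: Ti_group.
- have [nE dE] := dif_exp dD (expo_Eb i); have [nG dG] := dif_exp dD (expo_Gb i).
  case: (beta_gen_cases gi) => -[t ->]; rewrite ?dE ?dG; apply: Sexp => // y.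
    exact: SE.
  exact: SG.
- by rewrite r1 mul1mx.
- by rewrite rM; [rewrite -mulmxA; apply/hg/hk | apply: groupH_E7..].
- have K7 := groupH_E7 Kg.
  rewrite (rho_V ch cartan_diag (@rsp_alpha _ _ X) (@rsp_nalpha _ _ X) rK) //.
  apply: lin_stable_inv => //.
  exact: (rho_unit ch cartan_diag (@rsp_alpha _ _ X) (@rsp_nalpha _ _ X) rK).
Qed.

End GroupH.

(** * The 56-dimensional representation *)

Section SparseMatrices.

(** Pairs of a column and a coefficient. Repeated columns add up, so that adding rows is
    concatenation; [snorm] merges them and drops zeros. *)
Definition srow := seq (nat * int).
Definition smx := seq srow.

Definition coef (r : srow) (j : nat) : int :=
  foldr (fun p s => if p.1 == j then p.2 + s else s) 0 r.
Definition entry (A : smx) (i j : nat) : int := coef (nth [::] A i) j.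
Definition sscale (c : int) (A : smx) : smx := map (map (fun p => (p.1, c * p.2))) A.
Definition sadd (A B : smx) : smx := mkseq (fun i => nth [::] A i ++ nth [::] B i) 56.
Definition smul (A B : smx) : smx :=
  map (fun r : srow => flatten
    (map (fun p => map (fun q : nat * int => (q.1, p.2 * q.2)) (nth [::] B p.1)) r)) A.
Definition sone : smx := mkseq (fun i => [:: (i, 1)]) 56.
Definition sbr (A B : smx) : smx := sadd (smul A B) (sscale (-1) (smul B A)).
Definition snorm (A : smx) : smx :=
  map (fun r => filter (fun p => p.2 != 0) (map (fun j => (j, coef r j)) (undup (map fst r)))) A.
Definition sok (A : smx) : bool := all (all (fun p : nat * int => (p.1 < 56)%N)) A.
Definition seqm (A B : smx) : bool :=
  all (fun i => all (fun j => entry A i j == entry B i j) (iota 0 56)) (iota 0 56).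
Definition strm (A B : smx) : bool :=
  all (fun i => all (fun j => entry A i j == entry B j i) (iota 0 56)) (iota 0 56).

Lemma coef_cat r s j : coef (r ++ s) j = coef r j + coef s j.
Proof.
by elim: r => [|p r IH] /=; rewrite ?add0r // IH; case: eqP => //; rewrite addrA.
Qed.

Lemma coef_scale c (r : srow) j :
  coef (map (fun p => (p.1, c * p.2)) r) j = c * coef r j.
Proof.
by elim: r => [|p r IH] /=; rewrite ?mulr0 // IH; case: eqP => //; rewrite mulrDr.
Qed.

Lemma coef_notin r j : j \notin map fst r -> coef r j = 0.
Proof.
elim: r => //= p r IH; rewrite inE negb_or eq_sym => /andP[/negPf -> /IH ->].
by [].
Qed.

Variable C : numClosedFieldType.

Definition mxS (A : smx) : 'M[C]_56 := \matrix_(i, j) (entry A i j)%:~R.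
Definition vS (v : seq int) : 'cV[C]_56 := \col_i (nth 0 v i)%:~R.
Definition smulv (A : smx) (v : seq int) : seq int :=
  map (fun r : srow => foldr (fun p s => p.2 * nth 0 v p.1 + s) 0 r) A.
Definition sveq (v w : seq int) : bool :=
  all (fun i => nth 0 v i == nth 0 w i) (iota 0 56).

Lemma mxS_eq A B : seqm A B -> mxS A = mxS B.
Proof.
move=> /forall_ord2 H; apply/matrixP => i j; rewrite !mxE.
by congr (_%:~R); apply/eqP; apply: H.
Qed.

Lemma mxS_tr A B : strm A B -> adjm (mxS A) = mxS B.
Proof.
move=> /forall_ord2 H; apply/matrixP => i j; rewrite !mxE.
by rewrite rmorph_int; congr (_%:~R); apply/eqP; apply: H.
Qed.

Lemma vS_eq v w : sveq v w -> vS v = vS w.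
Proof.
move=> /forall_ord H; apply/colP => i; rewrite !mxE.
by congr (_%:~R); apply/eqP; apply: H.
Qed.

Lemma mxS_add A B : mxS (sadd A B) = mxS A + mxS B.
Proof.
apply/matrixP => i j; rewrite !mxE -rmorphD; congr (_%:~R).
by rewrite /entry nth_mkseq // coef_cat.
Qed.

Lemma mxS_scale c A : mxS (sscale c A) = c%:~R *: mxS A.
Proof.
apply/matrixP => i j; rewrite !mxE -rmorphM; congr (_%:~R).
rewrite /entry; case: (ltnP i (size A)) => iA.
  by rewrite (nth_map [::]) // coef_scale.
by rewrite !nth_default ?size_map //= mulr0.
Qed.

Lemma mxS_one : mxS sone = 1%:M.
Proof.
apply/matrixP => i j; rewrite !mxE /entry nth_mkseq //= addr0 (inj_eq val_inj).
by case: eqP.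
Qed.

Lemma foldr_coef (r : srow) (f : nat -> C) : all (fun p => (p.1 < 56)%N) r ->
  \sum_(k < 56) (coef r k)%:~R * f k = foldr (fun p s => p.2%:~R * f p.1 + s) 0 r.
Proof.
elim: r => [|p r IH] /= => [_|/andP[p56 r56]].
  by rewrite big1 // => k _; rewrite mul0r.
rewrite -IH // (bigD1 (Ordinal p56)) //= eqxx [in RHS](bigD1 (Ordinal p56)) //=.
rewrite rmorphD mulrDl addrA; congr (_ + _); apply: eq_bigr => k kp.
by rewrite ifF //; apply/eqP => e; case/eqP: kp; apply: val_inj.
Qed.

Lemma mxS_mul A B : sok A -> mxS (smul A B) = mxS A *m mxS B.
Proof.
move=> /allP okA; apply/matrixP => i j; rewrite !mxE.
have okr : all (fun p : nat * int => (p.1 < 56)%N) (nth [::] A i).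
  by case: (ltnP i (size A)) => iA; [apply/okA/mem_nth | rewrite nth_default].
have -> : \sum_k mxS A i k * mxS B k j
    = \sum_(k < 56) (coef (nth [::] A i) k)%:~R * (entry B k j)%:~R.
  by apply: eq_bigr => k _; rewrite !mxE.
rewrite (foldr_coef (fun k => (entry B k j)%:~R)) // /entry /smul.
case: (ltnP i (size A)) => iA; last by rewrite !nth_default ?size_map.
rewrite (nth_map [::]) //; elim: (nth _ A i) => [|p r IH] //=.
by rewrite coef_cat rmorphD /= -IH coef_scale rmorphM.
Qed.

Lemma mxS_br A B : sok A -> sok B -> mxS (sbr A B) = bracket (mxS A) (mxS B).
Proof.
by move=> a b; rewrite mxS_add mxS_scale !mxS_mul // rmorphN1 scaleN1r.
Qed.

Lemma mxS_norm A : mxS (snorm A) = mxS A.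
Proof.
apply/matrixP => i j; rewrite !mxE; congr (_%:~R); rewrite /entry.
case: (ltnP i (size A)) => iA; last by rewrite !nth_default ?size_map.
rewrite (nth_map [::]) //; set r := nth _ A i.
have u := undup_uniq (map fst r).
have -> : coef r j = if (nat_of_ord j) \in undup (map fst r) then coef r j else 0.
  by rewrite mem_undup; case: ifPn => // /coef_notin.
elim: (undup _) u => //= k s IH /andP[ks us].
rewrite inE; case: (eqVneq (nat_of_ord j) k) => [jk | jk] /=.
  subst k; case: ifPn => [_|]; rewrite /= ?eqxx.
    by rewrite IH // (negPf ks) addr0.
  by rewrite negbK => /eqP k0; rewrite IH // (negPf ks) k0.
by case: ifPn => _; rewrite /= ?[k == _]eq_sym ?(negPf jk) IH.
Qed.

Lemma mxS_v A v : sok A -> size A = 56%N -> mxS A *m vS v = vS (smulv A v).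
Proof.
move=> /allP okA szA; apply/colP => i; rewrite !mxE.
have iA : (i < size A)%N by rewrite szA.
have okr : all (fun p : nat * int => (p.1 < 56)%N) (nth [::] A i).
  by apply/okA/mem_nth.
have -> : \sum_k mxS A i k * vS v k 0
    = \sum_(k < 56) (coef (nth [::] A i) k)%:~R * (nth 0 v k)%:~R.
  by apply: eq_bigr => k _; rewrite !mxE.
rewrite (foldr_coef (fun k => (nth 0 v k)%:~R)) // (nth_map [::]) //.
by elim: (nth _ A i) => [|p r IH] //=; rewrite IH rmorphD rmorphM.
Qed.

End SparseMatrices.

Definition lower (w : seq int) : seq (seq int) :=
  pmap (fun i => if nth 0 w i == 1 then Some (mkseq (fun j => nth 0 w j - ctn j i) 7)
                 else None) (iota 0 7).
Definition next_level (l : seq (seq int)) : seq (seq int) :=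
  undup (flatten (map lower l)).
(* The weights of the minuscule representation [V_{omega_7}], in the order of
   a breadth-first search from the highest one. *)
Definition W56 : seq (seq int) := Eval vm_compute in
  flatten (traject next_level [:: [:: 0; 0; 0; 0; 0; 0; 1]] 28).

(* In a minuscule representation each root vector acts by partial bijections of
   the weight basis.  All signs can be taken to be [+] for the simple roots and,
   as it turns out, also for [beta_1]. *)
Definition rootS (a : seq int) : smx := map (fun w =>
  let u := mkseq (fun j => nth 0 w j - cwS a j) 7 in
  if u \in W56 then [:: (index u W56, 1)] else [::]) W56.
Definition corootS (a : seq int) : smx := map (fun w =>
  [:: (index w W56, sum7 (fun k => nth 0 a k * nth 0 w k))]) W56.

Definition eS : seq smx := Eval vm_compute in mkseq (fun i => rootS (alphaS i)) 7.
Definition fS : seq smx := Eval vm_compute in mkseq (fun i => rootS (map -%R (alphaS i))) 7.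
Definition hwS : seq smx := Eval vm_compute in mkseq (fun i => corootS (alphaS i)) 7.
Definition ebS : seq smx := Eval vm_compute in mkseq (fun i => rootS (betaS i)) 7.
Definition fbS : seq smx := Eval vm_compute in mkseq (fun i => rootS (map -%R (betaS i))) 7.
Definition hbS : seq smx := Eval vm_compute in mkseq (fun i => corootS (betaS i)) 7.
Definition nthm (s : seq smx) i := nth [::] s i.

Definition good (s : seq smx) := all sok s && all (fun A => size A == 56%N) s.
Lemma good_all : [/\ good eS, good fS & good hwS] /\ [/\ good ebS, good fbS & good hbS].
Proof. by split; split; vm_compute. Qed.

Definition chevS (c : nat -> nat -> int) (e f h : seq smx) : bool :=
  all (fun i => all (fun j =>
   [&& seqm (sbr (nthm e i) (nthm f j)) (if i == j then nthm h i else [::]),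
       seqm (sbr (nthm h i) (nthm e j)) (sscale (c i j) (nthm e j)),
       seqm (sbr (nthm h i) (nthm f j)) (sscale (- c i j) (nthm f j)) &
       seqm (sbr (nthm h i) (nthm h j)) [::]]) (iota 0 7)) (iota 0 7).

Lemma chevS_E7 : chevS ctn eS fS hwS.
Proof. by vm_compute. Qed.
Lemma chevS_beta : chevS cbn ebS fbS hbS.
Proof. by vm_compute. Qed.

Definition grow (start : seq smx) (rec : seq (nat * nat)) : seq smx :=
  foldl (fun acc p => rcons acc (snorm (sbr (nthm fbS p.1) (nthm acc p.2)))) start rec.

(* [lieS] lists the negative root vectors of [H]: the [k]-th one, for [k >= 7],
   is the bracket of the [fbS] and the [lieS] entries with indices
   [lie_rec`_(k - 7)]. *)
Definition lie_rec : seq (nat * nat) :=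
  [:: (1, 0); (2, 1); (3, 2); (4, 3); (5, 3); (2, 7); (3, 8); (4, 9); (5, 9);
      (5, 10); (3, 12); (4, 13); (5, 13); (5, 14); (4, 17); (5, 17); (5, 18);
      (3, 20); (5, 21); (3, 23); (3, 25); (2, 26); (2, 27); (1, 29)]%N.
Definition lieS : seq smx := Eval vm_compute in grow fbS lie_rec.

Lemma lieS_ok : all (fun k => let p := nth (0%N, 0%N) lie_rec (k - 7) in
  if (k < 7)%N then nthm lieS k == nthm fbS k else
  [&& (p.1 < 7)%N, (p.2 < k)%N & seqm (nthm lieS k) (sbr (nthm fbS p.1) (nthm lieS p.2))])
  (iota 0 31).
Proof. by vm_compute. Qed.

(* A set of root vectors containing the [e_i] and [f_6] that spans, together
   with the Borel subalgebra opposite to that of [H], a subspace stable under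
   this subalgebra. *)
Definition ellS : seq smx := Eval vm_compute in grow (rcons eS (nthm fS 5))
  [:: (0, 5); (5, 7); (6, 7); (1, 8); (3, 9); (6, 9); (2, 11); (2, 12); (4, 12);
      (6, 12); (3, 14); (1, 15); (4, 15); (6, 15); (6, 16); (4, 18); (4, 19);
      (6, 19); (3, 20); (6, 20); (3, 24); (6, 24); (5, 26); (6, 26); (2, 28);
      (5, 28); (6, 28); (5, 32); (6, 32); (3, 35); (4, 37)]%N.

(** A basis of the Borel subalgebra: 30 negative root vectors of D6, one of A1, and from index 31 on
    the seven coroots. *)
Definition borS : seq smx := lieS ++ hbS.

(* [x xi] for [x] in [ellS], as a signed sum of the [y xi] with [y] in [borS]. *)
Definition certS : seq (seq (int * nat)) :=
  [:: [::]; [::]; [::]; [::]; [:: (-1, 24%N)]; [:: (-1, 6%N)]; [:: (1, 0%N)]; [:: (1, 0%N)];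
      [:: (-1, 32%N)]; [::]; [:: (1, 32%N); (1, 36%N)]; [:: (-1, 1%N)]; [::]; [:: (1, 5%N)];
      [:: (-1, 8%N)]; [::]; [::]; [:: (-1, 11%N)]; [:: (-1, 13%N)]; [:: (-1, 22%N)]; [::];
      [:: (1, 15%N)]; [:: (-1, 16%N)]; [:: (-1, 18%N)]; [:: (-1, 25%N)]; [:: (-1, 19%N)]; [::];
      [:: (1, 20%N)]; [:: (-1, 27%N)]; [:: (-1, 23%N)]; [:: (-1, 0%N)]; [:: (1, 24%N)];
      [:: (-1, 29%N)]; [:: (-1, 7%N)]; [:: (-1, 26%N)]; [:: (-1, 12%N)]; [:: (-1, 28%N)];
      [:: (-1, 17%N)]; [:: (-1, 21%N)]].

Definition delta (k : nat) : seq int := mkseq (fun j => (j == k)%:R) 56.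
Definition comb (s : seq (int * seq int)) : seq int :=
  mkseq (fun j => foldr (fun p t => p.1 * nth 0 p.2 j + t) 0 s) 56.

(** Root vectors for the negatives of [alpha_6 + alpha_7] and of [alpha_2 + alpha_3 + 2 alpha_4 + 2
    alpha_5 + alpha_6 + alpha_7]. These roots are orthogonal, and outside [H] because their
    coefficient on [alpha_6] is odd. Their exponentials applied to [v_0] give [xiS]. *)
Definition x1S : smx := Eval vm_compute in
  snorm (sbr (nthm fS 6) (nthm fS 5)).
Definition x2S : smx := Eval vm_compute in
  foldr (fun i A => snorm (sbr (nthm fS i) A)) (nthm fS 1) [:: 6; 4; 5; 3; 4; 2; 3]%N.
Definition xiS : seq int := Eval vm_compute in
  comb [:: (1, delta 0); (-1, delta 2); (1, delta 12); (1, delta 18)].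

Lemma xiS_ok : [&& sveq (smulv (sadd sone x2S) (smulv (sadd sone x1S) (delta 0))) xiS,
  seqm (smul x1S x1S) [::] & seqm (smul x2S x2S) [::]].
Proof. by vm_compute. Qed.

Lemma good_more : [&& good lieS, good ellS & good [:: x1S; x2S]].
Proof. by vm_compute. Qed.

Lemma cert_ok : all (fun k => sveq (smulv (nthm ellS k) xiS)
    (comb (map (fun p : int * nat => (p.1, smulv (nthm borS p.2) xiS)) (nth [::] certS k))))
  (iota 0 39).
Proof. by vm_compute. Qed.

Definition candS : seq smx := Eval vm_compute in map snorm (ellS ++ borS).
Lemma candSE : candS = map snorm (ellS ++ borS).
Proof. by vm_compute. Qed.

(** A sufficient test by lookup: for these root vectors a bracket is zero or, up to sign, one of the
    listed matrices. *)
Definition in_span (x : smx) : bool :=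
  let y := snorm x in (y == nseq 56 [::]) ||
  has (fun z => (y == z) || (y == sscale (-1) z)) candS.

Lemma ell_fb_ok : all (fun x => all (fun b => in_span (sbr b x)) fbS) ellS.
Proof. by vm_compute. Qed.

Lemma ell_hb_ok : all (fun x => all (fun b =>
  let y := snorm (sbr b x) in
  has (fun c => y == snorm (sscale c x)) [:: 0; 1; -1; 2; -2]) hbS) ellS.
Proof. by vm_compute. Qed.

Lemma star_ok : all (fun i => [&& strm (nthm eS i) (nthm fS i),
  strm (nthm ebS i) (nthm fbS i) & strm (nthm hbS i) (nthm hbS i)]) (iota 0 7).
Proof. by vm_compute. Qed.

(** This is [theta e f 1], with exponentials reduced to [1 + e] and [1 - f] because [e] and [f] have
    square zero. *)
Definition nS (i : nat) : smx := snorm (smul (smul (sadd sone (nthm eS i))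
  (sadd sone (sscale (-1) (nthm fS i)))) (sadd sone (nthm eS i))).
Definition wordS : smx := Eval vm_compute in
  foldr (fun i A => snorm (smul (nS i) A)) sone beta_word.

Lemma square_ok : all (fun i => seqm (smul (nthm eS i) (nthm eS i)) [::]
  && seqm (smul (nthm fS i) (nthm fS i)) [::]) (iota 0 7).
Proof. by vm_compute. Qed.

Lemma good_n : good (map nS (iota 0 7)) && good [:: wordS].
Proof. by vm_compute. Qed.

Lemma beta_word_ok : seqm (smul wordS (nthm eS 6)) (smul (nthm ebS 0) wordS)
  && seqm (smul wordS (nthm fS 6)) (smul (nthm fbS 0) wordS).
Proof. by vm_compute. Qed.

Lemma beta_simple_ok : all (fun i => (i != 0%N) ==>
  (nthm ebS i == nthm eS (bidx i)) && (nthm fbS i == nthm fS (bidx i))) (iota 0 7).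
Proof. by vm_compute. Qed.

(* Highest weight vectors of [H]: [v_0] of weight [lambda_1 + lambda_7], [v_2]
   of weight [lambda_6], and in the tensor square
   [v_0 v_18 + v_18 v_0 - v_1 v_15 - v_15 v_1] of weight [lambda_2]. *)
Definition actb (i k : nat) : seq int := smulv (nthm ebS i) (delta k).
Lemma hw_ok : all (fun i => [&& sveq (actb i 0) [::], sveq (actb i 2) [::],
    sveq (actb i 18) (comb [:: ((i == 0%N)%:R, delta 1); ((i == 6%N)%:R, delta 15)]),
    sveq (actb i 1) (comb [:: ((i == 6%N)%:R, delta 0)])
  & sveq (actb i 15) (comb [:: ((i == 0%N)%:R, delta 0)])]) (iota 0 7).
Proof. by vm_compute. Qed.

Definition hbw (i k : nat) : int := entry (nthm hbS i) k k.
Lemma hbw_ok : all (fun i => all (fun k =>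
    sveq (smulv (nthm hbS i) (delta k)) (comb [:: (hbw i k, delta k)]))
  [:: 0; 1; 2; 15; 18]%N) (iota 0 7).
Proof. by vm_compute. Qed.

Lemma hbw_val : all (fun i => [&& hbw i 0 == nth 0 [:: 1; 0; 0; 0; 0; 0; 1] i,
  hbw i 2 == nth 0 [:: 0; 0; 0; 0; 0; 1; 0] i,
  hbw i 0 + hbw i 18 == nth 0 [:: 0; 1; 0; 0; 0; 0; 0] i &
  hbw i 1 + hbw i 15 == nth 0 [:: 0; 1; 0; 0; 0; 0; 0] i]) (iota 0 7).
Proof. by vm_compute. Qed.

(** Paired with a highest weight vector of weight [m] in the [k]-th power, these relations become
    [m_3 = m_4 = m_5 = 0], [m_1 = m_7] and [m_1 + 2 m_2 + m_6 = k]. *)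
Lemma xi_torus_ok :
  [&& all (fun i => sveq (smulv (nthm hbS i) xiS) [::]) [:: 2; 3; 4]%N,
    sveq (smulv (nthm hbS 0) xiS) (smulv (nthm hbS 6) xiS) &
    sveq (comb [:: (1, smulv (nthm hbS 0) xiS); (2, smulv (nthm hbS 1) xiS);
                   (1, smulv (nthm hbS 5) xiS)]) xiS].
Proof. by vm_compute. Qed.

Lemma e7_hw_ok : all (fun i => sveq (smulv (nthm eS i) (delta 0)) [::] &&
  sveq (smulv (nthm hwS i) (delta 0)) (comb [:: ((i == 6%N)%:R, delta 0)])) (iota 0 7).
Proof. by vm_compute. Qed.

(** * The tables as complex matrices *)

Section Model.
Variable C : numClosedFieldType.
Local Notation mxS := (@mxS C).
Local Notation vS := (@vS C).

Definition e1 (i : 'I_7) := mxS (nthm eS i).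
Definition f1 (i : 'I_7) := mxS (nthm fS i).
Definition h1 (i : 'I_7) := mxS (nthm hwS i).
Definition eb1 (i : 'I_7) := mxS (nthm ebS i).
Definition fb1 (i : 'I_7) := mxS (nthm fbS i).
Definition hb1 (i : 'I_7) := mxS (nthm hbS i).
Definition xi1 := vS xiS.
Definition vb (k : nat) := vS (delta k).

Lemma good_nth s k : good s -> sok (nthm s k) /\ ((k < size s)%N -> size (nthm s k) = 56%N).
Proof.
case/andP => /allP s1 /allP s2; case: (ltnP k (size s)) => ks; last first.
  by rewrite /nthm nth_default.
by split=> [|_]; [apply: s1 | apply/eqP; apply: s2]; apply: mem_nth.
Qed.

Lemma mxS_nil : mxS [::] = 0.
Proof. by apply/matrixP => i j; rewrite !mxE /entry nth_nil. Qed.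
Lemma vS_nil : vS [::] = 0.
Proof. by apply/colP => i; rewrite !mxE nth_nil. Qed.

Lemma vS_comb s : vS (comb s) = \sum_(p <- s) p.1%:~R *: vS p.2.
Proof.
apply/colP => i; rewrite summxE mxE nth_mkseq //.
elim: s => [|p s IH]; first by rewrite big_nil.
by rewrite big_cons -IH /= rmorphD rmorphM !mxE.
Qed.

Lemma chevS_chev (c : nat -> nat -> int) (cc : 'I_7 -> 'I_7 -> int) e f h :
  (forall i j : 'I_7, cc i j = c i j) ->
  good e -> good f -> good h -> chevS c e f h ->
  chev cc (fun i => mxS (nthm e i)) (fun i => mxS (nthm f i)) (fun i => mxS (nthm h i)).
Proof.
move=> ccE ge gf gh /forall_ord2 H.
have oe k := (good_nth k ge).1; have of' k := (good_nth k gf).1.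
have oh k := (good_nth k gh).1.
by split=> i j; have /and4P[h1 h2 h3 h4] := H i j;
  rewrite -mxS_br ?(mxS_eq _ h1) ?(mxS_eq _ h2) ?(mxS_eq _ h3) ?(mxS_eq _ h4) //
    ?mxS_scale ?rmorphN ?ccE //; [rewrite (inj_eq val_inj); case: eqP => // _|];
  exact: mxS_nil.
Qed.

Lemma model_chev : chev (fun i j => cartanE7 i j) e1 f1 h1.
Proof.
have [[g1 g2 g3] _] := good_all.
exact: (chevS_chev cartanE g1 g2 g3 chevS_E7).
Qed.

Lemma model_chev_beta : chev cartanB eb1 fb1 hb1.
Proof.
have [_ [g1 g2 g3]] := good_all.
exact: (chevS_chev cartanBE g1 g2 g3 chevS_beta).
Qed.

Lemma model_star i : [/\ adjm (e1 i) = f1 i, adjm (eb1 i) = fb1 i & adjm (hb1 i) = hb1 i].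
Proof. by have /and3P[s1 s2 s3] := forall_ord star_ok i; split; apply: mxS_tr. Qed.

Lemma exp_square n (A : 'M[C]_n) c : A *m A = 0 ->
  nilmx A /\ exp_nilp (c *: A) = 1%:M + c *: A.
Proof.
move=> A2; have A2' : A ^+ 2 = 0 by rewrite expr2.
split; first by exists 2%N.
rewrite (exp_nilpE (N := 2) (M := 2)) ?mxexprZ ?A2' ?scaler0 //.
by rewrite !big_ord_recl big_ord0 addr0 /= /bump /= expk1 /expk expr0 fact0 invr1 scale1r.
Qed.

Lemma model_square i : e1 i *m e1 i = 0 /\ f1 i *m f1 i = 0.
Proof.
have [[g1 g2 _] _] := good_all.
have /andP[s1 s2] := forall_ord square_ok i.
by rewrite /e1 /f1 -!mxS_mul ?(mxS_eq _ s1) ?(mxS_eq _ s2);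
  [split; apply: mxS_nil | exact: (good_nth _ g2).1 | exact: (good_nth _ g1).1].
Qed.

Lemma sok_one_add A : sok A -> sok (sadd sone A).
Proof.
move=> okA; rewrite /sok /sadd all_map; apply/allP => i; rewrite mem_iota => /= i56.
rewrite all_cat nth_mkseq //= i56 /=.
by case: (ltnP i (size A)) => iA; [apply: (allP okA); apply: mem_nth | rewrite nth_default].
Qed.

Lemma sok_scale c A : sok A -> sok (sscale c A).
Proof.
move=> /allP okA; rewrite /sok /sscale all_map; apply/allP => r /okA /= ok.
by rewrite all_map.
Qed.

Lemma sok_add A B : sok A -> sok B -> sok (sadd A B).
Proof.
move=> okA okB; rewrite /sok /sadd all_map; apply/allP => i _ /=.
have nthok D : sok D -> all (fun p : nat * int => (p.1 < 56)%N) (nth [::] D i).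
  move=> okD; case: (ltnP i (size D)) => iD; last by rewrite nth_default.
  by apply: (allP okD); apply: mem_nth.
by rewrite all_cat !nthok.
Qed.

Lemma sok_mul A B : sok A -> sok B -> sok (smul A B).
Proof.
move=> /allP oA /allP oB; rewrite /sok /smul all_map; apply/allP => r rA /=.
elim: r {rA} => //= p r IH; rewrite all_cat IH andbT all_map.
case: (ltnP p.1 (size B)) => pB; last by rewrite nth_default.
by apply: oB; apply: mem_nth.
Qed.

Lemma sok_norm A : sok A -> sok (snorm A).
Proof.
move=> /allP okA; rewrite /sok /snorm all_map; apply/allP => r /okA /allP ok /=.
apply/allP => p; rewrite mem_filter => /andP[_ /mapP[j]]; rewrite mem_undup.
by move=> /mapP[q qr ->] -> /=; apply: ok.
Qed.

Lemma model_theta (i : 'I_7) : theta (e1 i) (f1 i) 1 = mxS (nS i).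
Proof.
have [[g1 g2 _] _] := good_all.
have oe := (good_nth i g1).1; have of' := (good_nth i g2).1.
have [s1 s2] := model_square i.
have [_ E1] := exp_square 1 s1; have [_ E2] := exp_square (- 1^-1) s2.
rewrite /theta E1 E2 mxS_norm.
have o1 := sok_one_add oe; have o2 := sok_one_add (sok_scale (-1) of').
rewrite (mxS_mul _ _ (sok_mul o1 o2)) (mxS_mul _ _ o1).
rewrite !mxS_add mxS_one mxS_scale -/(e1 i) -/(f1 i) scale1r invr1.
by rewrite rmorphN1.
Qed.

Lemma model_word : wmx e1 f1 beta_word = mxS wordS.
Proof.
have /andP[gn _] := good_n.
set f := fun i A => snorm (smul (nS i) A).
have step w : all (fun i => (i < 7)%N) w -> wmx e1 f1 w = mxS (foldr f sone w).
  elim: w => [|i w IH] => [_|]; first by rewrite wmx_nil; apply/esym/mxS_one.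
  rewrite [all _ _]/((i < 7)%N && all (fun i => (i < 7)%N) w) => /andP[i7 w7].
  rewrite wmx_cons (IH w7) model_theta (inordK i7).
  have -> : foldr f sone (i :: w) = snorm (smul (nS i) (foldr f sone w)) by exact: erefl.
  have oi : sok (nS i).
    have := (good_nth i gn).1; have si : (i < size (iota 0 7))%N by rewrite size_iota.
    by rewrite /nthm (nth_map 0%N [::] nS si) (nth_iota 0 0 i7).
  by rewrite mxS_norm (mxS_mul _ _ oi).
have -> : wordS = foldr f sone beta_word by vm_compute.
exact: step.
Qed.

Lemma model_wordP : wmx e1 f1 beta_word \in unitmx.
Proof.
have S i := chev_sl2 cartan_diag model_chev i.
elim: beta_word => [|i w IH]; first by rewrite wmx_nil unitmx1.
by rewrite wmx_cons unitmx_mul (theta_unit (S _)).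
Qed.

Lemma model_Ebm i : Ebm e1 f1 e1 i = eb1 i /\ Ebm e1 f1 f1 i = fb1 i.
Proof.
rewrite /Ebm; case: eqP => [-> | /eqP i0]; last first.
  have /implyP/(_ i0)/andP[/eqP h1 /eqP h2] := forall_ord beta_simple_ok i.
  by rewrite /e1 /f1 /eb1 /fb1 h1 h2.
have [_ [g1 g2 _]] := good_all.
have /andP[_ gw0] := good_n; have gw := (good_nth 0 gw0).1.
have /andP[b1 b2] := beta_word_ok.
have u := model_wordP.
have key A B : sok B -> seqm (smul wordS A) (smul B wordS) ->
    wmx e1 f1 beta_word *m mxS A *m invmx (wmx e1 f1 beta_word) = mxS B.
  move=> oB AB; apply: (can_inj (mulmxK u)); rewrite (mulmxKV u) model_word.
  by rewrite -(mxS_mul _ _ gw) -(mxS_mul _ _ oB); apply: mxS_eq.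
have i6 : val (inord 6 : 'I_7) = 6%N by apply: inordK.
split; rewrite /e1 /f1 i6; apply: key.
- exact: (good_nth _ g1).1.
- exact: b1.
- exact: (good_nth _ g2).1.
- exact: b2.
Qed.

(* The tables are now used only through the lemmas above; this keeps conversion from evaluating
   them. *)
Opaque sok good seqm sveq smul sadd sscale snorm smulv comb delta sone mkseq.

Lemma sbr_norm_mx A B : sok A -> sok B ->
  mxS (snorm (sbr A B)) = bracket (mxS A) (mxS B).
Proof. by move=> oA oB; rewrite mxS_norm (mxS_br _ oA oB). Qed.

Lemma model_xi : exists x1 x2 : 'M[C]_56,
  [/\ lie_generated (fun Y => exists i, Y = f1 i) x1, x1 *m x1 = 0,
      lie_generated (fun Y => exists i, Y = f1 i) x2, x2 *m x2 = 0
    & xi1 = exp_nilp x2 *m (exp_nilp x1 *m vb 0)].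
Proof.
have [[_ g2 _] _] := good_all.
have /and3P[v1 s1 s2] := xiS_ok; have /and3P[_ _ gx] := good_more.
have k1 : sok x1S := (good_nth 0 gx).1; have k2 : sok x2S := (good_nth 1 gx).1.
have ofS i := (good_nth i g2).1.
pose P Y := lie_generated (fun Y => exists i, Y = f1 i) Y.
have gen (i : 'I_7) : P (f1 i) by apply: LieIn; exists i.
have brg (i : 'I_7) A : sok A -> P (mxS A) -> P (mxS (snorm (sbr (nthm fS i) A))).
  move=> oA lA; rewrite (sbr_norm_mx (ofS i) oA).
  exact: LieBracket (gen i) lA.
have sq A : sok A -> seqm (smul A A) [::] -> mxS A *m mxS A = 0.
  by move=> oA /(mxS_eq C) e; rewrite -[LHS](mxS_mul _ _ oA) e; apply: mxS_nil.
have p1 : P (mxS x1S).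
  have -> : x1S = snorm (sbr (nthm fS (inord 6 : 'I_7)) (nthm fS (inord 5 : 'I_7))).
    by rewrite !inordK //; vm_compute.
  apply: brg; [exact: ofS | exact: gen].
have p2 : P (mxS x2S).
  have word w A : sok A -> P (mxS A) -> let B := foldr (fun (i : 'I_7) B =>
      snorm (sbr (nthm fS i) B)) A w in sok B /\ P (mxS B).
    move=> oA pA; elim: w => [|i w [oB pB]]; first by split.
    split; last exact: brg.
    apply: sok_norm; apply: sok_add; first by apply: sok_mul => //; apply: ofS.
    by apply: sok_scale; apply: sok_mul => //; apply: ofS.
  have [_] := word (map (fun i => inord i) [:: 6; 4; 5; 3; 4; 2; 3]%N) _
    (ofS (inord 1 : 'I_7)) (gen _).
  congr (P (mxS _)); rewrite /= !inordK //; exact: (erefl x2S).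
exists (mxS x1S), (mxS x2S); split; [exact: p1 | exact: sq | exact: p2 | exact: sq |].
have e A : sok A -> seqm (smul A A) [::] -> exp_nilp (mxS A) = mxS (sadd sone A).
  move=> oA sA; have [_] := exp_square 1 (sq A oA sA); rewrite scale1r => ->.
  by rewrite mxS_add mxS_one.
have sz A : size (sadd sone A) = 56%N by apply: size_mkseq.
rewrite (e _ k1 s1) (e _ k2 s2) /xi1 /vb.
rewrite (mxS_v _ _ (sok_one_add k1) (sz _)) (mxS_v _ _ (sok_one_add k2) (sz _)).
by apply/esym; apply: vS_eq v1.
Qed.

Definition Bl := lie_generated (fun Y => exists i, Y = fb1 i \/ Y = hb1 i).
Definition Ll Y := exists2 k, (k < 39)%N & Y = mxS (nthm ellS k).

Lemma Bl_fb i : Bl (fb1 i). Proof. by apply: LieIn; exists i; left. Qed.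
Lemma Bl_hb i : Bl (hb1 i). Proof. by apply: LieIn; exists i; right. Qed.

Lemma Bl_lie k : (k < 31)%N -> Bl (mxS (nthm lieS k)).
Proof.
have [m] := ubnP k; elim: m k => // m IH k km k31.
have [_ [_ g2 _]] := good_all; have /and3P[gl _ _] := good_more.
have := @forall_ord 31 _ lieS_ok (Ordinal k31).
rewrite -[nat_of_ord (Ordinal k31)]/k; case: (ltnP k 7) => [k7 /eqP -> | k7].
  exact: (Bl_fb (Ordinal k7)).
case/and3P; set p := nth _ lie_rec _ => p7 pk /(mxS_eq C).
rewrite (mxS_br C (good_nth p.1 g2).1 (good_nth p.2 gl).1) => ->.
apply: LieBracket; first exact: (Bl_fb (Ordinal p7)).
by apply: IH; lia.
Qed.

Lemma borS_size : size lieS = 31%N /\ size borS = 38%N.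
Proof. by []. Qed.

Lemma Bl_bor k : Bl (mxS (nthm borS k)).
Proof.
have [s1 s2] := borS_size.
case: (ltnP k 38) => k38; last first.
  rewrite /nthm nth_default ?s2 // mxS_nil -(scale0r (fb1 0)).
  apply: LieScale; exact: Bl_fb.
rewrite /nthm /borS nth_cat s1; case: ltnP => k31; first exact: Bl_lie.
have k7 : (k - 31 < 7)%N by lia.
exact: (Bl_hb (Ordinal k7)).
Qed.

Lemma Bl_lin : lin Bl.
Proof.
split; first by rewrite -(scale0r (fb1 0)); apply: LieScale; apply: Bl_fb.
by move=> c x y bx b_y; apply: LieAdd => //; apply: LieScale.
Qed.

Lemma Ll_bracket_fb x (b : 'I_7) : Ll x ->
  lspan (fun z => Ll z \/ Bl z) (bracket (fb1 b) x).
Proof.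
move=> [k k39 ->]; have [_ [_ g2 _]] := good_all; have /and3P[_ ge _] := good_more.
have szf : size fbS = 7%N by []. have sze : size ellS = 39%N by [].
have sp : in_span (sbr (nthm fbS b) (nthm ellS k)).
  have /allP/(_ (nthm ellS k)) := ell_fb_ok.
  rewrite mem_nth ?sze // => /(_ isT)/allP/(_ (nthm fbS b)).
  by rewrite mem_nth ?szf //; apply.
rewrite /fb1 -(mxS_br C (good_nth b g2).1 (good_nth k ge).1).
move: sp; rewrite /in_span; set y := snorm _; rewrite -(mxS_norm C) -/y.
case/orP => [/eqP -> | /hasP[z]].
  have -> : mxS (nseq 56 [::]) = 0.
    by apply/matrixP => i j; rewrite !mxE /entry nth_nseq; case: ifP.
  exact: Span0.
rewrite candSE => /mapP[t tin ->].
have Lt : lspan (fun z => Ll z \/ Bl z) (mxS (snorm t)).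
  rewrite mxS_norm; apply: lspan_gen; move: tin; rewrite mem_cat.
  case/orP => /(nthP [::])[q qs <-]; first by left; exists q => //; rewrite -sze.
  by right; apply: Bl_bor.
case/orP => /eqP ->; first exact: Lt.
by rewrite mxS_scale; apply: linZ => //; apply: lspan_lin.
Qed.

Lemma Ll_bracket_hb x (b : 'I_7) : Ll x -> exists c, bracket (hb1 b) x = c *: x.
Proof.
move=> [k k39 ->]; have [_ [_ _ g3]] := good_all; have /and3P[_ ge _] := good_more.
have szh : size hbS = 7%N by []. have sze : size ellS = 39%N by [].
have /allP/(_ (nthm ellS k)) := ell_hb_ok.
rewrite mem_nth ?sze // => /(_ isT)/allP/(_ (nthm hbS b)).
rewrite mem_nth ?szh // => /(_ isT)/hasP[c _ /eqP e]; exists c%:~R.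
rewrite /hb1 -(sbr_norm_mx (good_nth b g3).1 (good_nth k ge).1) e.
by rewrite mxS_norm mxS_scale.
Qed.

Lemma Ll_xi x : Ll x -> exists2 y, Bl y & x *m xi1 = y *m xi1.
Proof.
move=> [k k39 ->]; have /and3P[gl ge _] := good_more; have [_ [_ _ g3]] := good_all.
have gb q : sok (nthm borS q) /\ ((q < size borS)%N -> size (nthm borS q) = 56%N).
  have [s1 s2] := borS_size; rewrite s2 /nthm /borS nth_cat s1.
  case: ltnP => q31.
    by have [o1 o2] := good_nth q gl; split=> // _; apply: o2; rewrite s1.
  have [o1 o2] := good_nth (q - 31) g3; split=> // q38; apply: o2.
  by have -> : size hbS = 7%N by []; lia.
have szx : size (nthm ellS k) = 56%N by apply: (good_nth k ge).2.
have := @forall_ord 39 _ cert_ok (Ordinal k39); rewrite -[nat_of_ord (Ordinal k39)]/k.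
have cert_lt : all (fun k => all (fun p : int * nat => (p.2 < 38)%N) (nth [::] certS k))
  (iota 0 39) by [].
have := @forall_ord 39 _ cert_lt (Ordinal k39); rewrite -[nat_of_ord (Ordinal k39)]/k.
set s := nth _ certS k => s38 /(vS_eq C) e0.
have := etrans e0 (vS_comb _); rewrite big_map => e.
exists (\sum_(p <- s) p.1%:~R *: mxS (nthm borS p.2)).
  by apply: lin_sum => [|p _]; [exact: Bl_lin | apply: LieScale; apply: Bl_bor].
rewrite /xi1   (mxS_v _ _ (good_nth k ge).1 szx) e mulmx_suml.
apply: eq_big_seq => p ps; have p38 := allP s38 p ps.
have [o1 o2] := gb p.2.
by rewrite -scalemxAl; congr (_ *: _); apply/esym/(mxS_v _ _ o1 (o2 p38)).
Qed.

Lemma Ll_e i : Ll (e1 i).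
Proof.
exists i; first by apply: leq_trans (ltn_ord i) _.
have : all (fun i => nthm eS i == nthm ellS i) (iota 0 7) by vm_compute.
by move=> /forall_ord/(_ i)/eqP e; rewrite /e1 e.
Qed.

(** All simple roots of G but [alpha_6] (index 5) are simple roots of [H]; [f_6] is the entry 7 of
    [ellS]. *)
Lemma LB_f i : Ll (f1 i) \/ Bl (f1 i).
Proof.
have [i5 | i5] := eqVneq (i : nat) 5%N.
  left; exists 7%N => //; rewrite /f1 i5.
  have -> : nthm ellS 7 = nthm fS 5 by vm_compute.
  by [].
right; have ok : all (fun i => (i != 5%N) ==> has (fun b => nthm fS i == nthm fbS b) (iota 0 7))
  (iota 0 7) by vm_compute.
have /implyP/(_ i5)/hasP[b] := forall_ord ok i.
rewrite mem_iota => b7 /eqP e; rewrite /f1 e; exact: (Bl_fb (Ordinal b7)).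
Qed.

Lemma mxS_vb A k : sok A -> size A = 56%N -> mxS A *m vb k = vS (smulv A (delta k)).
Proof. exact: mxS_v. Qed.

Lemma eb_vb (i : 'I_7) k v : sveq (actb i k) v -> eb1 i *m vb k = vS v.
Proof.
have [_ [g1 _ _]] := good_all; have [o1 o2] := good_nth i g1.
by move=> /(vS_eq C) e; rewrite -[RHS]e; apply: mxS_vb o1 (o2 (ltn_ord i)).
Qed.

Lemma model_hw (i : 'I_7) : [/\ eb1 i *m vb 0 = 0, eb1 i *m vb 2 = 0,
    eb1 i *m vb 18 = (i == 0 :> nat)%:R *: vb 1 + (i == 6%N :> nat)%:R *: vb 15,
    eb1 i *m vb 1 = (i == 6%N :> nat)%:R *: vb 0
  & eb1 i *m vb 15 = (i == 0 :> nat)%:R *: vb 0].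
Proof.
have /and5P[h1 h2 h3 h4 h5] := forall_ord hw_ok i.
split.
- by rewrite (eb_vb h1) vS_nil.
- by rewrite (eb_vb h2) vS_nil.
- rewrite (eb_vb h3) [LHS]vS_comb !big_cons big_nil addr0 /=.
  by congr (_ *: _ + _ *: _); case: (_ == _).
- by rewrite (eb_vb h4) [LHS]vS_comb !big_cons big_nil addr0 /=; congr (_ *: _); case: (_ == _).
- by rewrite (eb_vb h5) [LHS]vS_comb !big_cons big_nil addr0 /=; congr (_ *: _); case: (_ == _).
Qed.

Lemma model_hb (i : 'I_7) k : k \in [:: 0; 1; 2; 15; 18]%N ->
  hb1 i *m vb k = (hbw i k)%:~R *: vb k.
Proof.
have [_ [_ _ g3]] := good_all; have [o1 o2] := good_nth i g3.
move=> kin; have /allP/(_ k kin)/(vS_eq C) e0 := forall_ord hbw_ok i.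
have := etrans e0 (vS_comb _); rewrite big_cons big_nil addr0 => e; rewrite -[RHS]e.
exact: mxS_vb o1 (o2 (ltn_ord i)).
Qed.

Lemma model_torus (i : 'I_7) : ((i : nat) \in [:: 2; 3; 4]%N -> hb1 i *m xi1 = 0) /\
  (hb1 0 *m xi1 = hb1 (inord 6) *m xi1) /\
  hb1 0 *m xi1 + 2 *: (hb1 (inord 1) *m xi1) + hb1 (inord 5) *m xi1 = xi1.
Proof.
have [_ [_ _ g3]] := good_all.
have hE (j : 'I_7) : hb1 j *m xi1 = vS (smulv (nthm hbS j) xiS).
  by have [o1 o2] := good_nth j g3; apply: mxS_v o1 (o2 (ltn_ord j)).
have /and3P[t1 t2 t3] := xi_torus_ok.
split; first by move=> iin; rewrite hE; apply: etrans (vS_eq C (allP t1 _ iin)) vS_nil.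
have i6 : val (inord 6 : 'I_7) = 6%N by apply: inordK.
have i1 : val (inord 1 : 'I_7) = 1%N by apply: inordK.
have i5 : val (inord 5 : 'I_7) = 5%N by apply: inordK.
split; rewrite !hE ?i6 ?i1 ?i5; first exact: (vS_eq C t2).
rewrite -[RHS](vS_eq C t3) [RHS]vS_comb !big_cons big_nil addr0 /=.
by rewrite !scale1r addrA.
Qed.

Lemma model_e7_hw (i : 'I_7) : e1 i *m vb 0 = 0 /\
  h1 i *m vb 0 = (weightE7 1 i)%:R *: vb 0.
Proof.
have [[g1 _ g3] _] := good_all.
have [o1 o2] := good_nth i g1; have [o3 o4] := good_nth i g3.
have z2 := o2 (ltn_ord i); have z4 := o4 (ltn_ord i).
have /andP[s1 s2] := forall_ord e7_hw_ok i; split.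
  exact: etrans (mxS_v _ _ o1 z2) (etrans (vS_eq C s1) vS_nil).
rewrite [LHS](mxS_v _ _ o3 z4) [LHS](vS_eq C s2) [LHS]vS_comb big_cons big_nil addr0 /=.
congr (_ *: _); rewrite /weightE7; move: {s1 s2 o1 o2 o3 o4 z2 z4} i.
by case=> -[|[|[|[|[|[|[|i]]]]]]] i7.
Qed.

Lemma dot_xi k : (k < 56)%N -> dot xi1 (vb k) = (nth 0 xiS k)%:~R.
Proof.
move=> k56; rewrite dotE (bigD1 (Ordinal k56)) //= big1 ?addr0 => [|i ik].
  by rewrite !mxE rmorph_int nth_mkseq // eqxx mulr1.
have -> : vb k i 0 = 0; last by rewrite mulr0.
rewrite mxE nth_mkseq //; case: eqP => // e.
by case/eqP: ik; apply: val_inj.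
Qed.

Lemma vb0_neq0 : vb 0 != 0.
Proof.
apply/eqP => /colP/(_ (Ordinal (isT : (0 < 56)%N))); rewrite !mxE nth_mkseq //=.
by move/eqP; rewrite oner_eq0.
Qed.

End Model.

(** * Tensor powers: derivations, group elements and pure powers *)

Section TensorPowers.
Variables (C : numClosedFieldType) (N : nat).

(** [N ^ k] in the shape produced by [*t], so that dimensions agree by conversion. *)
Fixpoint dk (k : nat) : nat := if k is k'.+1 then (dk k' * N)%N else 1%N.

Fixpoint Dk (k : nat) (A : 'M[C]_N) : 'M[C]_(dk k) :=
  match k return 'M[C]_(dk k) with
  | 0 => 0
  | k'.+1 => Dk k' A *t 1%:M + 1%:M *t A
  end.
Fixpoint Tk (k : nat) (g : 'M[C]_N) : 'M[C]_(dk k) :=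
  match k return 'M[C]_(dk k) with
  | 0 => 1%:M
  | k'.+1 => Tk k' g *t g
  end.
Fixpoint pk (k : nat) (x : 'cV[C]_N) : 'cV[C]_(dk k) :=
  match k return 'cV[C]_(dk k) with
  | 0 => 1%:M
  | k'.+1 => tensv (pk k' x) x
  end.

Lemma Dk_lin k c A B : Dk k (c *: A + B) = c *: Dk k A + Dk k B.
Proof.
elim: k => [|k IH] /=; first by rewrite scaler0 addr0.
by rewrite IH tensDl tensDr tensZl tensZr scalerDr addrACA.
Qed.

Lemma Dk0 k : Dk k 0 = 0.
Proof. by have := Dk_lin k (-1) 0 0; rewrite scaler0 addr0 scaleN1r addNr. Qed.

Lemma DkZ k c A : Dk k (c *: A) = c *: Dk k A.
Proof. by have := Dk_lin k c A 0; rewrite Dk0 !addr0. Qed.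

Lemma DkD k A B : Dk k (A + B) = Dk k A + Dk k B.
Proof. by have := Dk_lin k 1 A B; rewrite !scale1r. Qed.

Lemma Dk_bracket k A B : Dk k (bracket A B) = bracket (Dk k A) (Dk k B).
Proof.
elim: k => [|k IH] /=; first by rewrite /bracket mulmx0 subr0.
rewrite bracketDl !bracketDr bracket_tl bracket_tr bracket_tlr bracket_trl.
by rewrite addr0 add0r IH.
Qed.

Lemma Dk_adj k A : adjm (Dk k A) = Dk k (adjm A).
Proof.
elim: k => [|k IH] /=; first by apply/matrixP => i j; rewrite !mxE conjC0.
by rewrite adjmD !adjmT IH !adjm1.
Qed.

Lemma Tk_mul k g h : Tk k (g *m h) = Tk k g *m Tk k h.
Proof.
elim: k => [|k IH] /=; first by rewrite mulmx1.
by rewrite IH tensmx_mul.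
Qed.

Lemma Tk_1 k : Tk k 1%:M = 1%:M.
Proof. by elim: k => [|k IH] //=; rewrite IH tens11. Qed.

Lemma Tk_Dk k g A B : g *m A = B *m g -> Tk k g *m Dk k A = Dk k B *m Tk k g.
Proof.
move=> gA; elim: k => [|k IH] /=; first by rewrite mulmx0 mul0mx.
by rewrite mulmxDr mulmxDl !tensmx_mul !mulmx1 !mul1mx IH gA.
Qed.

Lemma tens1_pow d d' (X : 'M[C]_d) m : (X *t (1%:M : 'M_d')) ^+ m = X ^+ m *t 1%:M.
Proof.
elim: m => [|m IH]; first by rewrite !expr0; apply/esym/tens11.
by rewrite !exprS IH -!mulmxE tensmx_mul mulmx1.
Qed.

Lemma tensr_pow d d' (X : 'M[C]_d') m : ((1%:M : 'M_d) *t X) ^+ m = 1%:M *t X ^+ m.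
Proof.
elim: m => [|m IH]; first by rewrite !expr0; apply/esym/tens11.
by rewrite !exprS IH -!mulmxE tensmx_mul mulmx1.
Qed.

Lemma exp_tensl d d' (X : 'M[C]_d) : nilmx X ->
  nilmx (X *t (1%:M : 'M_d')) /\ exp_nilp (X *t (1%:M : 'M_d')) = exp_nilp X *t 1%:M.
Proof.
move=> [M XM]; have XM' : (X *t (1%:M : 'M_d')) ^+ M = 0 by rewrite tens1_pow XM tens0mx.
split; first by exists M.
rewrite (exp_nilpE XM' (leqnn M)) (exp_nilpE XM (leqnn M)).
rewrite (big_morph (fun Y => Y *t (1%:M : 'M_d')) (fun x y => tensDl x y _) (tens0mx _)).
by apply: eq_bigr => k _; rewrite /expk tens1_pow tensZl.
Qed.

Lemma exp_tensr d d' (X : 'M[C]_d') : nilmx X ->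
  nilmx ((1%:M : 'M_d) *t X) /\ exp_nilp ((1%:M : 'M_d) *t X) = 1%:M *t exp_nilp X.
Proof.
move=> [M XM]; have XM' : ((1%:M : 'M_d) *t X) ^+ M = 0 by rewrite tensr_pow XM tensmx0.
split; first by exists M.
rewrite (exp_nilpE XM' (leqnn M)) (exp_nilpE XM (leqnn M)).
rewrite (big_morph (fun Y => (1%:M : 'M_d) *t Y) (fun x y => tensDr _ x y) (tensmx0 _)).
by apply: eq_bigr => k _; rewrite /expk tensr_pow tensZr.
Qed.

Lemma Dk_exp k A : nilmx A -> nilmx (Dk k A) /\ exp_nilp (Dk k A) = Tk k (exp_nilp A).
Proof.
move=> nA; elim: k => [|k [nk ek]] /=.
  by split; [exact: nilmx0 | exact: exp0].
have [n1 e1] := exp_tensl N nk; have [n2 e2] := exp_tensr (dk k) nA.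
have com : GRing.comm (Dk k A *t (1%:M : 'M_N)) (1%:M *t A).
  by rewrite /GRing.comm -!mulmxE !tensmx_mul !mulmx1 !mul1mx.
split; first exact: nilmxD.
by rewrite expD // e1 e2 -mulmxE tensmx_mul mulmx1 mul1mx ek.
Qed.

Lemma Tk_pk k g x : Tk k g *m pk k x = pk k (g *m x).
Proof.
elim: k => [|k IH] /=; first by rewrite mulmx1.
by rewrite tensv_mul IH.
Qed.

Lemma Dk_tensv k A (u : 'cV[C]_(dk k)) x :
  Dk k.+1 A *m tensv u x = tensv (Dk k A *m u) x + tensv u (A *m x).
Proof. by rewrite /= mulmxDl !tensv_mul !mul1mx. Qed.

(** This passes the certificates at [xi] from the 56-dimensional representation to all its tensor
    powers. *)
Lemma Dk_pk k A B x : A *m x = B *m x -> Dk k A *m pk k x = Dk k B *m pk k x.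
Proof.
move=> AB; elim: k => [|k IH] //=.
by have := Dk_tensv; rewrite /= => H; rewrite !H IH AB.
Qed.

Lemma Dk_pk_eigen k A x c : A *m x = c *: x -> Dk k A *m pk k x = (k%:R * c) *: pk k x.
Proof.
move=> Ax; elim: k => [|k IH]; first by rewrite mul0mx mul0r scale0r.
rewrite [pk k.+1 x]/(tensv (pk k x) x) Dk_tensv IH Ax /tensv tensZl tensZr -scalerDl.
by congr (_ *: _); rewrite -nat1r mulrDl mul1r addrC.
Qed.

Lemma Dk_pk0 k A x : A *m x = 0 -> Dk k A *m pk k x = 0.
Proof.
by move=> Ax; rewrite (@Dk_pk_eigen k A x 0) ?Ax ?scale0r // mulr0 scale0r.
Qed.

Lemma dot_tensv d d' (x x' : 'cV[C]_d) (y y' : 'cV[C]_d') :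
  dot (tensv x y) (tensv x' y') = dot x x' * dot y y'.
Proof.
rewrite !dotE (reindex (@mxtens_index d d')) /=; last first.
  by exists (@mxtens_unindex d d') => k _; rewrite ?mxtens_indexK ?mxtens_unindexK.
rewrite mulr_suml; under [RHS]eq_bigr do rewrite mulr_sumr.
rewrite pair_bigA /=; apply: eq_bigr => -[i j] _.
by rewrite !tensvE rmorphM /=; ring.
Qed.

Lemma tensv_neq0 d d' (x : 'cV[C]_d) (y : 'cV[C]_d') : x != 0 -> y != 0 -> tensv x y != 0.
Proof.
move=> x0 y0; apply/eqP => e; have := dot_tensv x x y y; rewrite e dot0r.
move/esym/eqP; rewrite mulf_eq0 => /orP[/eqP/dot_eq0 z|/eqP/dot_eq0 z].
  by rewrite z eqxx in x0.
by rewrite z eqxx in y0.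
Qed.

Lemma pk_neq0 k x : x != 0 -> pk k x != 0.
Proof.
move=> x0; elim: k => [|k IH] /=; last exact: tensv_neq0.
by apply/eqP => /matrixP/(_ 0 0)/eqP; rewrite !mxE oner_eq0.
Qed.

End TensorPowers.

Lemma stable_exp (F : numFieldType) d (S : 'cV[F]_d -> Prop) (Y : 'M[F]_d) : lin S ->
  nilmx Y -> (forall x, S x -> S (Y *m x)) -> forall x, S x -> S (exp_nilp Y *m x).
Proof.
move=> Sl [M YM] SY x Sx; rewrite (exp_nilpE YM (leqnn M)).
rewrite mulmx_suml; apply: lin_sum => // k _; rewrite /expk.
rewrite -scalemxAl; apply: linZ => //.
elim: (nat_of_ord k) => [|j IH]; first by rewrite mul1mx.
by rewrite exprS -mulmxE -mulmxA; apply: SY.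
Qed.

(* Twice the coordinates of the half sum of positive coroots on the simple
   coroots. *)
Definition rhoE7 : seq int := [:: 34; 49; 66; 96; 75; 52; 27].
Definition rhoB : seq int := [:: 10; 18; 24; 28; 15; 15; 1].

Definition hcoef (F : numFieldType) (s : seq int) (i : nat) : F := (nth 0 s i)%:~R / 2.

Lemma hcoef_sum (F : numFieldType) n (s : seq int) (a : 'I_n -> int) :
  \sum_(i < n) nth 0 s i * a i = 2 -> \sum_(i < n) hcoef F s i * (a i)%:~R = 1.
Proof.
move=> H; have two0 : (2 : F) != 0 by rewrite pnatr_eq0.
apply: (mulfI two0); rewrite mulr_sumr mulr1 -[RHS](_ : 2%:~R = 2) // -H rmorph_sum.
by apply: eq_bigr => i _; rewrite rmorphM /hcoef; field.
Qed.

Lemma grading_E7 (F : numFieldType) j :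
  \sum_i hcoef F rhoE7 (i : 'I_7) * (cartanE7 i j)%:~R = 1.
Proof.
apply: hcoef_sum; under eq_bigr do rewrite cartanE.
rewrite (sum7E (fun i => nth 0 rhoE7 i * ctn i j)); apply/eqP; move: j.
by apply: (@forall_ord 7 (fun j => sum7 (fun i => nth 0 rhoE7 i * ctn i j) == 2)).
Qed.

Lemma grading_B (F : numFieldType) j :
  \sum_i hcoef F rhoB (i : 'I_7) * (cartanB i j)%:~R = 1.
Proof.
apply: hcoef_sum; under eq_bigr do rewrite cartanBE.
rewrite (sum7E (fun i => nth 0 rhoB i * cbn i j)); apply/eqP; move: j.
by apply: (@forall_ord 7 (fun j => sum7 (fun i => nth 0 rhoB i * cbn i j) == 2)); vm_compute.
Qed.

(** The weights of both factors in one list; the last entry is the multiple of [lambda_7]. *)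
Definition wB (a1 a2 a3 : nat) (i : 'I_7) : nat := nth 0%N [:: a1; a2; 0; 0; 0; a3; a1]%N i.

Lemma chev_Dk (C : numClosedFieldType) N r (aa : 'I_r -> 'I_r -> int) k
    (E F H : 'I_r -> 'M[C]_N) : chev aa E F H ->
  chev aa (fun i => Dk k (E i)) (fun i => Dk k (F i)) (fun i => Dk k (H i)).
Proof.
move=> ch; split=> i j; rewrite -Dk_bracket.
- by rewrite (chEF ch); case: eqP => // _; rewrite Dk0.
- by rewrite (chHE ch) DkZ.
- by rewrite (chHF ch) DkZ.
- by rewrite (chHH ch) Dk0.
Qed.

(** * Branching in the tensor power *)

Section ModelBranching.
Variables (C : numClosedFieldType) (k : nat).
Let d := dk 56 k.
Let E (i : 'I_7) := Dk k (@e1 C i).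
Let F (i : 'I_7) := Dk k (@f1 C i).
Let H (i : 'I_7) := Dk k (@h1 C i).
Let Eb (i : 'I_7) := Dk k (@eb1 C i).
Let Fb (i : 'I_7) := Dk k (@fb1 C i).
Let Hb (i : 'I_7) := Dk k (@hb1 C i).
Let v := pk k (@vb C 0).
Let xi := pk k (@xi1 C).

Let ch : chev (fun i j => cartanE7 i j) E F H := chev_Dk k (model_chev C).
Let chb : chev cartanB Eb Fb Hb := chev_Dk k (model_chev_beta C).

Lemma model_adj i : [/\ adjm (E i) = F i, adjm (Eb i) = Fb i & adjm (Hb i) = Hb i].
Proof. by have [s1 s2 s3] := model_star C i; rewrite !Dk_adj s1 s2 s3. Qed.

Lemma model_hwv : hwv E H (weightE7 k) v.
Proof.
split; first exact: pk_neq0 (vb0_neq0 C).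
  move=> i; have [e0 _] := model_e7_hw C i.
  exact: Dk_pk0.
move=> i; have [_ h0] := model_e7_hw C i; rewrite (Dk_pk_eigen k h0) -natrM.
congr (_%:R *: _); rewrite /weightE7; case: i {h0}.
by move=> [|[|[|[|[|[|[|i]]]]]]] i7 //=; rewrite ?muln0 ?muln1.
Qed.

Definition C0 := cyc F v.

Lemma C0_lin : lin C0. Proof. exact: cyc_lin. Qed.
Lemma C0_E : stab E C0. Proof. exact: (cyc_stabE ch model_hwv). Qed.
Lemma C0_F : stab F C0. Proof. by move=> i x; apply: CycF. Qed.

Lemma C0_irr : irrmod E F C0.
Proof.
apply: (star_irreducible cartan_diag (grading_E7 C) ch model_hwv) => i.
by have [] := model_adj i.
Qed.

Lemma stab_lie (G : 'I_7 -> 'M[C]_56) (S : 'cV[C]_d -> Prop) x : lin S ->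
  stab (fun i => Dk k (G i)) S -> lie_generated (fun Y => exists i, Y = G i) x ->
  forall z, S z -> S (Dk k x *m z).
Proof.
move=> Sl SG; elim=> {x} [Y [i ->]|Y Z _ h1 _ h2|c Y _ h1|Y Z _ h1 _ h2] z Sz.
- exact: SG.
- by rewrite DkD mulmxDl; apply: linD => //; [apply: h1 | apply: h2].
- by rewrite DkZ -scalemxAl; apply: linZ => //; apply: h1.
- rewrite Dk_bracket /bracket mulmxBl -!mulmxA; apply: linB => //; first exact/h1/h2.
  exact/h2/h1.
Qed.

Lemma C0_xi : C0 xi.
Proof.
have [x1 [x2 [l1 s1 l2 s2 xiE]]] := model_xi C.
have n1 : nilmx x1 by exists 2%N; rewrite expr2.
have n2 : nilmx x2 by exists 2%N; rewrite expr2.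
rewrite /xi xiE -!Tk_pk.
have [m1 <-] := Dk_exp k n1; have [m2 <-] := Dk_exp k n2.
apply: (stable_exp C0_lin m2) => [z|]; first exact: (stab_lie C0_lin C0_F l2).
apply: (stable_exp C0_lin m1) => [z|]; first exact: (stab_lie C0_lin C0_F l1).
exact: CycGen.
Qed.

Lemma Tk_unit (g : 'M[C]_56) : g \in unitmx -> Tk k g \in unitmx.
Proof.
move=> gu; have : Tk k g *m Tk k (invmx g) = 1%:M by rewrite -Tk_mul mulmxV // Tk_1.
by move/mulmx1_unit => [].
Qed.

Lemma C0_word w z : C0 z -> C0 (Tk k (wmx (@e1 C) (@f1 C) w) *m z).
Proof.
move=> Cz; elim: w => [|i w IH]; first by rewrite wmx_nil Tk_1 mul1mx.
have S2 := chev_sl2 cartan_diag (model_chev C) (inord i).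
have ex A s y : nilmx A -> (forall z, C0 z -> C0 (Dk k A *m z)) -> C0 y ->
    C0 (Tk k (exp_nilp (s *: A)) *m y).
  move=> nA SA Cy; have [m <-] := Dk_exp k (nilmxZ s nA).
  apply: (stable_exp C0_lin m) => // t Ct.
  by rewrite DkZ -scalemxAl; apply: linZ; [exact: C0_lin | exact: SA].
rewrite wmx_cons /theta !Tk_mul -!mulmxA.
apply: (ex _ _ _ (sl2_nilmx_e S2) (@C0_E _)).
apply: (ex _ _ _ (sl2_nilmx_f S2) (@C0_F _)).
exact: (ex _ _ _ (sl2_nilmx_e S2) (@C0_E _) IH).
Qed.

Lemma C0_Ebm (X : 'I_7 -> 'M[C]_56) : stab (fun i => Dk k (X i)) C0 ->
  stab (fun i => Dk k (Ebm (@e1 C) (@f1 C) X i)) C0.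
Proof.
move=> SX i z Cz; rewrite /Ebm; case: eqP => _; last exact: SX.
set w := wmx _ _ _; have uw : w \in unitmx := model_wordP C.
have uT := Tk_unit uw.
have -> : Dk k (w *m X (inord 6) *m invmx w) = Tk k w *m Dk k (X (inord 6)) *m invmx (Tk k w).
  apply: (can_inj (mulmxK uT)); rewrite mulmxKV //; apply/esym/Tk_Dk.
  by rewrite mulmxKV.
rewrite -!mulmxA; apply: C0_word; apply: SX.
apply: (lin_stable_inv C0_lin uT) => // y; exact: C0_word.
Qed.

Lemma C0_Eb : stab Eb C0.
Proof.
move=> i z Cz; have [e _] := model_Ebm C i; rewrite /Eb -e.
exact: (C0_Ebm (X := @e1 C) C0_E).
Qed.

Lemma C0_Fb : stab Fb C0.
Proof.
move=> i z Cz; have [_ e] := model_Ebm C i; rewrite /Fb -e.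
exact: (C0_Ebm (X := @f1 C) C0_F).
Qed.

Lemma C0_Hb : stab Hb C0.
Proof. exact: (stab_H cartanB_diag chb C0_lin C0_Eb C0_Fb). Qed.

(* [U(b) xi], for [b] the Borel subalgebra opposite to that of [Lie H]. *)
Inductive borel_orbit : 'cV[C]_d -> Prop :=
| OrbGen : borel_orbit xi
| Orb0 : borel_orbit 0
| OrbLin c x y : borel_orbit x -> borel_orbit y -> borel_orbit (c *: x + y)
| OrbF i x : borel_orbit x -> borel_orbit (Fb i *m x)
| OrbH i x : borel_orbit x -> borel_orbit (Hb i *m x).

Lemma orb_lin : lin borel_orbit.
Proof. by split; [apply: Orb0 | apply: OrbLin]. Qed.

Lemma orb_Bl y : Bl y -> forall z, borel_orbit z -> borel_orbit (Dk k y *m z).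
Proof.
have Sl := orb_lin.
elim=> {y} [Y [i [-> | ->]]|Y Z _ h1 _ h2|c Y _ h1|Y Z _ h1 _ h2] z Sz.
- exact: OrbF.
- exact: OrbH.
- by rewrite DkD mulmxDl; apply: linD => //; [apply: h1 | apply: h2].
- by rewrite DkZ -scalemxAl; apply: linZ => //; apply: h1.
- rewrite Dk_bracket /bracket mulmxBl -!mulmxA; apply: linB => //; first exact/h1/h2.
  exact/h2/h1.
Qed.

(** At [xi] the element [x] is replaced by an element of the Borel subalgebra. Further down [x b z =
    b x z - [b, x] z], and [[b, x]] stays in the span of [Ll] and [Bl]. *)
Lemma orb_Ll z : borel_orbit z -> forall x, Ll x -> borel_orbit (Dk k x *m z).
Proof.
have Sl := orb_lin.
have swap (A B : 'M[C]_56) y : Dk k A *m (Dk k B *m y)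
    = Dk k B *m (Dk k A *m y) - Dk k (bracket B A) *m y.
  by rewrite Dk_bracket /bracket mulmxBl !mulmxA opprB addrC subrK.
elim=> {z} [||c y z _ IHy _ IHz|i z oz IH|i z oz IH] x Lx.
- have [y By xy] := Ll_xi Lx; rewrite /xi (Dk_pk k xy).
  by apply: orb_Bl => //; apply: OrbGen.
- by rewrite mulmx0; apply: Orb0.
- by rewrite mulmxDr -scalemxAr; apply: OrbLin; [apply: IHy | apply: IHz].
- rewrite swap; apply: linB => //; first by apply: OrbF; apply: IH.
  have := Ll_bracket_fb i Lx.
  apply: (lspan_map (T := fun A => Dk k A *m z)) => // [c A B|A [LA|BA]].
  + by rewrite Dk_lin mulmxDl -scalemxAl.
  + exact: IH.
  + exact: orb_Bl.
- rewrite swap; apply: linB => //; first by apply: OrbH; apply: IH.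
  have [c ->] := Ll_bracket_hb i Lx.
  by rewrite DkZ -scalemxAl; apply: linZ => //; apply: IH.
Qed.

Lemma xi_neq0 : xi != 0.
Proof.
apply: pk_neq0; apply/eqP => x0; have := @dot_xi C 0 isT; rewrite x0.
rewrite dotE big1 => [|i _]; last by rewrite mxE conjC0 mul0r.
by move/esym/eqP; rewrite intr_eq0.
Qed.

Lemma C0_orb z : C0 z -> borel_orbit z.
Proof.
apply: (C0_irr orb_lin) => [i y oy|i y oy|y|].
- exact: orb_Ll oy _ (Ll_e C i).
- by case: (LB_f C i) => h; [apply: orb_Ll | apply: orb_Bl].
- elim=> {y} [||c x y _ Cx _ Cy|i y _|i y _].
  + exact: C0_xi.
  + exact: Cyc0.
  + exact: CycLin.
  + exact: C0_Fb.
  + exact: C0_Hb.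
- by exists xi; split; [exact: OrbGen | exact: xi_neq0].
Qed.

(* [C0 = U(b) xi], and the adjoints of the elements of [b] multiply [y] by
   scalars. *)
Lemma xi_nondegenerate m y : C0 y -> (forall i, Eb i *m y = 0) ->
  (forall i, Hb i *m y = (m i : C) *: y) -> dot xi y = 0 -> y = 0.
Proof.
move=> Cy Ey Hy xy; apply: dot_eq0.
suff : forall z, borel_orbit z -> dot z y = 0 by apply; apply: C0_orb.
move=> z; elim=> {z} [||c x z _ hx _ hz|i z _ hz|i z _ hz].
- exact: xy.
- exact: dot0l.
- by rewrite dotDl hx hz mulr0 addr0.
- by have [_ e _] := model_adj i; rewrite dotMl -e adjmK Ey dot0r.
- by have [_ _ e] := model_adj i; rewrite dotMl e Hy dotZr hz mulr0.
Qed.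

(** The number [dot xi y] is nonzero and [m i] times it is [dot (Hb i *m xi) y], so each relation
    among the vectors [Hb i *m xi] is one among the [m i]. *)
Lemma hwv_weight m y : C0 y -> hwv Eb Hb m y ->
  exists a : branching_index k, forall i, m i = wB (val a).1.1 (val a).1.2 (val a).2 i.
Proof.
move=> Cy [y0 Ey Hy].
have q0 : dot xi y != 0.
  apply: contra y0 => /eqP q0; apply/eqP.
  exact: (xi_nondegenerate Cy Ey Hy).
have mE i : (m i)%:R * dot xi y = dot (Hb i *m xi) y.
  by have [_ _ e] := model_adj i; rewrite dotMl e Hy dotZr.
have z (i : 'I_7) : (i : nat) \in [:: 2; 3; 4]%N -> m i = 0%N.
  move=> iin; have [t _] := model_torus C i.
  apply/eqP; have := mE i; rewrite /Hb /xi (Dk_pk0 k (t iin)) dot0l.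
  by move/eqP; rewrite mulf_eq0 (negPf q0) orbF pnatr_eq0.
have [_ [t06 tk]] := model_torus C 0.
have m06 : m 0 = m (inord 6).
  apply/eqP; rewrite -(eqr_nat C); apply/eqP/(mulIf q0).
  by rewrite !mE /Hb /xi (Dk_pk k t06).
have mk : (m 0%R + 2 * m (inord 1) + m (inord 5))%N = k.
  apply/eqP; rewrite -(eqr_nat C); apply/eqP/(mulIf q0).
  have hx : (hb1 C 0 + 2 *: hb1 C (inord 1) + hb1 C (inord 5)) *m xi1 C = 1 *: xi1 C.
    by rewrite !mulmxDl -scalemxAl tk scale1r.
  have := Dk_pk_eigen k hx; rewrite mulr1 !DkD DkZ !mulmxDl -scalemxAl.
  rewrite -/xi -/(Hb _) -/(Hb _) -/(Hb _) => e.
  have := congr1 (fun w => dot w y) e => /=.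
  rewrite -[Hb 0 *m xi + _ + _]addrA -[Hb 0 *m xi]scale1r !dotDl conjC1 rmorph_nat.
  have := dotDl k%:R xi 0 y; rewrite addr0 dot0l addr0 rmorph_nat => -> <-.
  by rewrite !natrD !mulrDl !mE mul0r mul1r; ring.
have lt1 : (m 0%R < k.+1)%N by lia.
have lt2 : (m (inord 1) < k.+1)%N by lia.
have lt3 : (m (inord 5) < k.+1)%N by lia.
pose a : 'I_k.+1 * 'I_k.+1 * 'I_k.+1 := (Ordinal lt1, Ordinal lt2, Ordinal lt3).
have aP : (a.1.1 + 2 * a.1.2 + a.2 == k)%N by rewrite /= mk.
exists (exist _ a aP) => i; rewrite /wB /=.
have io (j : nat) (p : (j < 7)%N) : Ordinal p = inord j.
  by apply: val_inj; rewrite /= inordK.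
case: i => -[|[|[|[|[|[|[|i]]]]]]] i7 //=.
- by congr m; apply: val_inj.
- by rewrite io.
- exact: z.
- exact: z.
- exact: z.
- by rewrite io.
- by rewrite m06 io.
Qed.

Lemma hwv_mult1 m y y' : C0 y -> C0 y' -> hwv Eb Hb m y -> hwv Eb Hb m y' ->
  exists c, y' = c *: y.
Proof.
move=> Cy Cy' [y0 Ey Hy] [y'0 Ey' Hy'].
have q0 : dot xi y != 0.
  apply: contra y0 => /eqP q0; apply/eqP.
  exact: (xi_nondegenerate Cy Ey Hy).
(* The scalar that makes [y' - c *: y] orthogonal to [xi]. *)
exists (dot xi y' / dot xi y); apply/eqP; rewrite -subr_eq0; apply/eqP.
set c := _ / _.
have zE : y' - c *: y = (- c) *: y + y' by rewrite scaleNr addrC.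
apply: (xi_nondegenerate (m := fun i => (m i)%:R)).
- by rewrite zE; apply: CycLin.
- by move=> i; rewrite zE mulmxDr -scalemxAr Ey Ey' scaler0 addr0.
- by move=> i; rewrite zE mulmxDr -scalemxAr Hy Hy' scalerDr !scalerA mulrC.
- by rewrite zE dotDr mulNr /c divfK // addNr.
Qed.

End ModelBranching.

Lemma wB_add a1 a2 a3 b1 b2 b3 i :
  wB (a1 + b1) (a2 + b2) (a3 + b3) i = (wB a1 a2 a3 i + wB b1 b2 b3 i)%N.
Proof. by case: i => -[|[|[|[|[|[|[|i]]]]]]] i7. Qed.

(** * Highest weight vectors of H in tensor powers *)

Section Existence.
Variable C : numClosedFieldType.
Implicit Types k a : nat.

(* Highest weight vectors of [H] in the tensor power; they need not lie in [C0]
   but their projections to [C0] are nonzero, because [xi] is in [C0]. *)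
Definition test_hwv k a1 a2 a3 (u : 'cV[C]_(dk 56 k)) :=
  [/\ forall i, Dk k (eb1 C i) *m u = 0,
      forall i, Dk k (hb1 C i) *m u = (wB a1 a2 a3 i)%:R *: u
    & dot (pk k (xi1 C)) u != 0].

Lemma model_hbE (i : 'I_7) : [/\ hb1 C i *m vb C 0 = (wB 1 0 0 i)%:R *: vb C 0,
  hb1 C i *m vb C 2 = (wB 0 0 1 i)%:R *: vb C 2 &
  (hbw i 0)%:~R + (hbw i 18)%:~R = (wB 0 1 0 i)%:R :> C /\
  (hbw i 1)%:~R + (hbw i 15)%:~R = (wB 0 1 0 i)%:R :> C].
Proof.
have /and4P[/eqP h1 /eqP h2 /eqP h3 /eqP h4] := forall_ord hbw_val i.
rewrite -!intrD (model_hb _ _ (k := 0)) // (model_hb _ _ (k := 2)) //= h3 h4 h1 h2.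
have E b1 b2 b3 (s : seq int) : (forall j : 'I_7, nth 0 s j = (wB b1 b2 b3 j)%:Z) ->
    (nth 0 s i)%:~R = (wB b1 b2 b3 i)%:R :> C by move=> ->.
have c b1 b2 b3 (s : seq int) : all (fun j => nth 0 s j
    == (nth 0%N [:: b1; b2; 0; 0; 0; b3; b1]%N j)%:Z) (iota 0 7) ->
    (forall j : 'I_7, nth 0 s j = (wB b1 b2 b3 j)%:Z).
  by move=> /forall_ord h j; apply/eqP; exact: h j.
by rewrite (E 0%N 1%N 0%N [:: 0; 1; 0; 0; 0; 0; 0]) ?(E 1%N 0%N 0%N [:: 1; 0; 0; 0; 0; 0; 1])
  ?(E 0%N 0%N 1%N [:: 0; 0; 0; 0; 0; 1; 0]) //; apply: c.
Qed.

Lemma test_tensv k a1 a2 a3 b1 b3 u x : test_hwv a1 a2 a3 u ->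
  (forall i, eb1 C i *m x = 0) -> (forall i, hb1 C i *m x = (wB b1 0 b3 i)%:R *: x) ->
  dot (xi1 C) x != 0 -> @test_hwv k.+1 (a1 + b1) a2 (a3 + b3) (tensv u x).
Proof.
move=> [Eu Hu qu] Ex Hx qx; split=> [i|i|].
- by rewrite Dk_tensv Eu Ex /tensv tens0mx tensmx0 addr0.
- rewrite Dk_tensv Hu Hx /tensv tensZl tensZr -scalerDl -natrD.
  by have := wB_add a1 a2 a3 b1 0 b3 i; rewrite addn0 => ->.
- by rewrite /= dot_tensv mulf_neq0.
Qed.

Lemma dot_xiE : [/\ dot (xi1 C) (vb C 0) = 1, dot (xi1 C) (vb C 2) = -1,
  dot (xi1 C) (vb C 18) = 1, dot (xi1 C) (vb C 1) = 0 & dot (xi1 C) (vb C 15) = 0].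
Proof. by split; rewrite dot_xi //. Qed.

Lemma test_square k a1 a2 a3 u : @test_hwv k a1 a2 a3 u ->
  exists u' : 'cV_(dk 56 k.+2), test_hwv a1 a2.+1 a3 u'.
Proof.
move=> [Eu Hu qu]; pose t p q : 'cV[C]_(dk 56 k.+2) := tensv (tensv u (vb C p)) (vb C q).
pose tt (x y : 'cV[C]_56) : 'cV[C]_(dk 56 k.+2) := tensv (tensv u x) y.
have ttZl c x y : tt (c *: x) y = c *: tt x y by rewrite /tt /tensv tensZr tensZl.
have ttZr c x y : tt x (c *: y) = c *: tt x y by rewrite /tt /tensv tensZr.
have ttDl x x' y : tt (x + x') y = tt x y + tt x' y by rewrite /tt /tensv tensDr tensDl.
have ttDr x y y' : tt x (y + y') = tt x y + tt x y' by rewrite /tt /tensv tensDr.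
have tt0l y : tt 0 y = 0 by rewrite /tt /tensv tensmx0 tens0mx.
have tt0r x : tt x 0 = 0 by rewrite /tt /tensv tensmx0.
have Dtt A c x y : Dk k A *m u = c *: u ->
    Dk k.+2 A *m tt x y = c *: tt x y + tt (A *m x) y + tt x (A *m y).
  move=> Au; rewrite /tt !Dk_tensv Au /tensv !tensDl !tensZl; congr (_ + _ + _).
have Eu' i : Dk k (eb1 C i) *m u = 0 *: u by rewrite Eu scale0r.
have [x0 x2 x18 x1 x15] := dot_xiE.
(* [beta_1] sends [v_18] to [v_1] and [v_15] to [v_0], [beta_7] sends [v_18] to [v_15] and [v_1] to
   [v_0]: the signs make the images cancel. Only the first two terms pair with [xi], each
   contributing the pairing of [u]. *)
exists (tt (vb C 0) (vb C 18) + tt (vb C 18) (vb C 0) - tt (vb C 1) (vb C 15)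
        - tt (vb C 15) (vb C 1)); split=> [i|i|].
- have [e0 e2 e18 e1 e15] := model_hw C i.
  rewrite !mulmxDr !mulmxN !(Dtt _ _ _ _ (Eu' i)) e0 e18 e1 e15.
  rewrite !scale0r !add0r !tt0l !tt0r !ttDl !ttDr !ttZl !ttZr !add0r !addr0.
  by apply/matrixP => p q; rewrite !mxE; ring.
- have [_ _ [h1 h2]] := model_hbE i.
  have hb p : p \in [:: 0; 1; 2; 15; 18]%N -> _ := fun pp => model_hb C i pp.
  rewrite !mulmxDr !mulmxN !(Dtt _ _ _ _ (Hu i)) !hb // !ttZl !ttZr.
  have -> : (wB a1 a2.+1 a3 i)%:R = (wB a1 a2 a3 i)%:R + (wB 0 1 0 i)%:R :> C.
    by rewrite -natrD -wB_add !addn0 addn1.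
  have h18 : (hbw i 18)%:~R = (wB 0 1 0 i)%:R - (hbw i 0)%:~R :> C by rewrite -h1 addrC addKr.
  have h15 : (hbw i 15)%:~R = (wB 0 1 0 i)%:R - (hbw i 1)%:~R :> C by rewrite -h2 addrC addKr.
  by rewrite h18 h15; apply/matrixP => p q; rewrite !mxE; ring.
- have dotA d (x y z : 'cV[C]_d) : dot x (y + z) = dot x y + dot x z.
    by rewrite -[y]scale1r dotDr mul1r scale1r.
  rewrite !dotBr dotA /tt /= !dot_tensv x0 x18 x1 x15 !mulr0 !mulr1 !subr0.
  by rewrite -mulr2n mulrn_eq0.
Qed.

Lemma test_exists k a1 a2 a3 : (a1 + 2 * a2 + a3)%N = k ->
  exists u : 'cV_(dk 56 k), test_hwv a1 a2 a3 u.
Proof.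
have [x0 x2 _ _ _] := dot_xiE.
move=> <-; elim: a3 => [|a3 [u tu]].
  rewrite addn0; elim: a2 => [|a2 [u tu]].
    rewrite addn0; elim: a1 => [|a1 [u tu]].
      exists 1%:M; split=> [i|i|]; rewrite /= ?mul0mx //.
        have -> : wB 0 0 0 i = 0%N by case: i => -[|[|[|[|[|[|[|i]]]]]]] i7.
        by rewrite scale0r.
      by rewrite dotE big_ord1 !mxE conjC1 mulr1 oner_neq0.
    exists (tensv u (vb C 0)); rewrite -[X in test_hwv X]addn1 -[X in test_hwv _ _ X](addn0 0%N).
    apply: test_tensv => // [i|i|]; last by rewrite x0 oner_neq0.
      by have [] := model_hw C i.
    by have [] := model_hbE i.
  rewrite mulnS addnCA add2n; exact: test_square tu.
rewrite addnS; exists (tensv u (vb C 2)).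
rewrite -[X in test_hwv X]addn0 -[X in test_hwv _ _ X]addn1.
apply: test_tensv => // [i|i|]; last by rewrite x2 oppr_eq0 oner_neq0.
  by have [] := model_hw C i.
by have [] := model_hbE i.
Qed.

End Existence.

(** * Decomposition of the model under H *)

Section Decomposition.
Variables (C : numClosedFieldType) (k : nat).
Let d := dk 56 k.
Let Eb (i : 'I_7) := Dk k (@eb1 C i).
Let Fb (i : 'I_7) := Dk k (@fb1 C i).
Let Hb (i : 'I_7) := Dk k (@hb1 C i).
Let xi := pk k (@xi1 C).
Let chb : chev cartanB Eb Fb Hb := chev_Dk k (model_chev_beta C).

Let adjEb i : adjm (Eb i) = Fb i. Proof. by have [] := model_adj C k i. Qed.
Let adjFb i : adjm (Fb i) = Eb i. Proof. by rewrite -adjEb adjmK. Qed.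
Let adjHb i : adjm (Hb i) = Hb i. Proof. by have [] := model_adj C k i. Qed.

Definition wa (a : branching_index k) (i : 'I_7) : nat :=
  wB (val a).1.1 (val a).1.2 (val a).2 i.

Lemma wa_inj a b : (forall i, wa a i = wa b i) -> a = b.
Proof.
case: a => [[[x1 x2] x3] pa]; case: b => [[[y1 y2] y3] pb] ab; apply: val_inj => /=.
have := ab 0; have := ab (inord 1); have := ab (inord 5).
rewrite /wa /wB !inordK //= => h5 h1 h0.
by congr (_, _, _); apply: val_inj.
Qed.

(** The defect [T s - c s] lies in [S] and equals [c (u - s) - T (u - s)], which is orthogonal to
    [S] as [S] is stable under the adjoint of [T]. *)
Lemma projection_eigen (S : 'cV[C]_d -> Prop) (T : 'M[C]_d) c u s : lin S ->
  (forall y, S y -> S (T *m y)) -> (forall y, S y -> S (adjm T *m y)) ->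
  S s -> (forall y, S y -> dot y (u - s) = 0) -> T *m u = c *: u -> T *m s = c *: s.
Proof.
move=> Sl ST ST' Ss us Tu; apply/eqP; rewrite -subr_eq0; apply/eqP/dot_eq0.
have Sw : S (T *m s - c *: s) by apply: linB => //; [apply: ST | apply: linZ].
have e : T *m s - c *: s = c *: (u - s) - T *m (u - s).
  rewrite scalerBr mulmxBr Tu; move: (T *m s) (c *: u) (c *: s) => p q r.
  by apply/matrixP => i j; rewrite !mxE; ring.
rewrite [X in dot _ X]e dotBr dotZr us // dotMr us ?mulr0 ?subrr //; exact: ST'.
Qed.

Lemma C0_adj (i : 'I_7) y : C0 y ->
  [/\ C0 (adjm (Eb i) *m y) & C0 (adjm (Hb i) *m y)].
Proof.
move=> Cy; have [_ -> ->] := model_adj C k i.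
by split; [apply: C0_Fb | apply: C0_Hb].
Qed.

Lemma C0_hwv (a : branching_index k) : exists x, C0 x /\ hwv Eb Hb (wa a) x.
Proof.
have [u [Eu Hu qu]] := test_exists C (eqP (valP a)).
have Cl : lin (@C0 C k) by exact: C0_lin.
have [s Cs us] := orth_projection u Cl.
exists s; split=> //; split.
- apply: contra qu => /eqP s0; have := us _ (C0_xi C k).
  by rewrite s0 subr0 => ->.
- move=> i; rewrite -[RHS](scale0r s).
  apply: (projection_eigen Cl _ _ Cs us); last by rewrite Eu scale0r.
    exact: C0_Eb.
  by move=> y /(C0_adj i)[].
- move=> i; apply: (projection_eigen Cl _ _ Cs us); last exact: Hu.
    exact: C0_Hb.
  by move=> y /(C0_adj i)[].
Qed.

Definition hcomp x : 'cV[C]_d -> Prop := cyc Fb x.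

Lemma orth_stab (S : 'cV[C]_d -> Prop) (X Y : 'I_7 -> 'M[C]_d) :
  (forall i, adjm (X i) = Y i) -> stab Y S ->
  stab X (fun x => forall y, S y -> dot y x = 0).
Proof. by move=> XY SY i x ox y Sy; rewrite dotMr XY; apply: ox; apply: SY. Qed.

Lemma cyc_C0 x : C0 x -> forall y, hcomp x y -> C0 y.
Proof. by move=> Cx; apply: cyc_min => //; [exact: C0_lin | exact: C0_Fb]. Qed.

Lemma hcomp_stab m x : hwv Eb Hb m x -> stab Eb (hcomp x) /\ stab Hb (hcomp x).
Proof.
by move=> hx; split; [exact: (cyc_stabE chb hx) | exact: (cyc_stabH chb hx)].
Qed.

(** [x] and [x'] have different eigenvalues under a self-adjoint [Hb i]. Lowering operators are then
    moved across the form, where they become raising operators. *)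
Lemma hcomp_disjoint m m' x x' : hwv Eb Hb m x -> hwv Eb Hb m' x' ->
  (exists i, m i <> m' i) -> forall z z', hcomp x z -> hcomp x' z' -> dot z z' = 0.
Proof.
move=> hx hx' [i mi]; have [x0 Ex Hx] := hx; have [x0' Ex' Hx'] := hx'.
have [SE SH] := hcomp_stab hx; have [SE' SH'] := hcomp_stab hx'.
have xx' : dot x x' = 0.
  have := dotMl (Hb i) x x'; rewrite adjHb Hx' Hx dotZr.
  have := dotDl (m i)%:R x 0 x'; rewrite addr0 dot0l addr0 rmorph_nat => -> /eqP.
  rewrite -subr_eq0 -mulrBl mulf_eq0.
  by rewrite subr_eq0 eqr_nat => /orP[/eqP|/eqP].
have lo z' : hcomp x' z' -> dot x z' = 0.
  move=> cz'; elim: cz' => {z'} [||c y y' _ hy _ hy'|j y _ hy].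
  - exact: xx'.
  - exact: dot0r.
  - by rewrite dotDr hy hy' mulr0 addr0.
  - by rewrite dotMr adjFb Ex dot0l.
move=> z z' cz; elim: cz z' => {z} [||c y y' _ hy _ hy'|j y _ hy] z' cz'.
- exact: lo.
- exact: dot0l.
- by rewrite dotDl hy // hy' // mulr0 addr0.
- by rewrite dotMl adjFb; apply: hy; apply: SE'.
Qed.

Lemma C0_decomposition : exists x : branching_index k -> 'cV[C]_d,
  [/\ forall a, C0 (x a), forall a, hwv Eb Hb (wa a) (x a),
      forall a, irrmod Eb Fb (hcomp (x a)),
      forall a b z z', a != b -> hcomp (x a) z -> hcomp (x b) z' -> dot z z' = 0
    & forall y, C0 y -> exists z : branching_index k -> 'cV[C]_d,
        (forall a, hcomp (x a) (z a)) /\ y = \sum_a z a].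
Proof.
have [x xP] := boolp.choice C0_hwv.
have Cx a : C0 (x a) by have [] := xP a.
have hx a : hwv Eb Hb (wa a) (x a) by have [] := xP a.
exists x; split=> // [a|a b z z' ab|y Cy].
- apply: (star_irreducible cartanB_diag (grading_B C) chb (hx a)) => i.
  by have [] := model_adj C k i.
- apply: (hcomp_disjoint (hx a) (hx b)); apply: boolp.contrapT => nex.
  case/eqP: ab; apply: wa_inj => i; apply: boolp.contrapT => wi.
  by apply: nex; exists i.
pose S y := exists z : branching_index k -> 'cV[C]_d,
  (forall a, hcomp (x a) (z a)) /\ y = \sum_a z a.
have Sl : lin S.
  split; first by exists (fun=> 0); rewrite big1; split=> // a; exact: Cyc0.
  move=> c y1 y2 [z1 [h1 ->]] [z2 [h2 ->]]; exists (fun a => c *: z1 a + z2 a).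
  split=> [a|]; last by rewrite scaler_sumr -big_split.
  by apply: CycLin; [exact: h1 | exact: h2].
have SF : stab Fb S.
  move=> i _ [z [h ->]]; exists (fun a => Fb i *m z a).
  split=> [a|]; first by apply: CycF; exact: h.
  by rewrite mulmx_sumr.
have SE : stab Eb S.
  move=> i _ [z [h ->]]; exists (fun a => Eb i *m z a); split=> [a|]; last by rewrite mulmx_sumr.
  by have [SE _] := hcomp_stab (hx a); apply: SE; exact: h.
have SC z : S z -> C0 z.
  by move=> [w [h ->]]; apply: lin_sum => [|a _]; [exact: C0_lin | exact: (cyc_C0 (Cx a) (h a))].
have [s Ss ys] := orth_projection y Sl.
have [/eqP ys0 | ys0] := boolP (y - s == 0).
  by have -> : y = s by apply/eqP; rewrite -subr_eq0 ys0.
exfalso.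
(* A nonzero complement would contain a highest weight vector [w]. Its weight is some [wa a], so
   [x a] is a multiple of [w] by multiplicity one, and hence orthogonal to itself. *)
pose O z := C0 z /\ forall w, S w -> dot w z = 0.
have Ol : lin O.
  have [c0 cl] := C0_lin C k; have [o0 ol] := lin_orth S.
  by split=> [|c p q [Cp op] [Cq oq]]; split=> //; [exact: cl | exact: ol].
have OE : stab Eb O.
  move=> i z [Cz oz]; split; first exact: C0_Eb.
  by apply: (orth_stab (Y := Fb)) => // j; have [] := model_adj C k j.
have OH : stab Hb O.
  move=> i z [Cz oz]; split; first exact: C0_Hb.
  apply: (orth_stab (Y := Hb)) => [j||//]; first by have [] := model_adj C k j.
  exact: (stab_H cartanB_diag chb Sl SE SF).
have Oy : O (y - s).
  by split=> //; apply: linB => //; [exact: C0_lin | exact: SC].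
have [m [w [[Cw ow] hw]]] := hwv_exists cartanB_diag (grading_B C) chb Ol OE OH Oy ys0.
have [a ma] := hwv_weight Cw hw.
have hxa : hwv Eb Hb m (x a).
  have [q1 q2 q3] := hx a; split=> // i; by rewrite ma.
have [c xc] := hwv_mult1 Cw (Cx a) hw hxa.
have [xa0 _ _] := hx a; case/eqP: xa0.
apply: dot_eq0; rewrite [X in dot _ X]xc.
rewrite dotZr ow ?mulr0 //; exists (fun b => if b == a then x a else 0); split.
  by move=> b; case: eqP => [->|_]; [exact: CycGen | exact: Cyc0].
by rewrite -big_mkcond big_pred1_eq.
Qed.

End Decomposition.

Lemma inj_row_full (F : fieldType) m n (A : 'M[F]_(m, n)) :
  (forall z : 'cV_n, A *m z = 0 -> z = 0) -> row_full A.
Proof.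
move=> H; rewrite /row_full -mxrank_tr -[_ == _]/(row_free A^T) -kermx_eq0.
apply/rowV0P => u /sub_kermxP uA; apply: trmx_inj; rewrite trmx0; apply: H.
by rewrite -[A]trmxK -trmx_mul uA trmx0.
Qed.

Lemma surj_row_free (F : fieldType) m n (A : 'M[F]_(m, n)) :
  (forall y : 'cV_m, exists z : 'cV_n, y = A *m z) -> row_free A.
Proof.
move=> H; have [B BP] := boolp.choice (fun j : 'I_m => H (col j 1%:M)).
apply/row_freeP; exists (\matrix_(i, j) B j i 0); apply/matrixP => i j.
have := congr1 (fun x : 'cV_m => x i 0) (BP j); rewrite [LHS]mxE => ->.
by rewrite !mxE; apply: eq_bigr => k _; rewrite !mxE.
Qed.

(** * Intertwining maps and the embedding of V in the model *)

Section Intertwining.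
Variable F : numFieldType.

Lemma theta_intertwine d d' (P : 'M[F]_(d', d)) (e f h : 'M_d) (e' f' h' : 'M_d') s :
  sl2 e f h -> sl2 e' f' h' -> P *m e = e' *m P -> P *m f = f' *m P ->
  P *m theta e f s = theta e' f' s *m P.
Proof.
move=> S S' Pe Pf; have ne := sl2_nilmx_e S; have nf := sl2_nilmx_f S.
have ne' := sl2_nilmx_e S'; have nf' := sl2_nilmx_f S'.
have ie c : P *m exp_nilp (c *: e) = exp_nilp (c *: e') *m P.
  by apply/esym/intertwine_exp; try exact: nilmxZ; rewrite -scalemxAl -scalemxAr Pe.
have iff c : P *m exp_nilp (c *: f) = exp_nilp (c *: f') *m P.
  by apply/esym/intertwine_exp; try exact: nilmxZ; rewrite -scalemxAl -scalemxAr Pf.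
by rewrite /theta !mulmxA ie -(mulmxA _ P) iff -!mulmxA ie.
Qed.

Lemma Ebm_intertwine d d' (P : 'M[F]_(d', d)) (E G H : 'I_7 -> 'M_d)
    (E' G' H' : 'I_7 -> 'M_d') (Z : 'I_7 -> 'M_d) (Z' : 'I_7 -> 'M_d') i :
  (forall i, sl2 (E i) (G i) (H i)) -> (forall i, sl2 (E' i) (G' i) (H' i)) ->
  (forall i, P *m E i = E' i *m P) -> (forall i, P *m G i = G' i *m P) ->
  (forall i, P *m Z i = Z' i *m P) -> P *m Ebm E G Z i = Ebm E' G' Z' i *m P.
Proof.
move=> S S' PE PG PZ; rewrite /Ebm; case: eqP => // _; set w := wmx E G _; set w' := wmx E' G' _.
have wu : w \in unitmx /\ w' \in unitmx.
  rewrite /w /w'; elim: beta_word => [|j l [u u']]; first by rewrite !wmx_nil !unitmx1.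
  by split; rewrite wmx_cons unitmx_mul ?(theta_unit (S _)) ?(theta_unit (S' _)) ?u.
have Pw : P *m w = w' *m P.
  rewrite /w /w'; elim: beta_word => [|j l IH]; first by rewrite !wmx_nil mulmx1 mul1mx.
  rewrite !wmx_cons mulmxA (theta_intertwine 1 (S _) (S' _) (PE _) (PG _)).
  by rewrite -!mulmxA IH.
have [u u'] := wu; have Pwi : P *m invmx w = invmx w' *m P.
  by rewrite -[LHS](mulKmx u') [w' *m _]mulmxA -Pw mulmxK.
by rewrite !mulmxA Pw -(mulmxA _ P) PZ -!mulmxA Pwi.
Qed.

End Intertwining.

Section ModelEmbedding.
Variables (C : numClosedFieldType) (k : nat).

Lemma Dk_Ebm (Z : 'I_7 -> 'M[C]_56) i :
  Dk k (Ebm (@e1 C) (@f1 C) Z i) = Ebm (fun j => Dk k (e1 C j)) (fun j => Dk k (f1 C j))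
    (fun j => Dk k (Z j)) i.
Proof.
rewrite /Ebm; case: eqP => // _; set w := wmx _ _ _.
have uw : w \in unitmx := model_wordP C; have uT := Tk_unit k uw.
have -> : wmx (fun j => Dk k (e1 C j)) (fun j => Dk k (f1 C j)) beta_word = Tk k w.
  rewrite /w; elim: beta_word => [|j l IH]; first by rewrite !wmx_nil Tk_1.
  have S2 := chev_sl2 cartan_diag (model_chev C) (inord j).
  have ex (A : 'M[C]_56) s : nilmx A -> exp_nilp (s *: Dk k A) = Tk k (exp_nilp (s *: A)).
    by move=> nA; have [_ <-] := Dk_exp k (nilmxZ s nA); rewrite DkZ.
  have ne := sl2_nilmx_e S2; have nf := sl2_nilmx_f S2.
  by rewrite !wmx_cons IH /theta !Tk_mul !ex.
apply: (can_inj (mulmxK uT)); rewrite mulmxKV //; apply/esym/Tk_Dk.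
by rewrite mulmxKV.
Qed.

Lemma chev_intertwine_H (r d d' : nat) (aa : 'I_r -> 'I_r -> int) (E G H : 'I_r -> 'M[C]_d)
    (E' G' H' : 'I_r -> 'M[C]_d') (P : 'M_(d', d)) : chev aa E G H -> chev aa E' G' H' ->
  (forall i, P *m E i = E' i *m P) -> (forall i, P *m G i = G' i *m P) ->
  forall i, P *m H i = H' i *m P.
Proof.
move=> ch ch' PE PG i; have := chEF ch i i; have := chEF ch' i i; rewrite eqxx => <- <-.
by rewrite /bracket mulmxBl mulmxBr !mulmxA PE PG -!mulmxA PE PG.
Qed.

Variables (n : nat) (X : E7_realization C n) (dV : nat) (V : 'M[C]_n -> 'M[C]_dV).
Hypothesis VP : irreducible_of_hw X alpha (weightE7 k) V.

Lemma model_embedding : exists D (P : 'M[C]_(dk 56 k, dV)),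
  [/\ differential X alpha V D, forall x : 'cV_dV, P *m x = 0 -> x = 0,
      forall y, C0 y <-> exists x, y = P *m x,
      (forall i, P *m D (Eb X i) = Dk k (eb1 C i) *m P)
      /\ (forall i, P *m D (Gb X i) = Dk k (fb1 C i) *m P)
    & forall i, P *m D (Hb X i) = Dk k (hb1 C i) *m P].
Proof.
have [rK irr [v hv]] := VP; have ch := chev_E7 X.
have HE i : rh X i = hS X (alpha i) by rewrite hS_alpha.
have [bE bG] := (rsp_E X, rsp_G X).
have [bE1 bG1] := (@rsp_alpha _ _ X, @rsp_nalpha _ _ X).
have [D dD] := differential_exists ch cartan_diag bE1 bG1 rK.
have chD := dif_chev ch cartan_diag bE bG bE1 bG1 rK dD.
have hvD := dif_hwv ch cartan_diag HE bE bG bE1 bG1 rK dD hv.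
have irD := dif_irr ch cartan_diag bE bG bE1 bG1 rK dD irr.
have chM := chev_Dk k (model_chev C).
have [P [PE PG _ Pinj PC]] := hw_embedding (grading_E7 C) chD chM hvD (model_hwv C k)
  irD (@C0_irr C k).
exists D, P.
have S2 := chev_sl2 cartan_diag chD; have S2' := chev_sl2 cartan_diag chM.
have PEb i : P *m D (Eb X i) = Dk k (eb1 C i) *m P.
  have [<- _] := model_Ebm C i; rewrite Dk_Ebm (dif_Eb rK dD).
  exact: (Ebm_intertwine (H := fun i => D (rh X i)) (H' := fun i => Dk k (h1 C i))).
have PGb i : P *m D (Gb X i) = Dk k (fb1 C i) *m P.
  have [_ <-] := model_Ebm C i; rewrite Dk_Ebm (dif_Gb rK dD).
  exact: (Ebm_intertwine (H := fun i => D (rh X i)) (H' := fun i => Dk k (h1 C i))).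
split=> // i.
(* The coroots follow from the root vectors, being their brackets. *)
have dbr : D (Hb X i) = bracket (D (Eb X i)) (D (Gb X i)).
  have := chEF (chev_beta X) i i; rewrite eqxx => <-.
  have [] := dif_bracket ch cartan_diag bE1 bG1 rK dD (expo_Eb X i)
    (dif_conj dD (expo_Gb X i)) => //.
have := chEF (chev_Dk k (model_chev_beta C)) i i; rewrite eqxx => <-.
by rewrite dbr /bracket mulmxBl mulmxBr !mulmxA PEb PGb -!mulmxA PEb PGb.
Qed.

End ModelEmbedding.

(** * The factors D6 and A1, with [f] embedding their labels into those of H *)

Section Factors.
Variables (C : numClosedFieldType) (n : nat) (X : E7_realization C n).
Variables (s : nat) (f : 'I_s -> 'I_7) (b : 'I_s -> 'rV[int]_7).
Hypotheses (f_inj : injective f) (bf : forall i, b i = beta (f i)).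
Let E i := Eb X (f i).
Let G i := Gb X (f i).
Let H i := Hb X (f i).
Let K := root_group X b.

Lemma factor_chev : chev (fun i j => cartanB (f i) (f j)) E G H.
Proof.
have ch := chev_beta X; split=> i j; [|exact: (chHE ch)|exact: (chHF ch)|exact: (chHH ch)].
by rewrite (chEF ch) (inj_eq f_inj).
Qed.
Let ch := factor_chev.

Let a2 i : cartanB (f i) (f i) = 2 := cartanB_diag (f i).
Let HE i : H i = hS X (b i). Proof. by rewrite bf. Qed.
Let bE i : rsp X (b i) (E i). Proof. by rewrite bf; apply: rsp_Eb. Qed.
Let bG i : rsp X (- b i) (G i). Proof. by rewrite bf; apply: rsp_Gb. Qed.
Let bE1 i Y : rsp X (b i) Y -> exists k, Y = k *: E i.
Proof. by rewrite bf; apply: rsp_beta. Qed.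
Let bG1 i Y : rsp X (- b i) Y -> exists k, Y = k *: G i.
Proof. by rewrite bf; apply: rsp_nbeta. Qed.

Lemma factor_groupH g : K g -> groupH X g.
Proof.
apply: group_generated_sub => {}g [i gi]; apply: GroupIn; right; exists (f i).
by rewrite -bf.
Qed.

Lemma factor_module m d (rho : 'M[C]_n -> 'M[C]_d) : irreducible_of_hw X b m rho ->
  exists D v, [/\ differential X b rho D,
    chev (fun i j => cartanB (f i) (f j)) (fun i => D (E i)) (fun i => D (G i))
      (fun i => D (H i)),
    hwv (fun i => D (E i)) (fun i => D (H i)) m v
  & irrmod (fun i => D (E i)) (fun i => D (G i)) (fun=> True)].
Proof.
move=> [rK irr [v hv]].
have [D dD] := differential_exists ch a2 bE1 bG1 rK; exists D, v; split=> //.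
- exact: (dif_chev ch a2 bE bG bE1 bG1 rK dD).
- exact: (dif_hwv ch a2 HE bE bG bE1 bG1 rK dD hv).
- exact: (dif_irr ch a2 bE bG bE1 bG1 rK dD irr).
Qed.

(** [T] will be [A (x) 1] or [1 (x) A]. The relation on root vectors is exponentiated to the
    generators of the group and extended to products and inverses. *)
Lemma factor_intertwine dV (V : 'M[C]_n -> 'M[C]_dV) DV d (rho : 'M[C]_n -> 'M[C]_d) D
    N (T : 'M[C]_d -> 'M[C]_N) (Q : 'M[C]_(dV, N)) :
  rational_rep (groupE7 X) V -> differential X alpha V DV ->
  rational_rep K rho -> differential X b rho D ->
  T 1%:M = 1%:M -> (forall A B, T (A *m B) = T A *m T B) ->
  (forall Y, nilmx Y -> nilmx (T Y) /\ forall t, T (exp_nilp (t *: Y)) = exp_nilp (t *: T Y)) ->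
  (forall i, DV (E i) *m Q = Q *m T (D (E i))) ->
  (forall i, DV (G i) *m Q = Q *m T (D (G i))) ->
  forall g, K g -> V g *m Q = Q *m T (rho g).
Proof.
move=> [V1 VM _] dV' [r1 rM _] dD T1 TM Texp QE QG.
have KV g : K g -> groupE7 X g by move/factor_groupH/groupH_E7.
have expQ Y t : expo (groupE7 X) Y -> expo K Y -> DV Y *m Q = Q *m T (D Y) ->
    V (exp_nilp (t *: Y)) *m Q = Q *m T (rho (exp_nilp (t *: Y))).
  move=> eV eK QY; have [n1 ->] := dif_exp dV' eV; have [n2 ->] := dif_exp dD eK.
  have [n3 ->] := Texp _ n2; apply: intertwine_exp; try exact: nilmxZ.
  by rewrite -scalemxAl -scalemxAr QY.
move=> g Kg; elim: Kg => {g} [g||g h Kg IHg Kh IHh|g Kg IHg].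
- move=> [i /(gen_cases bE1 bG1)[[t ->]|[t ->]]]; apply: expQ => //.
  + exact: expo_Eb.
  + exact: (K_expoE ch a2 bE).
  + exact: expo_Gb.
  + exact: (K_expoG ch a2 bG).
- by rewrite V1 r1 T1 mul1mx mulmx1.
- by rewrite VM ?rM ?TM //; try exact: KV; rewrite -mulmxA IHh mulmxA IHg mulmxA.
have Kg' : K (invmx g) by exact: GroupInv.
have gu := K_unit ch a2 bE1 bG1 Kg.
have e1 : T (rho g) *m T (rho (invmx g)) = 1%:M by rewrite -TM -rM // mulmxV // r1.
have e2 : V (invmx g) *m V g = 1%:M by rewrite -VM ?mulVmx ?V1 //; exact: KV.
rewrite -[Q in LHS]mulmx1 -e1 !mulmxA -[_ *m Q *m _]mulmxA -IHg.
by rewrite mulmxA e2 mul1mx.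
Qed.

End Factors.

(** * The action of the group H *)

Section Component.
Variables (C : numClosedFieldType) (n : nat) (X : E7_realization C n) (k : nat).

Let fD (i : 'I_6) : 'I_7 := lshift 1 i.
Let fA (i : 'I_1) : 'I_7 := rshift 6 i.

Let fD_inj : injective fD. Proof. exact: lshift_inj. Qed.
Let fA_inj : injective fA. Proof. by move=> i j _; rewrite !ord1. Qed.

Let betaDE i : betaD6 i = beta (fD i).
Proof. by congr beta; apply: val_inj. Qed.

Let betaAE i : betaA1 i = beta (fA i).
Proof. by congr beta; apply: val_inj; rewrite /= (ord1 i) addn0. Qed.

Lemma cartanB_block i j : cartanB (fD i) (fA j) = 0 /\ cartanB (fA j) (fD i) = 0.
Proof.
have ok : all (fun i => (i < 6)%N ==> (cbn i 6 == 0) && (cbn 6 i == 0)) (iota 0 7).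
  by vm_compute.
have /implyP/(_ (ltn_ord i))/andP[/eqP h1 /eqP h2] := forall_ord ok (fD i).
by rewrite !cartanBE (ord1 j).
Qed.

Let cD (i : 'I_6) : C := hcoef C rhoB (fD i).
Let cA (i : 'I_1) : C := hcoef C rhoB (fA i).

Let split7 (u : 'I_7 -> C) : \sum_i u i = \sum_i u (fD i) + \sum_i u (fA i).
Proof. exact: (@big_split_ord _ _ _ 6 1 xpredT u). Qed.

Let gradingD j : \sum_i cD i * (cartanB (fD i) (fD j))%:~R = 1.
Proof.
rewrite -[RHS](grading_B C (fD j)) split7 [X in _ = _ + X]big1 ?addr0 // => i _.
by have [_ ->] := cartanB_block j i; rewrite mulr0.
Qed.

Let gradingA j : \sum_i cA i * (cartanB (fA i) (fA j))%:~R = 1.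
Proof.
rewrite -[RHS](grading_B C (fA j)) split7 [X in _ = X + _]big1 ?add0r // => i _.
by have [-> _] := cartanB_block i j; rewrite mulr0.
Qed.

Lemma hwv_ext r d (E H : 'I_r -> 'M[C]_d) m m' v : (forall i, m i = m' i) ->
  hwv E H m v -> hwv E H m' v.
Proof. by move=> mm [v0 Ev Hv]; split=> // i; rewrite -mm. Qed.

Lemma weightDE (a : branching_index k) i : weightD6 a i = wa a (fD i).
Proof. by case: i => -[|[|[|[|[|[|i]]]]]] i6. Qed.

Lemma weightAE (a : branching_index k) i : weightA1 a i = wa a (fA i).
Proof. by rewrite (ord1 i). Qed.

(** The action on the stable image of [Q], written with a left inverse [L]; stability of the image
    gives multiplicativity, and the entries stay polynomial. *)
Lemma rational_compress dV (V : 'M[C]_n -> 'M[C]_dV) (K K' : 'M[C]_n -> Prop) d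
    (L : 'M[C]_(d, dV)) (Q : 'M[C]_(dV, d)) :
  (forall g, K' g -> K g) -> rational_rep K V -> L *m Q = 1%:M ->
  (forall g, K' g -> V g *m Q = Q *m (L *m V g *m Q)) ->
  rational_rep K' (fun g => L *m V g *m Q).
Proof.
move=> KK [V1 VM Vp] LQ VQ; split.
- by rewrite V1 mulmx1.
- move=> g h Kg Kh; rewrite VM; try exact: KK.
  by rewrite mulmxA -(mulmxA (L *m V g)) {1}(VQ h Kh) !mulmxA.
move=> i j; have [p pP] := boolp.choice (fun ij => Vp ij.1 ij.2).
exists (\sum_l \sum_l' (L i l' * Q l j) *: p (l', l)) => g Kg.
rewrite mxE raddf_sum; apply: eq_bigr => l _; rewrite mxE mulr_suml raddf_sum.
apply: eq_bigr => l' _; rewrite /= mevalZ -(pP (l', l)) /=; last exact: KK.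
by rewrite mulrAC.
Qed.

Variables (dV : nat) (V : 'M[C]_n -> 'M[C]_dV) (D : 'M[C]_n -> 'M[C]_dV).
Variable (P : 'M[C]_(dk 56 k, dV)).
Hypotheses (rV : rational_rep (groupE7 X) V) (dD : differential X alpha V D).
Hypotheses (Pinj : forall x : 'cV_dV, P *m x = 0 -> x = 0)
  (PC : forall y, C0 y <-> exists x, y = P *m x)
  (PE : forall i, P *m D (Eb X i) = Dk k (eb1 C i) *m P)
  (PG : forall i, P *m D (Gb X i) = Dk k (fb1 C i) *m P)
  (PH : forall i, P *m D (Hb X i) = Dk k (hb1 C i) *m P).
Variables (a : branching_index k) (x : 'cV[C]_(dk 56 k)).
Hypotheses (Cx : C0 x)
  (hx : hwv (fun i => Dk k (eb1 C i)) (fun i => Dk k (hb1 C i)) (wa a) x)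
  (irx : irrmod (fun i => Dk k (eb1 C i)) (fun i => Dk k (fb1 C i)) (hcomp x)).
Variables (dW dU : nat) (W : 'M[C]_n -> 'M[C]_dW) (U : 'M[C]_n -> 'M[C]_dU).
Hypotheses (WP : irreducible_of_hw X betaD6 (weightD6 a) W)
  (UP : irreducible_of_hw X betaA1 (weightA1 a) U).

Let Pcan (d : nat) (A B : 'M[C]_(dV, d)) : P *m A = P *m B -> A = B.
Proof.
move=> AB; apply: mx_ext => z; apply/eqP; rewrite -subr_eq0; apply/eqP/Pinj.
by rewrite mulmxBr !mulmxA AB subrr.
Qed.

Lemma component : exists (Q : 'M[C]_(dV, dW * dU)) tau,
  [/\ forall z : 'cV_(dW * dU), Q *m z = 0 -> z = 0,
      forall y, hcomp x y <-> exists z : 'cV_(dW * dU), y = P *m (Q *m z),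
      forall g, groupH X g -> V g *m Q = Q *m tau g
    & is_outer_tensor X W U tau].
Proof.
have [DW [w [dW' chW hw irW]]] := factor_module fD_inj betaDE WP.
have [DU [u [dU' chU hu irU]]] := factor_module fA_inj betaAE UP.
have {}hw := hwv_ext (weightDE a) hw; have {}hu := hwv_ext (weightAE a) hu.
have a12 i j := (cartanB_block i j).1; have a21 i j := (cartanB_block j i).2.
have cho := @outer_chev C 6 1 cartanB a12 a21 _ _ _ _ _ _ _ _ chW chU.
have ho := @outer_hwv C 6 1 _ _ _ _ _ _ (wa a) _ _ hw hu.
have iro := @outer_irr C 6 1 cartanB _ cD cA cartanB_diag a12 a21 (grading_B C)
  gradingD gradingA _ _ _ _ _ _ _ _ chW chU _ _ _ hw hu irW irU.
set oE := outer _ _ in ho iro cho; set oG := outer _ _ in iro cho; set oH := outer _ _ in ho cho.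
have [Pa [PaE PaG _ Painj Paim]] := hw_embedding (grading_B C) cho
  (chev_Dk k (model_chev_beta C)) ho hx iro irx.
(* The image of [Pa] is in [C0], the image of the injective [P], so [Pa] factors through [P]. *)
have [Q QP] : exists Q : 'M[C]_(dV, dW * dU), forall z : 'cV_(dW * dU),
    P *m (Q *m z) = Pa *m z.
  apply: (@lin_fun_mx _ _ _ (fun z y => P *m y = Pa *m z)).
  - move=> z; have [|y yE] := (PC (Pa *m z)).1; last by exists y.
    by apply: (cyc_C0 Cx); apply/Paim; exists z.
  - move=> z y y' <- e; apply/eqP; rewrite -subr_eq0; apply/eqP/Pinj.
    by rewrite mulmxBr e subrr.
  - by move=> c z y z' y' e e'; rewrite !mulmxDr -!scalemxAr e e'.
have PQ : P *m Q = Pa by apply: mx_ext => z; rewrite -mulmxA QP.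
have Qinj (z : 'cV_(dW * dU)) : Q *m z = 0 -> z = 0.
  by move=> Qz; apply: Painj; rewrite -QP Qz mulmx0.
have QE i : D (Eb X i) *m Q = Q *m oE i.
  by apply: Pcan; rewrite !mulmxA PE -(mulmxA _ P) PQ PaE.
have QG i : D (Gb X i) *m Q = Q *m oG i.
  by apply: Pcan; rewrite !mulmxA PG -(mulmxA _ P) PQ PaG.
have [L LQ] := row_fullP (inj_row_full Qinj).
pose tau g := L *m V g *m Q.
pose S y := exists z : 'cV_(dW * dU), y = Q *m z.
have Sl : lin S.
  split; first by exists 0; rewrite mulmx0.
  by move=> c _ _ [z ->] [z' ->]; exists (c *: z + z'); rewrite mulmxDr -scalemxAr.
have SE : stab (fun i => D (Eb X i)) S.
  by move=> i _ [z ->]; exists (oE i *m z); rewrite !mulmxA QE.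
have SG : stab (fun i => D (Gb X i)) S.
  by move=> i _ [z ->]; exists (oG i *m z); rewrite !mulmxA QG.
have SH : stab (fun i => D (Hb X i)) S.
  have QH i : D (Hb X i) *m Q = Q *m oH i.
    apply: Pcan; rewrite !mulmxA PH -(mulmxA _ P) PQ.
    exact/esym/(chev_intertwine_H cho (chev_Dk k (model_chev_beta C)) PaE PaG).
  by move=> i _ [z ->]; exists (oH i *m z); rewrite !mulmxA QH.
(* The image of [Q] is stable under the Lie algebra of [H], hence under the whole group, torus
   included; so [tau] is defined without decomposing elements of [H]. *)
have tauP g : groupH X g -> V g *m Q = Q *m tau g.
  move=> Hg; apply: mx_ext => z; rewrite -!mulmxA.
  have [|y yE] := groupH_stable rV dD Sl SE SG SH Hg (x := Q *m z); first by exists z.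
  by rewrite yE (mulmxA L) LQ mul1mx.
exists Q, tau; split=> //.
  move=> y; split=> [/Paim[z ->]|[z ->]]; first by exists z; rewrite QP.
  by rewrite QP; apply/Paim; exists z.
split; first exact: (rational_compress (@groupH_E7 _ _ X) rV LQ tauP).
have [rW _ _] := WP; have [rU _ _] := UP.
have iW : forall g, factorD6 X g -> V g *m Q = Q *m (W g *t 1%:M).
  apply: (factor_intertwine fD_inj betaDE (T := fun A => A *t 1%:M) rV dD rW dW').
  - exact: tens11.
  - by move=> A B; rewrite tensmx_mul mulmx1.
  - move=> Y nY; have [n1 e1] := exp_tensl dU nY; split=> // t.
    by have [_ <-] := exp_tensl dU (nilmxZ t nY); rewrite tensZl.
  - by move=> i; rewrite QE /oE -[fD i]/(lshift 1 i) outer_l.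
  - by move=> i; rewrite QG /oG -[fD i]/(lshift 1 i) outer_l.
have iU : forall g, factorA1 X g -> V g *m Q = Q *m (1%:M *t U g).
  apply: (factor_intertwine fA_inj betaAE (T := fun A => 1%:M *t A) rV dD rU dU').
  - exact: tens11.
  - by move=> A B; rewrite tensmx_mul mulmx1.
  - move=> Y nY; have [n1 e1] := exp_tensr dW nY; split=> // t.
    by have [_ <-] := exp_tensr dW (nilmxZ t nY); rewrite tensZr.
  - by move=> i; rewrite QE /oE -[fA i]/(rshift 6 i) outer_r.
  - by move=> i; rewrite QG /oG -[fA i]/(rshift 6 i) outer_r.
move=> g h Dg Ah; have [_ VM _] := rV.
have Hg := factor_groupH betaDE Dg; have Hh := factor_groupH betaAE Ah.
rewrite /tau VM; try exact: groupH_E7.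
rewrite -!mulmxA iU // !mulmxA -(mulmxA L) iW // mulmxA LQ mul1mx.
by rewrite tensmx_mul mulmx1 mul1mx.
Qed.

End Component.

(** * Assembling the components *)

Lemma sum_enum_val (V : nmodType) (I : finType) (F : I -> V) :
  \sum_(i < #|I|) F (enum_val i) = \sum_i F i.
Proof.
rewrite (reindex_onto enum_rank enum_val) => [|i _]; last by rewrite enum_valK.
by apply: eq_big => i; rewrite enum_rankK ?eqxx.
Qed.

Lemma branching (C : numClosedFieldType) (n : nat) (X : E7_realization C n) (k : nat)
    (dV : nat) (V : 'M[C]_n -> 'M[C]_dV) (dW dU : branching_index k -> nat)
    (W : forall a : branching_index k, 'M[C]_n -> 'M[C]_(dW a))
    (U : forall a : branching_index k, 'M[C]_n -> 'M[C]_(dU a)) :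
  irreducible_of_hw X alpha (weightE7 k) V ->
  (forall a, irreducible_of_hw X betaD6 (weightD6 a) (W a)) ->
  (forall a, irreducible_of_hw X betaA1 (weightA1 a) (U a)) ->
  exists tau : forall a : branching_index k, 'M[C]_n -> 'M[C]_(dW a * dU a),
    (forall a, is_outer_tensor X (W a) (U a) (tau a)) /\
    rep_iso (groupH X) V (rep_dsum tau).
Proof.
move=> VP WP UP; have [rV _ _] := VP.
have [D [P [dD Pinj PC [PE PG] PH]]] := model_embedding VP.
have [x [Cx hx irx orth dec]] := C0_decomposition C k.
have H a := component rV dD Pinj PC PE PG PH (Cx a) (hx a) (irx a) (WP a) (UP a).
(* The types of [Q a] and [tau a] depend on [a], so the witnesses are picked pointwise. *)
pose Q a := sval (boolp.cid (H a)); have QP a := svalP (boolp.cid (H a)).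
pose tau a := sval (boolp.cid (QP a)).
have tauP a : [/\ forall z : 'cV_(dW a * dU a), Q a *m z = 0 -> z = 0,
    forall y, hcomp (x a) y <-> exists z : 'cV_(dW a * dU a), y = P *m (Q a *m z),
    forall g, groupH X g -> V g *m Q a = Q a *m tau a g
  & is_outer_tensor X (W a) (U a) (tau a)] := svalP (boolp.cid (QP a)).
exists tau; split=> [a|]; first by have [] := tauP a.
(* This block row is onto because the components span [C0], and injective because they are pairwise
   orthogonal there. *)
exists (\mxrow_i Q (enum_val i)); split.
- apply: surj_row_free => y; have [|w [wP Pw]] := dec (P *m y); first by apply/PC; exists y.
  have [z zP] : exists z : forall a, 'cV_(dW a * dU a), forall a, w a = P *m (Q a *m z a).
    have ex a : exists z : 'cV_(dW a * dU a), w a = P *m (Q a *m z).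
      by have [_ im _ _] := tauP a; apply/im.
    by exists (fun a => sval (boolp.cid (ex a))) => a; exact: svalP (boolp.cid (ex a)).
  exists (\mxcol_i z (enum_val i)); rewrite mul_mxrow_mxcol.
  rewrite (sum_enum_val (fun a => Q a *m z a)); apply/eqP; rewrite -subr_eq0; apply/eqP/Pinj.
  rewrite mulmxBr Pw mulmx_sumr -sumrB big1 // => a _.
  by rewrite zP subrr.
- apply: inj_row_full => z; rewrite -[z]submxcolK mul_mxrow_mxcol => z0.
  have zi i : submxcol z i = 0.
    have [Qinj _ _ _] := tauP (enum_val i); apply/Qinj/Pinj/dot_eq0.
    pose y j := P *m (Q (enum_val j) *m submxcol z j).
    have cy j : hcomp (x (enum_val j)) (y j).
      by have [_ im _ _] := tauP (enum_val j); apply/im; exists (submxcol z j).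
    have := congr1 (fun t => dot (y i) (P *m t)) z0.
    rewrite mulmx_sumr mulmx0 dot0r (bigD1 i) //= -[X in X + _]scale1r dotDr mul1r => <-.
    rewrite -[LHS]addr0; congr (_ + _); apply/esym.
    elim/big_rec: _ => [|j t ji t0]; first exact: dot0r.
    rewrite -[X in X + _]scale1r dotDr t0 addr0 mul1r.
    by apply: (orth _ _ _ _ _ (cy i) (cy j)); rewrite (inj_eq enum_val_inj) eq_sym.
  by apply/matrixP => p q; rewrite mxE zi !mxE.
- move=> g Hg; rewrite mul_mxrow mul_mxrow_mxdiag; congr mxrow.
  by apply: boolp.functional_extensionality_dep => i; have [_ _ + _] := tauP (enum_val i); apply.
Qed.

Theorem theorem28 (R : realType) (n : nat) (X : E7_realization R[i] n) (k : nat)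
    (dV : nat) (V : 'M[R[i]]_n -> 'M[R[i]]_dV)
    (dW dU : branching_index k -> nat)
    (W : forall a : branching_index k, 'M[R[i]]_n -> 'M[R[i]]_(dW a))
    (U : forall a : branching_index k, 'M[R[i]]_n -> 'M[R[i]]_(dU a)) :
  irreducible_of_hw X alpha (weightE7 k) V ->
  (forall a, irreducible_of_hw X betaD6 (weightD6 a) (W a)) ->
  (forall a, irreducible_of_hw X betaA1 (weightA1 a) (U a)) ->
  exists tau : forall a : branching_index k,
      'M[R[i]]_n -> 'M[R[i]]_(dW a * dU a),
    (forall a, is_outer_tensor X (W a) (U a) (tau a)) /\
    rep_iso (groupH X) V (rep_dsum tau).
Proof. exact: (@branching R[i]). Qed.
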